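(* Assume the standing setting described in the context (the set $\mathcal{O}$, the operators $\mathcal{L}_k$, the functions $f_k$, $\zeta_k$, the functionals $h_k$ and the parameters $\lambda_k,\eta_k\ge 0$, for $k=1,\dots,m$). Suppose that there exists a finite sequence $\varrho=\{\rho_k\}_{k=1}^m\subseteq(0,\infty)$ such that, for every $k=1,\dots,m$, the following conditions hold: (a) $f_k$ is continuous on $\overline{\mathcal{O}}\times I(\varrho)\times R(\varrho)$, and there exists $\tau_k\in(0,+\infty)$ such that $$0\le f_k(x,\mathbf{z},\mathbf{w})\le\tau_kz_k\quad\text{for every }(x,\mathbf{z},\mathbf{w})\in\overline{\mathcal{O}}\times I(\varrho)\times R(\varrho);$$ (b) $h_k$ is continuous on $P(\varrho)$ and there exists $\xi_k\in(0,+\infty)$ such that $$h_k[\mathbf{u}]\le\xi_k\|\mathbf{u}\|_\infty\quad\text{for every }\mathbf{u}\in P(\varrho);$$ (c) the following inequality holds: $$\lambda_k\tau_k\|\mathcal{G}_k(\hat1)\|_\infty+\eta_k\xi_k\|\gamma_k\|_\infty<1.$$ Then the system $$\begin{cases}\mathcal{L}_k u_k=\lambda_k f_k(x,u_1,\dots,u_m,\nabla u_1,\dots,\nabla u_m)&\text{in }\mathcal{O},\quad k=1,\dots,m,\\ u_k(x)=\eta_k\zeta_k(x)h_k[u_1,\dots,u_m]&\text{for }x\in\partial\mathcal{O},\quad k=1,\dots,m,\end{cases}$$ has at most the zero (weak) solution in $P(\varrho)$.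
   Context: Standing setting. $m\ge1$ is a fixed natural number. $\mathcal{O}\subseteq\mathbb{R}^n$ is open, bounded, connected and of class $C^{1,\alpha}$ for some $\alpha\in(0,1)$. For every $k=1,\dots,m$: - $\mathcal{L}_k$ is the divergence-form operator $\mathcal{L}_k u=-\sum_{i,j=1}^n\partial_{x_i}\big(a^{(k)}_{i,j}(x)\partial_{x_j}u+b^{(k)}_i(x)u\big)+\sum_{i=1}^n c^{(k)}_i(x)\partial_{x_i}u+d^{(k)}(x)u$, whose coefficient functions belong to $C^{1,\alpha}(\overline{\mathcal{O}},\mathbb{R})$; the matrix $(a^{(k)}_{i,j}(x))_{i,j}$ is symmetric for every $x\in\mathcal{O}$; there exists $\Lambda_k>0$ with $\frac1{\Lambda_k}\|\xi\|^2\le\sum_{i,j}a^{(k)}_{i,j}(x)\xi_i\xi_j\le\Lambda_k\|\xi\|^2$ for all $x\in\mathcal{O}$, $\xi\in\mathbb{R}^n\setminus\{0\}$ (Euclidean norm); and for every non-negative $\varphi\in C_0^\infty(\mathcal{O},\mathbb{R})$ one has $\int_{\mathcal{O}}(d^{(k)}\varphi+\sum_i b^{(k)}_i\partial_{x_i}\varphi)\,dx\ge0$ and $\int_{\mathcal{O}}(d^{(k)}\varphi+\sum_i c^{(k)}_i\partial_{x_i}\varphi)\,dx\ge0$. - $f_k$ is a real-valued function on $\overline{\mathcal{O}}\times\mathbb{R}^m\times\mathbb{R}^{nm}$; $h_k$ is a real-valued functional on $C^1(\overline{\mathcal{O}},\mathbb{R}^m)$; $\zeta_k\in C^{1,\alpha}(\overline{\mathcal{O}},\mathbb{R})$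 with $\zeta_k\ge0$ on $\mathcal{O}$; $\lambda_k,\eta_k$ are non-negative real parameters. Linear problems. For an operator $\mathcal{L}u=-\mathrm{div}(A\nabla u+\mathbf{b}u)+\langle\mathbf{c},\nabla u\rangle+du$ of this kind, $f\in C(\overline{\mathcal{O}},\mathbb{R})$ and $g\in C^{1,\alpha}(\overline{\mathcal{O}},\mathbb{R})$, a solution of $\mathcal{L}u=f$ in $\mathcal{O}$, $u|_{\partial\mathcal{O}}=g$, is a function $u\in W^{1,2}(\mathcal{O})$ with $u-g\in W^{1,2}_0(\mathcal{O})$ and $\int_{\mathcal{O}}(\langle A\nabla u+\mathbf{b}u,\nabla\phi\rangle+\langle\mathbf{c},\nabla u\rangle\phi+du\phi)\,dx=\int_{\mathcal{O}}f\phi\,dx$ for all $\phi\in C_0^\infty(\mathcal{O},\mathbb{R})$. Since $\mathcal{O}$ is open, bounded, connected and of class $C^{1,\alpha}$, the coefficients $a_{i,j},b_i,c_i,d$ of $\mathcal{L}$ belong to $C^{1,\alpha}(\overline{\mathcal{O}},\mathbb{R})$, the matrix $A(x)=(a_{i,j}(x))_{i,j}$ is symmetric for every $x\in\mathcal{O}$, there is $\Lambda>0$ with $\frac1{\Lambda}\|\xi\|^2\le\sum_{i,j}a_{i,j}(x)\xi_i\xi_j\le\Lambda\|\xi\|^2$ for all $x\in\mathcal{O}$, $\xi\in\mathbb{R}^n\setminus\{0\}$, and $\int_{\mathcal{O}}(d\varphi+\sum_i b_i\partial_{x_i}\varphi)\,dx\ge0$ and $\int_{\mathcal{O}}(d\varphi+\sum_i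 c_i\partial_{x_i}\varphi)\,dx\ge0$ for every non-negative $\varphi\in C_0^\infty(\mathcal{O},\mathbb{R})$, the solution exists, is unique, and (up to a.e. equality) belongs to $C^{1,\alpha}(\overline{\mathcal{O}},\mathbb{R})$. - $\mathcal{G}_k:C(\overline{\mathcal{O}},\mathbb{R})\to C^{1,\alpha}(\overline{\mathcal{O}},\mathbb{R})$ is the Green operator: $\mathcal{G}_k(f)$ is the unique solution of $\mathcal{L}_ku=f$ in $\mathcal{O}$, $u|_{\partial\mathcal{O}}=0$. - $\gamma_k\in C^{1,\alpha}(\overline{\mathcal{O}},\mathbb{R})$ is the unique solution of $\mathcal{L}_ku=0$ in $\mathcal{O}$, $u|_{\partial\mathcal{O}}=\zeta_k$. - $\hat1$ is the constant function equal to $1$. Notation. On $\mathbb{R}^s$, $|\mathbf{v}|:=\max_i|v_i|$. For scalar continuous functions, $\|\cdot\|_\infty$ is the maximum of the absolute value over $\overline{\mathcal{O}}$; for vector-valued $\mathbf{u}=(u_1,\dots,u_m)$, $\|\mathbf{u}\|_\infty:=\max_k\|u_k\|_\infty$. $D\mathbf{u}(x):=(\nabla u_1(x),\dots,\nabla u_m(x))$. For $\rho>0$, $R_\rho:=\{\mathbf{v}\in\mathbb{R}^n:|\mathbf{v}|\le\rho\}$. For $\varrho=\{\rho_k\}_{k=1}^m$: $I(\varrho):=\prod_{k=1}^m[0,\rho_k]$, $R(\varrho):=\prod_{k=1}^mR_{\rho_k}$, and $P(\varrho):=\{\mathbf{u}\in C^1(\overline{\mathcal{O}},\mathbb{R}^m):\mathbf{u}(x)\in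 I(\varrho)\text{ and }D\mathbf{u}(x)\in R(\varrho)\text{ for all }x\in\overline{\mathcal{O}}\}$. Weak solution. With $\mathcal{F}_k(\mathbf{u})(x):=f_k(x,\mathbf{u}(x),D\mathbf{u}(x))$, a function $\mathbf{u}\in C^1(\overline{\mathcal{O}},\mathbb{R}^m)$ is a (weak) solution of the system if $u_k=\lambda_k\mathcal{G}_k(\mathcal{F}_k(\mathbf{u}))+\eta_k\gamma_k\,h_k[\mathbf{u}]$ for every $k=1,\dots,m$. *)

(* Defs.v *)
From HB Require Import structures.
From mathcomp Require Import all_boot all_order all_algebra.
From mathcomp Require Import all_classical all_reals all_analysis.
Set Implicit Arguments.
Unset Strict Implicit.
Unset Printing Implicit Defensive.
Import Order.TTheory GRing.Theory Num.Theory.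
Import numFieldNormedType.Exports.
Local Open Scope classical_set_scope.
Local Open Scope ring_scope.

Section measurable_rV.
Variables (R : realType) (n : nat).

Let coor : 'I_n -> 'rV[R]_n -> measurableTypeR R := fun i x => x ord0 i.

Let rV_set0 : g_sigma_preimage coor set0.
Proof. exact: sigma_algebra0. Qed.

Let rV_setC A : g_sigma_preimage coor A -> g_sigma_preimage coor (~` A).
Proof. exact: sigma_algebraC. Qed.

Let rV_bigcup (F : _^nat) : (forall i, g_sigma_preimage coor (F i)) ->
  g_sigma_preimage coor (\bigcup_i (F i)).
Proof. exact: sigma_algebra_bigcup. Qed.

(* the product sigma-algebra, which is the Borel one *)
HB.instance Definition _ := @isMeasurable.Build default_measure_display
  'rV[R]_n (g_sigma_preimage coor) rV_set0 rV_setC rV_bigcup.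

Lemma measurable_coor (i : 'I_n) :
  measurable_fun [set: 'rV[R]_n] (fun x : 'rV[R]_n => x ord0 i : measurableTypeR R).
Proof.
move=> _ Y mY; rewrite setTI; apply: sub_sigma_algebra => /=.
rewrite -bigcup_seq/=; exists i => /=; first by rewrite mem_index_enum.
by exists Y => //; rewrite setTI.
Qed.

Lemma measurable_fun_rV d (T : measurableType d) (f : T -> 'rV[R]_n) :
  (forall i, measurable_fun [set: T] (fun t => f t ord0 i : measurableTypeR R)) ->
  measurable_fun [set: T] f.
Proof.
move=> mf _ A mA; rewrite setTI.
suff : g_sigma_preimage coor `<=` [set A | measurable (f @^-1` A)] by apply.
apply: smallest_sub.
  split => /=.
  - by rewrite preimage_set0.
  - by move=> B mB; rewrite setTD preimage_setC; exact: measurableC.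
  - by move=> F mF; rewrite preimage_bigcup; exact: bigcupT_measurable.
rewrite -bigcup_seq/=; apply: bigcup_sub => i _ _ [B mB <-].
by have := mf i measurableT _ mB; rewrite !setTI.
Qed.

End measurable_rV.

Section lebesgue_rV.
Variable R : realType.

Definition rV_cons n (p : measurableTypeR R * 'rV[R]_n) : 'rV[R]_n.+1 :=
  \row_i oapp (fun j => p.2 ord0 j) (p.1 : R) (unlift ord0 i).

Lemma measurable_rV_cons n : measurable_fun setT (@rV_cons n).
Proof.
apply: measurable_fun_rV => i; rewrite /rV_cons.
under eq_fun do rewrite mxE.
case: unliftP => [j _|_] /=; last exact: measurable_fst.
exact: (measurableT_comp (measurable_coor j) measurable_snd).
Qed.


Definition rV_uncons n (x : 'rV[R]_n.+1) : measurableTypeR R * 'rV[R]_n :=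
  (x ord0 ord0 : measurableTypeR R, \row_j x ord0 (lift ord0 j)).

Lemma rV_consK n : cancel (@rV_cons n) (@rV_uncons n).
Proof.
move=> [a x]; rewrite /rV_uncons /rV_cons/= mxE unlift_none/=; congr pair.
by apply/rowP => j; rewrite !mxE liftK.
Qed.

Lemma measurable_rV_uncons n : measurable_fun setT (@rV_uncons n).
Proof.
apply/measurable_fun_pairP; split; first exact: measurable_coor.
apply: measurable_fun_rV => i /=.
under eq_fun do rewrite mxE.
exact: measurable_coor.
Qed.

Section cons_measure.
Variables (n : nat) (mu : {sigma_finite_measure set 'rV[R]_n -> \bar R}).

Definition cons_measure : set 'rV[R]_n.+1 -> \bar R :=
  pushforward (@lebesgue_measure R \x mu)%E (@rV_cons n).

HB.instance Definition _ := Measure.copy cons_measure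
  (measure_function_pushforward__canonical__measure_function_Measure
     (@lebesgue_measure R \x mu)%E (@measurable_rV_cons n)).

Let cons_measure_sigma_finite : sigma_finite setT cons_measure.
Proof.
have /sigma_finiteP[F [TF ndF Foo]] := sigma_finiteT (@lebesgue_measure R).
have /sigma_finiteP[G [TG ndG Goo]] := sigma_finiteT mu.
exists (fun k => @rV_uncons n @^-1` (F k `*` G k)).
  rewrite -preimage_bigcup -[LHS](preimage_setT (@rV_uncons n)); congr (_ @^-1` _).
  rewrite -setXTT TF TG predeqE => -[x y]; split.
    move=> [/= [i _ Fix] [k _ Gky]]; exists (maxn i k) => //; split.
    - by move: x Fix; exact/subsetPset/ndF/leq_maxl.
    - by move: y Gky; exact/subsetPset/ndG/leq_maxr.
  by move=> [i _ []/= ? ?]; split; exists i.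
move=> k; have [mF Fk] := Foo k; have [mG Gk] := Goo k; split.
  rewrite -[X in measurable X]setTI; apply: measurable_rV_uncons => //.
  exact: measurableX.
rewrite /cons_measure /pushforward -comp_preimage.
rewrite (_ : _ \o _ = id) ?preimage_id; last first.
  by apply/funext => p; exact: rV_consK.
by rewrite product_measure1E// lte_mul_pinfty// ge0_fin_numE.
Qed.

HB.instance Definition _ := Measure_isSigmaFinite.Build _ _ _ cons_measure
  cons_measure_sigma_finite.
End cons_measure.

Fixpoint lebesgue_rV (n : nat) : {sigma_finite_measure set 'rV[R]_n -> \bar R} :=
  match n with
  | 0 => dirac (0 : 'rV[R]_0)
  | n'.+1 => cons_measure (lebesgue_rV n')
  end.

Lemma lebesgue_rV_box n (A : 'I_n -> set (measurableTypeR R)) :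
  (forall i, measurable (A i)) ->
  lebesgue_rV n [set x | forall i, A i (x ord0 i)] =
  (\big[*%E/1%E]_(i < n) @lebesgue_measure R (A i))%E.
Proof.
elim: n A => [|n IHn] A mA.
  by rewrite big_ord0 /= diracE mem_set// => -[].
rewrite big_ord_recl -(IHn (fun i => A (lift ord0 i)))//= /cons_measure.
rewrite /pushforward -product_measure1E//.
- congr (_ _); apply/seteqP; split => -[a x] /=.
    move=> Aax; split => [|i].
      by have := Aax ord0; rewrite /rV_cons mxE unlift_none.
    by have := Aax (lift ord0 i); rewrite /rV_cons mxE liftK.
  move=> [Aa Ax] i; rewrite /rV_cons mxE.
  by case: unliftP => [j ->|->] /=.
- rewrite [X in measurable X](_ : _ = \bigcap_(i in setT)
    ((fun x : 'rV[R]_n => x ord0 i : measurableTypeR R) @^-1`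
       A (lift ord0 i))).
    apply: fin_bigcap_measurable; first exact: finite_finset.
    by move=> i _; rewrite -[X in measurable X]setTI; exact: measurable_coor.
  by apply/seteqP; split => x /= Ax i; [move=> _; exact: Ax|exact: (Ax i I)].
Qed.

End lebesgue_rV.

Section domains.
Variables (R : realType) (n : nat).
Implicit Types (O : set 'rV[R]_n) (u phi : 'rV[R]_n -> R).

Definition partial (i : 'I_n) u (x : 'rV[R]_n) : R :=
  'D_(delta_mx ord0 i) u x.

Definition grad u (x : 'rV[R]_n) : 'rV[R]_n := \row_i partial i u x.

Definition smooth u :=
  forall s : seq 'I_n, let v := foldr partial u s in
    continuous v /\ forall i x, derivable v x (delta_mx ord0 i).

(* C_0^oo(O), every function being extended by 0 outside O *)
Definition test_function O phi :=
  let supp := closure [set x | phi x != 0] in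
  [/\ smooth phi, compact supp & supp `<=` O].

(* A function on the closure of O is represented by a total function on R^n
   whose values outside the closure of O play no role. *)
Definition Cbar O u := {within closure O, continuous u}.

(* The gradient has a continuous extension g to the closure of O. *)
Definition C1bar O u :=
  [/\ Cbar O u,
      forall x i, O x -> derivable u x (delta_mx ord0 i) &
      exists2 g : 'rV[R]_n -> 'rV[R]_n, {within closure O, continuous g} &
        forall x, O x -> g x = grad u x].

(* The gradient on the closure of O: for u in C1bar O it is the unique
   continuous extension of grad u from O to closure O. *)
Definition gradbar O u (x : 'rV[R]_n) : 'rV[R]_n :=
  lim (grad u y @[y --> within O (nbhs x)]).

Definition C1abar (alpha : R) O u :=
  C1bar O u /\
  exists C : R, forall x y, O x -> O y ->
    `|grad u x - grad u y| <= C * `|x - y| `^ alpha.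

(* C^{1,alpha} maps of an open set U: first derivatives are Hoelder
   continuous locally in U. *)
Definition C1a_map (alpha : R) (U : set 'rV[R]_n)
    (psi : 'rV[R]_n -> 'rV[R]_n) :=
  (forall x i, U x -> derivable psi x (delta_mx ord0 i)) /\
  forall x, U x -> exists r C : R, 0 < r /\
    forall i y z, (U `&` ball x r) y -> (U `&` ball x r) z ->
      `|'D_(delta_mx ord0 i) psi y - 'D_(delta_mx ord0 i) psi z|
        <= C * `|y - z| `^ alpha.

(* Gilbarg and Trudinger, Section 6.2: the boundary is locally straightened
   by C^{1,alpha} diffeomorphisms psi (with inverse psi'), O being sent into
   the half-space y_k > 0 and its boundary into the hyperplane y_k = 0. *)
Definition C1a_domain (alpha : R) O :=
  forall x0, (closure O `\` interior O) x0 ->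
  exists (r : R) (D : set 'rV[R]_n) (psi psi' : 'rV[R]_n -> 'rV[R]_n)
         (k : 'I_n),
    let B := ball x0 r in
    [/\ 0 < r /\ open D,
        psi @` B = D /\ (forall x, B x -> psi' (psi x) = x),
        forall x, (B `&` O) x -> 0 < psi x ord0 k,
        forall x, (B `&` (closure O `\` interior O)) x -> psi x ord0 k = 0 &
        C1a_map alpha B psi /\ C1a_map alpha D psi'].

End domains.

Section sobolev.
Variables (R : realType) (n : nat).
Implicit Types (O : set 'rV[R]_n) (u phi : 'rV[R]_n -> R)
  (Du : 'rV[R]_n -> 'rV[R]_n).
Local Notation mu := (lebesgue_rV R n).

Definition L2 O u :=
  measurable_fun O u /\ mu.-integrable O (fun x => (u x ^+ 2)%:E).

(* u is in W^{1,2}(O) with weak gradient Du *)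
Definition weak_gradient O u Du :=
  [/\ L2 O u, forall i, L2 O (fun x => Du x ord0 i) &
      forall phi i, test_function O phi ->
        \int[mu]_(x in O) (u x * partial i phi x)
        = - \int[mu]_(x in O) (Du x ord0 i * phi x)].

(* W^{1,2}_0(O): the closure of C_0^oo(O) in W^{1,2}(O) *)
Definition W12_0 O u :=
  exists2 Du, weak_gradient O u Du &
  exists2 phi : nat -> 'rV[R]_n -> R, (forall j, test_function O (phi j)) &
    (fun j => \int[mu]_(x in O) ((u x - phi j x) ^+ 2)
       + \sum_i \int[mu]_(x in O) ((Du x ord0 i - partial i (phi j) x) ^+ 2))
      @ \oo --> (0 : R).

(* L u = - div (A grad u + b u) + <c, grad u> + d u *)
Record operator := Operator {
  opA : 'rV[R]_n -> 'M[R]_n ;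
  opb : 'rV[R]_n -> 'rV[R]_n ;
  opc : 'rV[R]_n -> 'rV[R]_n ;
  opd : 'rV[R]_n -> R }.

Definition admissible (alpha : R) O (L : operator) :=
  [/\ [/\ forall i j, C1abar alpha O (fun x => opA L x i j),
          forall i, C1abar alpha O (fun x => opb L x ord0 i),
          forall i, C1abar alpha O (fun x => opc L x ord0 i) &
          C1abar alpha O (opd L)],
      forall x, O x -> (opA L x)^T = opA L x,
      exists2 Lambda : R, 0 < Lambda &
        forall x (xi : 'rV[R]_n), O x -> xi != 0 ->
          let q := \sum_i \sum_j opA L x i j * xi ord0 i * xi ord0 j in
          let N := \sum_i xi ord0 i ^+ 2 in
          Lambda^-1 * N <= q <= Lambda * N,
      forall phi, test_function O phi -> (forall x, 0 <= phi x) ->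
        0 <= \int[mu]_(x in O) (opd L x * phi x
               + \sum_i opb L x ord0 i * partial i phi x) &
      forall phi, test_function O phi -> (forall x, 0 <= phi x) ->
        0 <= \int[mu]_(x in O) (opd L x * phi x
               + \sum_i opc L x ord0 i * partial i phi x)].

(* u solves L u = f in O, u = g on the boundary of O *)
Definition dirichlet_solution O (L : operator) (f g u : 'rV[R]_n -> R) :=
  exists Du,
    [/\ weak_gradient O u Du, W12_0 O (fun x => u x - g x) &
        forall phi, test_function O phi ->
          \int[mu]_(x in O)
            (\sum_i (\sum_j opA L x i j * Du x ord0 j + opb L x ord0 i * u x)
                      * partial i phi x
             + (\sum_i opc L x ord0 i * Du x ord0 i) * phi x
             + opd L x * u x * phi x)
          = \int[mu]_(x in O) (f x * phi x)].

(* Uniqueness of the solution is a theorem for admissible operators; hence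
   this determines G f on the closure of O. *)
Definition green_operator (alpha : R) O (L : operator)
    (G : ('rV[R]_n -> R) -> 'rV[R]_n -> R) :=
  forall f, Cbar O f ->
    C1abar alpha O (G f) /\ dirichlet_solution O L f (fun=> 0) (G f).

End sobolev.

Section systems.
Variables (R : realType) (m n : nat).
Implicit Types (O : set 'rV[R]_n) (u v : 'rV[R]_n -> 'rV[R]_m)
  (rho : 'I_m -> R).

Definition supnorm O (w : 'rV[R]_n -> R) : R :=
  sup [set `|w x| | x in closure O].

Definition component u (k : 'I_m) : 'rV[R]_n -> R := fun x => u x ord0 k.

Definition supnormv O u : R := \big[Num.max/0]_(k < m) supnorm O (component u k).

Definition C1barv O u := forall k, C1bar O (component u k).

(* row k is the gradient of the k-th component *)
Definition jac O u (x : 'rV[R]_n) : 'M[R]_(m, n) :=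
  \matrix_(k, i) gradbar O (component u k) x ord0 i.

Definition normC1 O u : R :=
  Num.max (supnormv O u)
    (\big[Num.max/0]_(k < m) \big[Num.max/0]_(i < n)
        supnorm O (fun x => jac O u x k i)).

Definition Ibox rho : set 'rV[R]_m :=
  [set z | forall k, 0 <= z ord0 k <= rho k].

(* the norm of a row vector is the maximum of the `|w k i| *)
Definition Rbox rho : set 'M[R]_(m, n) :=
  [set w | forall k, `|row k w| <= rho k].

Definition Pset O rho : set ('rV[R]_n -> 'rV[R]_m) :=
  [set u | C1barv O u /\
    forall x, closure O x -> Ibox rho (u x) /\ Rbox rho (jac O u x)].

(* Continuity for the C^1 norm over the closure of O; in particular h u
   depends only on the values of u on the closure of O, for u in P. *)
Definition continuous_on_C1 O (P : set ('rV[R]_n -> 'rV[R]_m))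
    (h : ('rV[R]_n -> 'rV[R]_m) -> R) :=
  forall u, P u -> forall e : R, 0 < e -> exists2 d : R, 0 < d &
    forall v, P v -> normC1 O (fun x => v x - u x) < d -> `|h v - h u| < e.

Definition weak_solution O
    (f : 'I_m -> 'rV[R]_n -> 'rV[R]_m -> 'M[R]_(m, n) -> R)
    (h : 'I_m -> ('rV[R]_n -> 'rV[R]_m) -> R) (lambda eta : 'I_m -> R)
    (G : 'I_m -> ('rV[R]_n -> R) -> 'rV[R]_n -> R)
    (gamma : 'I_m -> 'rV[R]_n -> R) u :=
  C1barv O u /\
  forall k x, closure O x ->
    u x ord0 k = lambda k * G k (fun y => f k y (u y) (jac O u y)) x
                 + eta k * gamma k x * h k u.

End systems.

(* Main.v *)
Require Import Defs.
From mathcomp Require Import all_boot all_order all_algebra.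
From mathcomp Require Import all_classical all_reals all_analysis.
From mathcomp Require Import measurable_realfun.
From mathcomp Require Import ring lra.
Set Implicit Arguments.
Unset Strict Implicit.
Unset Printing Implicit Defensive.
Import Order.TTheory GRing.Theory Num.Theory.
Import numFieldNormedType.Exports.
Local Open Scope classical_set_scope.
Local Open Scope ring_scope.

(* If [s] is the sup norm of a solution [u], monotonicity of the Green operators
   and nonnegativity of the [gamma k] bound each component by
   [(lambda k * tau k * |G k 1| + eta k * xi k * |gamma k|) * s], which is
   smaller than [s] unless [s = 0].

   Both facts are instances of a weak maximum principle: if [L u = f >= 0] in
   [O] and [u = g >= 0] on the boundary, then [u >= 0]. The two sign conditions
   on the coefficients make the form coercive along truncations: with
   [w = - u] and [beta] nondecreasing, [beta = 0] on the negative axis, the test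
   function [beta w] gives
     [\int beta'(w) <A grad w, grad w> + (d J(w) + <c, grad J(w)>)
        + (d K(w) + <b, grad K(w)>) <= 0]
   where [J' = beta] and [K' = t beta'], and the last two terms are nonnegative;
   the Poincare inequality concludes. Since only smooth test functions are
   available, [w = (g - u) - g] is replaced by [psi - q], with [psi] a test
   function close to [g - u] in the Sobolev norm and [q >= 0] smooth and
   C^1-close to [g] on the support of [psi]; then [beta (psi - q)] is again a
   test function. The function [q] glues first-order Taylor polynomials of [g]
   with a smooth partition of unity subordinate to a fine grid. *)

(** * Smooth functions *)

(** Truncating [w] by its positive part would require a chain rule for Sobolev functions. The
    nonlinear computation is instead done only for the smooth function [p = psi - q]. The passage
    from [p] to [w] uses just the linearity of the form in its first argument and an integral error
    estimate. The profiles all come from [flat t = exp (- 1 / t)], which satisfies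
    [t ^ 2 * flat' t = flat t]. With [beta t = (1 + 2 * t) * flat t], the primitives [J] and [K]
    become explicit, and [J t + K t = t * beta t] shares the zero-order term between the two sign
    conditions. Moreover [flat' ^ 2 <= beta'], so the energy controls the gradient of the test
    function [flat p], and the Poincare inequality is applied to that function. A constant added to
    the glued Taylor polynomials makes [q >= 0] on the whole space. Hence [p > 0] forces [psi > 0],
    which is where the compact support of [beta p] comes from. If [k] bounds the squared Sobolev
    distance, replacing [w] by [p] costs a multiple of [(1 + 1 / t) * k + t] for any [t > 0]; taking
    [t = s] and [k = s ^ 2] leaves a multiple of [s]. *)

Section directional.
Variables (R : realType) (V : normedModType R).
Implicit Types (u w : V -> R) (x v : V).

(** Both difference quotients are the same function of the increment, so directional derivatives
    reduce to one-variable calculus along a line. *)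
Lemma is_derive_line u x v d :
  is_derive x v u d <-> is_derive (0 : R) 1 (fun t : R => u (t *: v + x)) d.
Proof.
have E : 'D_v u x = 'D_1 (fun t : R => u (t *: v + x)) 0.
  rewrite /derive; set a := (X in lim (X @ _) = _); set b := (X in _ = lim (X @ _)).
  suff -> : a = b by [].
  by apply/funext => h; rewrite /a /b /= addr0 scale0r add0r [_ *: 1]mulr1.
split=> -[du dE]; split.
- exact: (derivable1P u x v).1.
- by rewrite -E.
- exact: (derivable1P u x v).2.
- by rewrite E.
Qed.

(** On the line through [x] along [v] the chain rule is one-dimensional, so [u] needs only a
    derivative in the direction [v], not a differential. *)
Lemma is_derive_comp (F : R -> R) u x v dF du :
  is_derive (u x) 1 F dF -> is_derive x v u du ->
  is_derive x v (fun y => F (u y)) (dF * du).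
Proof.
move=> HF /is_derive_line Hu; apply/is_derive_line.
apply: (@is_derive1_comp R F (fun t : R => u (t *: v + x))) => //.
by rewrite scale0r add0r.
Qed.

End directional.

(** * Functions [p (1 / t) * exp (- 1 / t)], flat at the origin *)

Section flat_exponential.
Variable R : realType.
Implicit Types (p : {poly R}) (t : R).

(** The polynomial factor makes the family stable under differentiation: the derivative of the
    member given by [p] is the member given by [X ^ 2 * (p - p')]. *)
Definition flatp p t : R := if 0 < t then p.[t^-1] * expR (- t^-1) else 0.

(** Each step of the induction on [p] spends half of the rate [a] on the polynomial of lower degree
    and the other half on the new factor [s], so the statement has to hold for every rate. *)
Lemma horner_expR_bound p (a : R) : 0 < a ->
  exists2 C : R, 0 <= C & forall s : R, 0 <= s -> `|p.[s]| <= C * expR (a * s).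
Proof.
elim/poly_ind: p a => [|p c IH] a a0.
  by exists 0 => // s s0; rewrite horner0 normr0 mul0r.
have [C C0 HC] := IH (a / 2) (divr_gt0 a0 (ltr0Sn R 1)).
exists (C * (2 / a) + `|c|) => [|s s0].
  by rewrite addr_ge0// mulr_ge0// divr_ge0// ltW.
rewrite hornerMXaddC; apply: (le_trans (ler_normD _ _)); rewrite mulrDl lerD//; last first.
  rewrite ler_peMr//; apply: le_trans (expR_ge1Dx _).
  by rewrite lerDl mulr_ge0// ltW.
rewrite normrM (ger0_norm s0).
have Ea : expR (a * s) = expR (a / 2 * s) * expR (a / 2 * s).
  by rewrite -expRD; congr expR; field.
have s_le : s <= 2 / a * expR (a / 2 * s).
  rewrite -ler_pdivrMl; last by rewrite divr_gt0.
  rewrite invf_div; apply: le_trans (expR_ge1Dx _).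
  by rewrite lerDr.
rewrite Ea.
have -> : C * (2 / a) * (expR (a / 2 * s) * expR (a / 2 * s)) =
  (C * expR (a / 2 * s)) * (2 / a * expR (a / 2 * s)) by ring.
by apply: ler_pM => //; exact: HC.
Qed.

(** The only delicate point is the origin. There the difference quotient for [h > 0] is [h] times
    the value at [h^-1] of ['X^2 * p], times the exponential, hence at most [C * h]. *)
Lemma is_derive_flatp p t :
  is_derive t 1 (flatp p) (flatp ('X^2 * (p - p^`())) t).
Proof.
have [t0|t0|->] := ltgtP t 0.
- rewrite {2}/flatp ltNge (ltW t0) /=.
  apply: (near_eq_is_derive _ (is_derive_cst (0 : R) t 1)).
  near=> s; rewrite /flatp ltNge; suff -> : s <= 0 by [].
  by apply: ltW; near: s; exact: lt_nbhsl.
- rewrite {2}/flatp t0.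
  have dV : is_derive t 1 (fun s : R => s^-1) (- t ^- 2).
    have := @is_deriveV _ id t 1 1 (lt0r_neq0 t0) (is_derive_id _ _).
    by move/is_derive_eq; apply; rewrite [LHS]mulr1.
  have dP := @is_derive1_comp _ (horner p) _ t _ _ (is_derive_poly p t^-1) dV.
  have dN : is_derive t 1 (fun s : R => - s^-1) (t ^- 2).
    by have /is_derive_eq := is_deriveN dV; apply; rewrite opprK.
  have dE := @is_derive1_comp _ expR _ t _ _ (is_derive_expR (- t^-1)) dN.
  apply: is_derive_eq (near_eq_is_derive _ (is_deriveM dP dE)) _.
    near=> s; rewrite /flatp; suff -> : 0 < s by [].
    by near: s; exact: lt_nbhsr.
  rewrite /= -![_ *: _]/(_ * _) hornerM hornerXn hornerD hornerN /=.
  by rewrite exprVn; ring.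
rewrite {2}/flatp ltxx.
have [C C0 HC] := @horner_expR_bound ('X^2 * p) 1 ltr01.
suff H : (fun h : R => h^-1 *: ((flatp p \o shift 0) (h *: 1) - flatp p 0)) @ 0^'
    --> (0 : R).
  by split; [apply/cvg_ex; exists 0|exact/cvg_lim].
apply/cvgrPdist_le => e e0; near=> h.
have h0 : h != 0 by near: h; exact: nbhs_dnbhs_neq.
rewrite sub0r normrN /= addr0 [h *: 1]mulr1 {2}/flatp ltxx subr0 /flatp.
case: ifPn => [h_gt0|]; last by rewrite scaler0 normr0 ltW.
rewrite -[_ *: _]/(_ * _).
have -> : h^-1 * (p.[h^-1] * expR (- h^-1)) =
    h * (('X^2 * p).[h^-1] * expR (- h^-1)).
  by rewrite hornerM hornerXn; field.
rewrite normrM (gtr0_norm h_gt0) normrM [`|expR _|]gtr0_norm ?expR_gt0//.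
apply: (@le_trans _ _ (h * C)).
  rewrite ler_pM2l// expRN ler_pdivrMr ?expR_gt0//.
  by have := HC h^-1; rewrite mul1r; apply; rewrite invr_ge0 ltW.
(* The divisor is [C + 1] because [C] may vanish. *)
apply: (@le_trans _ _ (e / (C + 1) * C)).
  rewrite ler_wpM2r//; apply: le_trans (ler_norm _) _; near: h.
  apply: dnbhs0_le; rewrite divr_gt0// ltr_wpDl//.
rewrite mulrAC ler_pdivrMr ?ltr_wpDl// mulrDr mulr1 lerDl ltW//.
Unshelve. all: by end_near. Qed.

End flat_exponential.

(** * Stability of smoothness under algebraic operations and composition *)

Section smooth_functions.
Variables (R : realType) (n : nat).
Implicit Types (u w : 'rV[R]_n -> R).

(* The closure is stable under each [partial i], hence consists of smooth
   functions: this is how smoothness of products and composites is obtained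
   without a Leibniz formula for iterated derivatives. *)
Inductive smooth_closure : ('rV[R]_n -> R) -> Prop :=
| closure_smooth u : smooth u -> smooth_closure u
| closureD u w : smooth_closure u -> smooth_closure w ->
    smooth_closure (fun x => u x + w x)
| closureM u w : smooth_closure u -> smooth_closure w ->
    smooth_closure (fun x => u x * w x)
| closure_flatp p u : smooth u -> smooth_closure (fun x => flatp p (u x))
| closureV u : smooth u -> (forall x, u x != 0) ->
    smooth_closure (fun x => (u x)^-1).

Lemma smooth_cst (c : R) : smooth (fun _ : 'rV[R]_n => c).
Proof.
have partial_cst (d : R) i : partial i (fun _ : 'rV[R]_n => d) = fun=> 0.
  by apply/funext => x; rewrite /partial derive_cst.
move=> s /=.
have [d ->] : exists d : R, foldr (@partial R n) (fun _ : 'rV[R]_n => c) s = fun=> d.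
  elim: s => [|i s [d IH]]; first by exists c.
  by exists 0; rewrite /= IH partial_cst.
split=> [|i x]; [exact: cst_continuous|exact: derivable_cst].
Qed.

Lemma smooth_partial i u : smooth u -> smooth (partial i u).
Proof.
by move=> su s; have := su (rcons s i); rewrite foldr_rcons.
Qed.

Lemma smooth_continuous u : smooth u -> continuous u.
Proof. by move=> /(_ [::])[]. Qed.

Lemma smooth_is_derive u i x : smooth u ->
  is_derive x (delta_mx ord0 i) u (partial i u x).
Proof. by move=> /(_ [::])[_ du]; exact/derivableP/du. Qed.

Lemma smooth_closureP u : smooth_closure u -> continuous u /\
  forall i, exists2 d, smooth_closure d &
    forall x, is_derive x (delta_mx ord0 i) u (d x).
Proof.
elim=> {u} [u su|u w _ [cu du] _ [cw dw]|u w Su [cu du] Sw [cw dw]|p u su|u su u0].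
- split=> [|i]; first exact: smooth_continuous.
  exists (partial i u); first exact/closure_smooth/smooth_partial.
  by move=> x; exact: smooth_is_derive.
- split=> [x|i]; first by apply: continuousD; [exact: cu|exact: cw].
  have [d Sd Hd] := du i; have [e Se He] := dw i.
  by exists (fun x => d x + e x); [exact: closureD|move=> x; exact: is_deriveD].
- split=> [x|i]; first by apply: continuousM; [exact: cu|exact: cw].
  have [d Sd Hd] := du i; have [e Se He] := dw i.
  exists (fun x => u x * e x + w x * d x); last by move=> x; exact: is_deriveM.
  by apply: closureD; exact: closureM.
- split=> [x|i].
    apply: continuous_comp; first exact: smooth_continuous.
    apply/differentiable_continuous/derivable1_diffP.
    by have [] := is_derive_flatp p (u x).
  exists (fun x => flatp ('X^2 * (p - p^`())) (u x) * partial i u x).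
    apply: closureM; first exact: closure_flatp.
    exact/closure_smooth/smooth_partial.
  move=> x; apply: is_derive_comp; first exact: is_derive_flatp.
  exact: smooth_is_derive.
- split=> [x|i]; first by apply: continuousV => //; exact: smooth_continuous.
  exists (fun x => (u x)^-1 * (u x)^-1 * (- 1 * partial i u x)).
    apply: closureM; first by apply: closureM; exact: closureV.
    apply: closureM; apply: closure_smooth; first exact: smooth_cst.
    exact: smooth_partial.
  move=> x.
  have dV := @is_deriveV _ id (u x) 1 1 (u0 x) (is_derive_id _ _).
  apply: is_derive_eq (is_derive_comp dV (smooth_is_derive i x su)) _.
  by rewrite -[_ *: _]/(_ * _) -exprVn; ring.
Qed.

Lemma smooth_closure_smooth u : smooth_closure u -> smooth u.
Proof.
move=> Su s /=.
have {Su} : smooth_closure (foldr (@partial R n) u s).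
  elim: s => //= i s IH; have [_ /(_ i)[d Sd Hd]] := smooth_closureP IH.
  rewrite (_ : partial i _ = d)//; apply/funext => x.
  by rewrite /partial; exact: derive_val.
move=> /smooth_closureP[cu du]; split=> // i x.
by have [d _ /(_ x)[]] := du i.
Qed.

Lemma smoothD u w : smooth u -> smooth w -> smooth (fun x => u x + w x).
Proof.
by move=> *; apply: smooth_closure_smooth; apply: closureD; exact: closure_smooth.
Qed.

Lemma smoothM u w : smooth u -> smooth w -> smooth (fun x => u x * w x).
Proof.
by move=> *; apply: smooth_closure_smooth; apply: closureM; exact: closure_smooth.
Qed.

Lemma smoothN u : smooth u -> smooth (fun x => - u x).
Proof.
move=> su; rewrite (_ : (fun x => - u x) = (fun x => -1 * u x)).
  by apply: smoothM => //; exact: smooth_cst.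
by apply/funext => x; rewrite mulN1r.
Qed.

Lemma smoothB u w : smooth u -> smooth w -> smooth (fun x => u x - w x).
Proof. by move=> su sw; exact/smoothD/smoothN. Qed.

Lemma smooth_flatp p u : smooth u -> smooth (fun x => flatp p (u x)).
Proof. by move=> su; exact/smooth_closure_smooth/closure_flatp. Qed.

Lemma smoothV u : smooth u -> (forall x, u x != 0) -> smooth (fun x => (u x)^-1).
Proof. by move=> su u0; exact/smooth_closure_smooth/closureV. Qed.

Lemma smooth_sum (I : Type) (r : seq I) (F : I -> 'rV[R]_n -> R) :
  (forall i, smooth (F i)) -> smooth (fun x => \sum_(i <- r) F i x).
Proof.
move=> sF; elim: r => [|i r IH].
  rewrite (_ : (fun _ => _) = fun=> 0); first exact: smooth_cst.
  by apply/funext => x; rewrite big_nil.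
rewrite (_ : (fun _ => _) = fun x => F i x + \sum_(j <- r) F j x).
  exact: smoothD.
by apply/funext => x; rewrite big_cons.
Qed.

Lemma smooth_prod (I : Type) (r : seq I) (F : I -> 'rV[R]_n -> R) :
  (forall i, smooth (F i)) -> smooth (fun x => \prod_(i <- r) F i x).
Proof.
move=> sF; elim: r => [|i r IH].
  rewrite (_ : (fun _ => _) = fun=> 1); first exact: smooth_cst.
  by apply/funext => x; rewrite big_nil.
rewrite (_ : (fun _ => _) = fun x => F i x * \prod_(j <- r) F j x).
  exact: smoothM.
by apply/funext => x; rewrite big_cons.
Qed.

Lemma is_derive_coord (i j : 'I_n) (x : 'rV[R]_n) :
  is_derive x (delta_mx ord0 i) (fun y : 'rV[R]_n => y ord0 j) (i == j)%:R.
Proof.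
apply/is_derive_line.
rewrite (_ : (fun t : R => _) = (fun t : R => (i == j)%:R * t + x ord0 j)).
  pose k : R := (i == j)%:R.
  apply: is_derive_eq (is_deriveD (is_deriveZ k (is_derive_id (0 : R) 1))
    (is_derive_cst (x ord0 j) (0 : R) 1)) _.
  by rewrite addr0 [LHS]mulr1.
by apply/funext => t; rewrite !mxE eqxx /= mulrC eq_sym.
Qed.

Lemma smooth_coord (j : 'I_n) : smooth (fun x : 'rV[R]_n => x ord0 j).
Proof.
have E i : partial i (fun x : 'rV[R]_n => x ord0 j) = fun=> (i == j)%:R.
  by apply/funext => x; have := is_derive_coord i j x => dx; exact: derive_val.
(* [foldr] applies the last index first, and after one derivative a coordinate is constant. *)
move=> s; elim/last_ind: s => [|s i _] /=.
  by split=> [|i x]; [exact: coord_continuous|have [] := is_derive_coord i j x].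
by rewrite foldr_rcons E; exact: (smooth_cst _ s).
Qed.

End smooth_functions.

(** * Smooth approximation of C^1 functions *)

Section rV_norm.
Variables (R : realType) (n : nat).
Implicit Types (x : 'rV[R]_n).

Lemma coord_le_norm x i : `|x ord0 i| <= `|x|.
Proof.
rewrite /Num.norm /= mx_normrE.
exact: (le_bigmax _ (fun j => `|x j.1 j.2|) (ord0, i)).
Qed.

Lemma rV_norm_le x (e : R) : 0 <= e -> (forall i, `|x ord0 i| <= e) -> `|x| <= e.
Proof.
move=> e0 xe; rewrite /Num.norm /= mx_normrE.
by apply: bigmax_le => // -[i j] _ /=; rewrite ord1.
Qed.

Lemma rV_norm_lt x (e : R) : 0 < e -> (forall i, `|x ord0 i| < e) -> `|x| < e.
Proof.
move=> e0 xe; rewrite /Num.norm /= mx_normrE.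
by apply: bigmax_lt => // -[i j] _ /=; rewrite ord1.
Qed.

End rV_norm.

(** * A smooth step and the hat functions built from it *)

Section smooth_step.
Variable R : realType.
Implicit Types t : R.

Definition flat t : R := flatp 1 t.
Definition dflat t : R := flatp 'X^2 t.

Lemma flat_le0 t : t <= 0 -> flat t = 0.
Proof. by move=> t0; rewrite /flat /flatp ltNge t0. Qed.

Lemma dflat_le0 t : t <= 0 -> dflat t = 0.
Proof. by move=> t0; rewrite /dflat /flatp ltNge t0. Qed.

Lemma flatE t : 0 < t -> flat t = expR (- t^-1).
Proof. by move=> t0; rewrite /flat /flatp t0 hornerE mul1r. Qed.

Lemma dflatE t : 0 < t -> dflat t = t^-1 ^+ 2 * expR (- t^-1).
Proof. by move=> t0; rewrite /dflat /flatp t0 hornerXn. Qed.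

Lemma flat_gt0 t : 0 < t -> 0 < flat t.
Proof. by move=> t0; rewrite flatE// expR_gt0. Qed.

Lemma flat_ge0 t : 0 <= flat t.
Proof.
by have [t0|/flat_gt0/ltW//] := leP t 0; rewrite flat_le0.
Qed.

Lemma flat_le1 t : flat t <= 1.
Proof.
have [t0|t0] := leP t 0; first by rewrite flat_le0.
by rewrite flatE// expR_le1 oppr_le0 invr_ge0 ltW.
Qed.

Lemma is_derive_flat t : is_derive t 1 flat (dflat t).
Proof.
have := is_derive_flatp 1 t.
by rewrite /dflat derivC subr0 mulr1.
Qed.

Lemma dflat_ge0 t : 0 <= dflat t.
Proof.
have [t0|t0] := leP t 0; first by rewrite dflat_le0.
by rewrite dflatE// mulr_ge0 ?expR_ge0// sqr_ge0.
Qed.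

(** The quarter is chosen because [(1 + s / 4) ^ 2 - s] is the square of [1 - s / 4]; so [s] is at
    most the square of [expR (s / 4)], and squaring again gives the claim. *)
Lemma sqr_le_expR (s : R) : 0 <= s -> s ^+ 2 <= expR s.
Proof.
move=> s0; have -> : expR s = expR (s / 4) ^+ 4.
  by rewrite -expRM_natl; congr expR; field.
have h : 1 + s / 4 <= expR (s / 4) by exact: expR_ge1Dx.
have h2 : s <= (1 + s / 4) ^+ 2.
  by rewrite -subr_ge0 (_ : _ - _ = (1 - s / 4) ^+ 2) ?sqr_ge0//; field.
have h3 : (1 + s / 4) ^+ 2 <= expR (s / 4) ^+ 2.
  by rewrite ler_pXn2r// nnegrE ?expR_ge0// addr_ge0// divr_ge0.
rewrite -[4%N]/(2 * 2)%N exprM ler_pXn2r ?nnegrE ?exprn_ge0 ?expR_ge0//.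
exact: le_trans h2 h3.
Qed.

Lemma dflat_le1 t : dflat t <= 1.
Proof.
have [t0|t0] := leP t 0; first by rewrite dflat_le0.
rewrite dflatE// expRN ler_pdivrMr ?expR_gt0// mul1r.
by rewrite sqr_le_expR// invr_ge0 ltW.
Qed.

Definition step t : R := flat t / (flat t + flat (1 - t)).
Definition dstep t : R :=
  (dflat t * flat (1 - t) + flat t * dflat (1 - t)) / (flat t + flat (1 - t)) ^+ 2.

(** One of [t] and [1 - t] is at least one half, where [flat] is at least [expR (- 2)]. *)
Lemma step_den t : expR (- 2) <= flat t + flat (1 - t).
Proof.
have half (s : R) : 2^-1 <= s -> expR (- 2) <= flat s.
  move=> s2; have s0 : 0 < s by apply: lt_le_trans s2; rewrite invr_gt0.
  rewrite flatE// ler_expR lerN2 -[leRHS]invrK lef_pV2 ?posrE// invr_gt0//.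
have [t2|t2] := leP 2^-1 t; first by rewrite ler_wpDr ?flat_ge0// half.
by rewrite ler_wpDl ?flat_ge0// half//; lra.
Qed.

Lemma step_den_gt0 t : 0 < flat t + flat (1 - t).
Proof. by apply: lt_le_trans (step_den t); exact: expR_gt0. Qed.

Lemma is_derive_step t : is_derive t 1 step (dstep t).
Proof.
have d1 : is_derive t 1 (fun s : R => 1 - s) (- 1).
  by apply: is_derive_eq (is_deriveB (is_derive_cst (1 : R) t 1) (is_derive_id t 1)) _;
    rewrite sub0r.
have d2 := @is_derive1_comp _ flat _ t _ _ (is_derive_flat (1 - t)) d1.
have d3 := is_deriveD (is_derive_flat t) d2.
have n0 := lt0r_neq0 (step_den_gt0 t).
have d4 := @is_deriveV _ (flat + (flat \o (fun s : R => 1 - s))) t _ 1 n0 d3.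
apply: is_derive_eq (is_deriveM (is_derive_flat t) d4) _.
rewrite /dstep -![_ *: _]/(_ * _) /= !fctE /=.
by field.
Qed.

Lemma step_le0 t : t <= 0 -> step t = 0.
Proof. by move=> t0; rewrite /step flat_le0// mul0r. Qed.

Lemma step_ge1 t : 1 <= t -> step t = 1.
Proof.
move=> t1; rewrite /step (@flat_le0 (1 - t)) ?subr_le0// addr0 divff//.
by apply/lt0r_neq0/flat_gt0/(lt_le_trans ltr01).
Qed.

Lemma step_ge0 t : 0 <= step t.
Proof. by rewrite divr_ge0 ?flat_ge0// ltW ?step_den_gt0. Qed.

Lemma step_le1 t : step t <= 1.
Proof. by rewrite ler_pdivrMr ?step_den_gt0// mul1r lerDl flat_ge0. Qed.

Lemma dstep_le0 t : t <= 0 -> dstep t = 0.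
Proof. by move=> t0; rewrite /dstep (flat_le0 t0) (dflat_le0 t0) !mul0r addr0 mul0r. Qed.

Lemma dstep_ge1 t : 1 <= t -> dstep t = 0.
Proof.
move=> t1; rewrite /dstep (@flat_le0 (1 - t)) ?subr_le0//.
by rewrite (@dflat_le0 (1 - t)) ?subr_le0// !mulr0 addr0 mul0r.
Qed.

Lemma dstep_ge0 t : 0 <= dstep t.
Proof.
rewrite divr_ge0 ?exprn_ge0 ?addr_ge0 ?flat_ge0//;
by rewrite mulr_ge0 ?flat_ge0 ?dflat_ge0.
Qed.

(** In [dstep] each of the two products in the numerator is at most 1, and the denominator is at
    least the square of [expR (- 2)]. *)
Definition dstep_bound : R := 2 / expR (- 2) ^+ 2.

Lemma dstep_le t : dstep t <= dstep_bound.
Proof.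
rewrite /dstep /dstep_bound; apply: ler_pM.
- by rewrite addr_ge0// mulr_ge0 ?flat_ge0 ?dflat_ge0.
- by rewrite invr_ge0 exprn_ge0// ltW// step_den_gt0.
- rewrite -[2]/(1 + 1); apply: lerD;
  by rewrite mulr_ile1 ?flat_ge0 ?dflat_ge0 ?flat_le1 ?dflat_le1.
- rewrite lef_pV2 ?posrE ?exprn_gt0 ?expR_gt0 ?step_den_gt0//.
  by rewrite ler_pXn2r ?nnegrE ?expR_ge0 ?step_den// ltW// step_den_gt0.
Qed.

Lemma dstep_bound_gt0 : 0 < dstep_bound.
Proof. by rewrite divr_gt0// exprn_gt0// expR_gt0. Qed.

(** A difference of consecutive steps vanishes outside [[-1, 1]], and its integer translates
    telescope: they form a partition of unity on the line. *)
Definition hat t : R := step (t + 1) - step t.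
Definition dhat t : R := dstep (t + 1) - dstep t.

Lemma is_derive_hat t : is_derive t 1 hat (dhat t).
Proof.
have d1 : is_derive t 1 (fun s : R => s + 1) 1.
  by apply: is_derive_eq (is_deriveD (is_derive_id t 1) (is_derive_cst (1 : R) t 1)) _;
    rewrite addr0.
have d2 := @is_derive1_comp _ step _ t _ _ (is_derive_step (t + 1)) d1.
by apply: is_derive_eq (is_deriveB d2 (is_derive_step t)) _; rewrite mulr1.
Qed.

Lemma hat_ge0 t : 0 <= hat t.
Proof.
rewrite /hat; have [t0|t0] := leP t 0; first by rewrite (step_le0 t0) subr0 step_ge0.
by rewrite (@step_ge1 (t + 1)) ?subr_ge0 ?step_le1//; lra.
Qed.

Lemma hat_far t : 1 <= `|t| -> hat t = 0.
Proof.
rewrite /hat ler_normr => /orP[t1|t1].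
  by rewrite !step_ge1 ?subrr//; lra.
by rewrite !step_le0 ?subrr//; lra.
Qed.

Lemma dhat_far t : 1 <= `|t| -> dhat t = 0.
Proof.
rewrite /dhat ler_normr => /orP[t1|t1].
  by rewrite !dstep_ge1 ?subrr//; lra.
by rewrite !dstep_le0 ?subrr//; lra.
Qed.

Lemma sum_hat (N : nat) t : 0 <= t <= N%:R -> \sum_(k < N.+1) hat (t - k%:R) = 1.
Proof.
move=> /andP[t0 tN].
rewrite -(big_mkord xpredT (fun k => hat (t - k%:R))).
have E k : hat (t - k%:R) = (- step (t + 1 - k.+1%:R)) - (- step (t + 1 - k%:R)).
  rewrite /hat opprK addrC -natr1; congr (- step _ + step _); lra.
under eq_bigr do rewrite E.
rewrite telescope_sumr// -natr1 step_le0; last by lra.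
by rewrite step_ge1 ?oppr0 ?sub0r ?opprK//; lra.
Qed.

Lemma sum_dhat (N : nat) t : 0 <= t <= N%:R -> \sum_(k < N.+1) dhat (t - k%:R) = 0.
Proof.
move=> /andP[t0 tN].
rewrite -(big_mkord xpredT (fun k => dhat (t - k%:R))).
have E k : dhat (t - k%:R) = (- dstep (t + 1 - k.+1%:R)) - (- dstep (t + 1 - k%:R)).
  rewrite /dhat opprK addrC -natr1; congr (- dstep _ + dstep _); lra.
under eq_bigr do rewrite E.
rewrite telescope_sumr// -natr1 dstep_le0; last by lra.
by rewrite dstep_ge1 ?oppr0 ?sub0r ?opprK//; lra.
Qed.

Lemma sum_at_most_one (N : nat) (F : 'I_N -> R) (B : R) : 0 <= B ->
  (forall i, 0 <= F i <= B) -> (forall i j, F i != 0 -> F j != 0 -> i = j) ->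
  \sum_i F i <= B.
Proof.
move=> B0 FB F1; case: (pickP (fun i => F i != 0)) => [i Fi|F0].
  rewrite (bigD1 i)//= big1 ?addr0; first by have /andP[] := FB i.
  by move=> j ji; apply/eqP/negPn/negP => Fj; move: ji; rewrite (F1 _ _ Fj Fi) eqxx.
by rewrite big1// => i _; exact/eqP/(negbFE (F0 i)).
Qed.

(** The translates live on disjoint unit intervals, so at most one term is nonzero. This keeps the
    derivative bound of the partition of unity independent of the number of nodes. *)
Lemma sum_dstep (N : nat) t : \sum_(k < N) dstep (t - k%:R) <= dstep_bound.
Proof.
apply: sum_at_most_one => [|i|i j]; first exact/ltW/dstep_bound_gt0.
  by rewrite dstep_ge0 dstep_le.
have aux (k : 'I_N) : dstep (t - k%:R) != 0 -> k%:R < t < k%:R + 1.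
  move=> k0; apply/andP; split; rewrite ltNge; apply: contra k0 => k0.
    by rewrite dstep_le0// subr_le0.
  by rewrite dstep_ge1// lerBrDl.
move=> /aux/andP[i1 i2] /aux/andP[j1 j2]; apply/val_inj/eqP => /=.
by rewrite eqn_leq -(ltnS i) -(ltnS j) -!(ltr_nat R) -[i.+1%:R]natr1 -[j.+1%:R]natr1;
  apply/andP; split; lra.
Qed.

Lemma sum_abs_dhat (N : nat) t :
  \sum_(k < N) `|dhat (t - k%:R)| <= 2 * dstep_bound.
Proof.
apply: (@le_trans _ _ (\sum_(k < N) (dstep (t + 1 - k%:R) + dstep (t - k%:R)))).
  apply: ler_sum => k _; rewrite /dhat.
  apply: le_trans (ler_normB _ _) _; rewrite !ger0_norm ?dstep_ge0//.
  by rewrite addrAC.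
by rewrite big_split /= mulr_natl mulr2n lerD// sum_dstep.
Qed.

End smooth_step.

(** * Partition of unity subordinate to a cubic grid *)

Section grid.
Variables (R : realType) (n : nat).

Lemma smooth_hat (u : 'rV[R]_n -> R) : smooth u -> smooth (fun x => hat (u x)).
Proof.
move=> su; have step_smooth w : smooth w -> smooth (fun x : 'rV[R]_n => step (w x)).
  move=> sw; have sw' := smoothB (@smooth_cst R n (1 : R)) sw.
  have sd := smoothD (smooth_flatp 1 sw) (smooth_flatp 1 sw').
  exact: (smoothM (smooth_flatp 1 sw) (smoothV sd (fun x => lt0r_neq0 (step_den_gt0 _)))).
exact: (smoothB (step_smooth _ (smoothD su (@smooth_cst R n 1))) (step_smooth _ su)).
Qed.

(** Tensor products of hats at scale [h]. A sum over all nodes of a product over coordinates is a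
    product of one-dimensional sums. A partial derivative changes only one of these factors, whence
    a total of order [1 / h] whatever the number of nodes. *)
Lemma grid_partition (M h : R) : 0 < h ->
  exists (I : finType) (c : I -> 'rV[R]_n) (theta : I -> 'rV[R]_n -> R),
  (forall k, [/\ smooth (theta k), forall x, 0 <= theta k x,
     forall x, theta k x != 0 -> `|x - c k| < h &
     forall x l, partial l (theta k) x != 0 -> `|x - c k| < h]) /\
  (forall x, `|x| <= M -> \sum_k theta k x = 1 /\
     forall l, \sum_k partial l (theta k) x = 0 /\
       \sum_k `|partial l (theta k) x| <= 2 * dstep_bound R / h).
Proof.
move=> h0.
have [N0 MN0] : exists N0 : nat, M <= h * N0%:R.
  exists (Num.truncn (`|M| / h)).+1.
  rewrite mulrC -ler_pdivrMr//; apply/ltW/(le_lt_trans _ (truncnS_gt _)).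
  by rewrite ler_pM2r ?invr_gt0// ler_norm.
pose N := (2 * N0)%N.
(* The shift by [N0] sends [[- M, M]] into [[0, N]], the range on which the [N + 1] hats sum to
   1. *)
pose t (x : 'rV[R]_n) (i : 'I_n) : R := x ord0 i / h + N0%:R.
pose c (k : {ffun 'I_n -> 'I_N.+1}) : 'rV[R]_n := \row_i (h * ((k i)%:R - N0%:R)).
pose theta (k : {ffun 'I_n -> 'I_N.+1}) x : R := \prod_i hat (t x i - (k i)%:R).
(* The factors of the [l]-th partial derivative of a tensor product: only the factor of index [l] is
   differentiated. *)
pose dfac l x i (j : 'I_N.+1) : R :=
  if i == l then dhat (t x i - j%:R) / h else hat (t x i - j%:R).
have dist (k : {ffun 'I_n -> 'I_N.+1}) x i : 1 <= `|t x i - (k i)%:R| \/ `|(x - c k) ord0 i| < h.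
  have [|lt1] := leP 1 `|t x i - (k i)%:R|; [by left|right].
  rewrite !mxE (_ : _ - _ = h * (t x i - (k i)%:R)); last first.
    by rewrite /t; field; exact: lt0r_neq0.
  by rewrite normrM gtr0_norm// gtr_pMr.
have dtheta l (k : {ffun 'I_n -> 'I_N.+1}) x : is_derive x (delta_mx ord0 l) (theta k) (\prod_i dfac l x i (k i)).
  apply/is_derive_line.
  have E : (fun s : R => theta k (s *: delta_mx ord0 l + x)) =
     (fun s : R => (\prod_(i | i != l) hat (t x i - (k i)%:R)) *
        hat (s / h + (t x l - (k l)%:R))).
    apply/funext => s; rewrite /theta (bigD1 l)//= mulrC; congr (_ * _).
      apply: eq_bigr => i il; congr hat; rewrite /t !mxE eqxx /=.
      by rewrite (negbTE il) mulr0 add0r.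
    by congr hat; rewrite /t !mxE !eqxx /= mulr1 mulrDl !addrA.
  have -> : \prod_i dfac l x i (k i) =
      (\prod_(i | i != l) hat (t x i - (k i)%:R)) * (dhat (t x l - (k l)%:R) / h).
    rewrite (bigD1 l)//= mulrC {2}/dfac eqxx; congr (_ * _).
    by apply: eq_bigr => i il; rewrite /dfac (negbTE il).
  rewrite E.
  have d1 : is_derive (0 : R) 1 (fun s : R => s / h + (t x l - (k l)%:R)) h^-1.
    have Z := is_deriveD (is_deriveZ h^-1 (is_derive_id (0 : R) 1))
       (is_derive_cst (t x l - (k l)%:R) (0 : R) 1).
    rewrite (_ : (fun s : R => _) = h^-1 \*: id + cst (t x l - (k l)%:R)).
      by apply: is_derive_eq Z _; rewrite addr0 [LHS]mulr1.
    by apply/funext => s; rewrite !fctE /= -[_ *: _]/(_ * _) mulrC.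
  have d2 := @is_derive1_comp _ (@hat R) _ (0 : R) _ _ (is_derive_hat _) d1.
  apply: is_derive_eq (is_deriveZ (\prod_(i | i != l) hat (t x i - (k i)%:R)) d2) _.
  by rewrite /= mul0r add0r.
have partialE l (k : {ffun 'I_n -> 'I_N.+1}) x : partial l (theta k) x = \prod_i dfac l x i (k i).
  by rewrite /partial; exact: derive_val.
exists {ffun 'I_n -> 'I_N.+1}, c, theta; split=> [k|x xM].
  split.
  - apply: smooth_prod => i.
    have st := smoothD (smoothM (@smooth_coord R n i) (@smooth_cst R n h^-1)) (@smooth_cst R n N0%:R).
    exact: (smooth_hat (smoothB st (@smooth_cst R n (k i)%:R))).
  - by move=> x; apply: prodr_ge0 => i _; exact: hat_ge0.
  - move=> x /prodf_neq0 x0; apply: rV_norm_lt => // i.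
    have [far|//] := dist k x i.
    by have := x0 i isT; rewrite hat_far// eqxx.
  - move=> x l; rewrite partialE => /prodf_neq0 x0; apply: rV_norm_lt => // i.
    have [far|//] := dist k x i.
    have := x0 i isT; rewrite /dfac; case: ifP => _; last by rewrite hat_far// eqxx.
    by rewrite dhat_far// mul0r eqxx.
have tN i : 0 <= t x i <= N%:R.
  have := le_trans (le_trans (coord_le_norm x i) xM) MN0.
  rewrite ler_norml /t natrM => /andP[x1 x2].
  have e : x ord0 i / h * h = x ord0 i by rewrite divfK// lt0r_neq0.
  apply/andP; split; rewrite -(ler_pM2r h0) mulrDl e; nra.
split.
  rewrite /theta -(bigA_distr_bigA (fun i (j : 'I_N.+1) => hat (t x i - j%:R))).
  by rewrite big1// => i _; rewrite sum_hat.
move=> l; split.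
  under eq_bigr do rewrite partialE.
  rewrite -(bigA_distr_bigA (dfac l x)); apply/eqP/prodf_eq0; exists l => //.
  by rewrite /dfac; under eq_bigr do rewrite eqxx; rewrite -mulr_suml sum_dhat ?mul0r.
under eq_bigr do rewrite partialE normr_prod.
rewrite -(bigA_distr_bigA (fun i j => `|dfac l x i j|)) (bigD1 l)//= [X in _ * X]big1.
  rewrite mulr1 /dfac; under eq_bigr do rewrite eqxx normrM [`|h^-1|]gtr0_norm ?invr_gt0//.
  by rewrite -mulr_suml ler_pM2r ?invr_gt0// sum_abs_dhat.
move=> i il; rewrite /dfac; under eq_bigr do rewrite (negbTE il) ger0_norm ?hat_ge0//.
exact: sum_hat.
Qed.

End grid.

Lemma is_derive_along (R : realType) (V : normedModType R) (u : V -> R) (x v : V)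
  (t d : R) : is_derive (t *: v + x) v u d ->
  is_derive t 1 (fun s : R => u (s *: v + x)) d.
Proof.
move=> /is_derive_line D.
have S : is_derive t 1 (fun s : R => s - t) 1.
  by apply: is_derive_eq (is_deriveB (is_derive_id t 1) (is_derive_cst t t 1)) _;
    rewrite subr0.
rewrite -(subrr t) in D.
have := @is_derive1_comp _ _ (fun s : R => s - t) t _ _ D S; rewrite mulr1.
congr is_derive; apply/funext => s /=.
by rewrite addrA -scalerDl subrK.
Qed.

Lemma is_derive_bigsum (R : realType) (V : normedModType R) (I : Type) (r : seq I)
  (F : I -> V -> R) (d : I -> R) (x v : V) :
  (forall i, is_derive x v (F i) (d i)) ->
  is_derive x v (fun y => \sum_(i <- r) F i y) (\sum_(i <- r) d i).
Proof.
move=> dF; elim: r => [|i r IH].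
  rewrite big_nil (_ : (fun _ => _) = cst 0); first exact: is_derive_cst.
  by apply/funext => y; rewrite big_nil.
rewrite big_cons (_ : (fun _ => _) = F i + (fun y => \sum_(j <- r) F j y)).
  exact: is_deriveD (dF i) IH.
by apply/funext => y; rewrite big_cons.
Qed.

(** * Taylor estimate and smooth approximation on a compact set *)

Section approximation.
Variables (R : realType) (n : nat).
Implicit Types (g : 'rV[R]_n -> R) (x y z : 'rV[R]_n) (O K : set 'rV[R]_n).

Definition C1_on O g := forall x, O x -> forall i,
  derivable g x (delta_mx ord0 i) /\ {for x, continuous (partial i g)}.

(** The mean value theorem on the segment between 0 and [a]; assuming the bound for all [|t| <= |a|]
    covers both signs of [a]. It yields both the Taylor estimate and, with [b = 0], Lipschitz
    bounds. *)
Lemma derive_deviation (F dF : R -> R) (a b w : R) :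
  (forall t : R, `|t| <= `|a| -> is_derive t 1 F (dF t) /\ `|dF t - b| <= w) ->
  `|F a - F 0 - b * a| <= w * `|a|.
Proof.
move=> H.
have cF t : `|t| <= `|a| -> {for t, continuous F}.
  move=> /H[dFt _]; apply/differentiable_continuous/derivable1_diffP.
  by have [] := dFt.
have [a0|a0] := leP 0 a.
  have [t| |t + ->] := @MVT_segment R F dF 0 a a0.
  - rewrite in_itv/= => /andP[t0 ta]; have [|//] := H t.
    by rewrite !ger0_norm// ltW.
  - apply: continuous_in_subspaceT => t; rewrite inE/= in_itv/= => /andP[t0 ta].
    by apply: cF; rewrite !ger0_norm.
  rewrite in_itv/= subr0 => /andP[t0 ta].
  rewrite -mulrBl normrM ler_wpM2r//.
  by have [] // := H t; rewrite !ger0_norm.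
have aN : `|a| = - a by rewrite ltr0_norm.
have [t| |t + E] := @MVT_segment R F dF a 0 (ltW a0).
- rewrite in_itv/= => /andP[t0 ta]; have [|//] := H t.
  by rewrite aN ltr0_norm// lerN2 ltW.
- apply: continuous_in_subspaceT => t; rewrite inE/= in_itv/= => /andP[t0 ta].
  by apply: cF; rewrite aN ler0_norm// lerN2.
rewrite in_itv/= => /andP[t0 ta].
have -> : F a - F 0 - b * a = (dF t - b) * a.
  by rewrite -[F a - F 0]opprB E; ring.
rewrite normrM ler_wpM2r//.
by have [] // := H t; rewrite aN ler0_norm// lerN2.
Qed.

(* The segment from [x] to [y] is replaced by a path parallel to the axes, as
   only partial derivatives are assumed to exist. *)
Lemma taylor1 g x y (w : R) :
  (forall z, `|z - x| <= `|y - x| -> forall i, derivable g z (delta_mx ord0 i) /\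
     `|partial i g z - partial i g x| <= w) ->
  `|g y - g x - \sum_i partial i g x * (y - x) ord0 i| <= n%:R * (w * `|y - x|).
Proof.
move=> H.
(* The corners of the path: [p k] has the first [k] coordinates of [y] and the remaining ones of
   [x]. *)
pose p (k : nat) : 'rV[R]_n := \row_i (if (i < k)%N then y ord0 i else x ord0 i).
have p0 : p 0%N = x by apply/rowP => i; rewrite mxE.
have pn : p n = y by apply/rowP => i; rewrite mxE ltn_ord.
have pS (k : 'I_n) : p k.+1 = ((y - x) ord0 k) *: delta_mx ord0 k + p k.
  apply/rowP => i; rewrite !mxE ltnS eqxx /= -val_eqE /=.
  by case: ltngtP => [ik|ik|/val_inj ->]; rewrite ?mulr0 ?add0r// mulr1 subrK.
(* The hypothesis bounds [w] from below only through a coordinate index, hence the argument of type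
   ['I_n]. *)
have w0 : 'I_n -> 0 <= w.
  move=> i; have [|_] := H x _ i; first by rewrite subrr normr0.
  exact: le_trans.
have step_le (k : 'I_n) :
  `|g (p k.+1) - g (p k) - partial k g x * (y - x) ord0 k| <= w * `|y - x|.
  pose F (t : R) := g (t *: delta_mx ord0 k + p k).
  apply: (@le_trans _ _ (w * `|(y - x) ord0 k|)); last first.
    by rewrite ler_wpM2l ?coord_le_norm// w0.
  rewrite pS (_ : g (p k) = F 0); last by rewrite /F scale0r add0r.
  apply: (@derive_deviation F (fun t => partial k g (t *: delta_mx ord0 k + p k))).
  move=> t tle.
  have pz : `|t *: delta_mx ord0 k + p k - x| <= `|y - x|.
    apply: rV_norm_le => // i; rewrite !mxE eqxx /=.
    have [->|ik] := eqVneq i k; rewrite ?ltnn ?mulr1 ?mulr0 ?add0r ?addrK.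
      by apply: le_trans tle _; exact: coord_le_norm.
    case: ifP => _; last by rewrite subrr normr0.
    by have := coord_le_norm (y - x) i; rewrite !mxE.
  have [dz dw] := H _ pz k; split; last exact: dw.
  exact: (is_derive_along (derivableP dz)).
have -> : g y - g x - \sum_i partial i g x * (y - x) ord0 i =
    \sum_(k < n) (g (p k.+1) - g (p k) - partial k g x * (y - x) ord0 k).
  rewrite big_split /= sumrN; congr (_ - _).
  rewrite -(big_mkord xpredT (fun k => g (p k.+1) - g (p k))) telescope_sumr//.
  by rewrite pn p0.
apply: le_trans (ler_norm_sum _ _ _) _.
apply: le_trans (ler_sum _ (fun k _ => step_le k)) _.
by rewrite sumr_const card_ord mulr_natl.
Qed.

(** Compactness, as a near-covering property, turns local oscillation bounds into one radius for all
    of [K]. The same radius keeps the neighbourhood of [K] inside [O], so that Taylor polynomials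
    can be centred slightly off [K]. *)
Lemma C1_on_compact O K g (w : R) : open O -> compact K -> K `<=` O ->
  C1_on O g -> 0 < w ->
  exists2 r : R, 0 < r & forall x, K x -> forall y, `|y - x| < r ->
    O y /\ forall i, `|partial i g y - partial i g x| <= w.
Proof.
move=> oO cK KO Cg w0.
have /compact_near_coveringP cov := cK.
have {cov} := cov R (0 : R)^'+ (fun r x => forall y, `|y - x| < r ->
  O y /\ forall i, `|partial i g y - partial i g x| <= w) _ _.
have loc x : K x -> exists2 d : R, 0 < d & forall y, `|y - x| < d ->
    O y /\ forall i, `|partial i g y - partial i g x| <= w / 2.
  move=> Kx; have Ox := KO _ Kx.
  have : \forall y \near x, O y /\ forall i, `|partial i g y - partial i g x| <= w / 2.
    have N : forall i, \forall y \near x, `|partial i g y - partial i g x| <= w / 2.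
      move=> i; have [_ ci] := Cg _ Ox i.
      have /cvgrPdist_le/(_ (w / 2)) := ci; rewrite divr_gt0// => /(_ isT).
      by apply: filterS => y; rewrite distrC.
    have Oy : \forall y \near x, O y by exact: open_nbhs_nbhs.
    exact: filterI Oy (filter_forall _ N).
  move=> /nbhs_ballP[d d0 Hd]; exists d => // y yx; apply: Hd.
  by rewrite -ball_normE /ball_ /= distrC.
move=> cov; have {cov} : \forall r \near (0 : R)^'+, forall x, K x ->
    forall y, `|y - x| < r -> O y /\ forall i, `|partial i g y - partial i g x| <= w.
  apply: cov => x Kx; have [d d0 Hd] := loc x Kx.
  (* One half of [d] for moving the centre and one half for the distance to it: both points stay
     within [d] of [x], and two oscillations of [w / 2] add up to [w]. *)
  exists (ball x (d / 2), [set r : R | r < d / 2]).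
    split=> /=; first by apply: nbhsx_ballx; rewrite divr_gt0.
    by apply: nbhs_right_lt; rewrite divr_gt0.
  move=> [x' r] /= [xx' rd] y yx'.
  have x'x : `|x' - x| < d / 2 by move: xx'; rewrite -ball_normE /ball_ /= distrC.
  have [|Oy Hy] := Hd y.
    rewrite -(subrKA x') (splitr d); apply: le_lt_trans (ler_normD _ _) _.
    by rewrite ltrD// (lt_trans yx').
  split=> // i; rewrite -(subrKA (partial i g x)) (splitr w).
  apply: le_trans (ler_normD _ _) _; rewrite lerD// distrC.
  have [|_ /(_ i) H2] := Hd x'; last exact: H2.
  by rewrite (lt_le_trans x'x)// ler_pdivrMr// mulr_natr mulr2n lerDl ltW.
move=> H; near (0 : R)^'+ => r; exists r; first by near: r; exact: nbhs_right_gt.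
by near: r; exact: H.
Unshelve. all: by end_near. Qed.

Lemma C1_on_bounded O K g : compact K -> K `<=` O -> C1_on O g ->
  exists2 M : R, 0 <= M & forall x, K x -> forall i, `|partial i g x| <= M.
Proof.
move=> cK KO Cg; have /compact_near_coveringP cov := cK.
have {cov} : \forall M \near +oo, forall x, K x -> forall i, `|partial i g x| <= M.
  apply: cov => x Kx.
  have [B HB] : exists B : R, forall i, `|partial i g x| <= B.
    exists (\sum_i `|partial i g x|) => i.
    by rewrite (bigD1 i)//= lerDl sumr_ge0.
  have N : forall i, \forall y \near x, `|partial i g y - partial i g x| <= 1.
    move=> i; have [_ ci] := Cg _ (KO _ Kx) i.
    have /cvgrPdist_le/(_ 1 ltr01) := ci.
    by apply: filterS => z; rewrite distrC.
  exists ([set y | forall i, `|partial i g y - partial i g x| <= 1], [set M | B + 1 <= M]).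
    by split; [exact: (filter_forall _ N)|apply: nbhs_pinfty_ge; exact: num_real].
  move=> [y M] /= [Hy HM] i; apply: le_trans HM.
  rewrite -[partial i g y](subrK (partial i g x)) addrC.
  by apply: le_trans (ler_normD _ _) _; rewrite lerD.
move=> H; near (pinfty_nbhs R) => M; exists M; first by near: M; apply: nbhs_pinfty_ge; exact: num_real.
by near: M.
Unshelve. all: by end_near. Qed.

(** The Taylor polynomials differ from [g] by [n * w * h] on cells of size [h], and the gradients of
    the partition sum to at most [C / h]. In the gradient error the mesh therefore cancels, leaving
    a multiple of [w], the oscillation of the gradient of [g]. *)
Lemma smooth_approx O K g (e : R) : open O -> compact K -> K `<=` O ->
  C1_on O g -> 0 < e ->
  exists q : 'rV[R]_n -> R, [/\ smooth q,
    forall x, K x -> `|g x - q x| <= e,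
    forall x i, K x -> `|partial i g x - partial i q x| <= e &
    (forall x, O x -> 0 <= g x) -> forall x, 0 <= q x].
Proof.
move=> oO cK KO Cg e0.
have [M M0 HM] := C1_on_bounded cK KO Cg.
have [A [_ /(_ (A + 1))HA]] : exists A : R, A \is Num.real /\
    forall B, A < B -> forall x, K x -> `|x| <= B.
  by have [A HA] := compact_bounded cK; exists A.
have {}HA x : K x -> `|x| <= A + 1 by apply: HA; rewrite ltrDl.
pose C := 2 * dstep_bound R.
have C0 : 0 < C by rewrite mulr_gt0// dstep_bound_gt0.
(* Chosen so that [w * (1 + n + n * C) = e / 2], which covers the value error [n * w] as well as the
   gradient error [w * (1 + n * C)]. *)
pose w := e / (2 * (1 + n%:R + n%:R * C)).
have D0 : 0 < 1 + n%:R + n%:R * C.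
  by rewrite ltr_wpDr ?mulr_ge0// ?(ltW C0)// ltr_wpDr.
have w0 : 0 < w by rewrite divr_gt0// mulr_gt0.
have [r r0 Hr] := C1_on_compact oO cK KO Cg (divr_gt0 w0 (ltr0Sn R 1)).
(* The first bound keeps cells meeting [K] within the radius [r], the second gives
   [n * w * h <= n * w], and the third makes the linear part of each Taylor polynomial at least
   [- (e / 2)] on its cell. *)
pose h := Num.min (r / 2) (Num.min 1 (e / (2 * (n%:R * (M + w) + 1)))).
have E0 : 0 < 2 * (n%:R * (M + w) + 1).
  by rewrite mulr_gt0// ltr_wpDl// mulr_ge0// addr_ge0// ltW.
have h0 : 0 < h by rewrite !lt_min divr_gt0// ltr01 divr_gt0.
have hr : h <= r / 2 by rewrite ge_min lexx.
have hr' : h <= r by lra.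
have w2 : w / 2 <= w by lra.
have h1 : h <= 1 by rewrite !ge_min lexx orbT.
have hM : h <= e / (2 * (n%:R * (M + w) + 1)) by rewrite !ge_min lexx !orbT.
have [I [c [th [Hth Sth]]]] := grid_partition n (A + 1) h0.
(* Only nodes near [K] carry a Taylor polynomial of [g]; elsewhere the polynomial is zero. *)
pose act k := `[< exists2 y, K y & `|y - c k| < h >].
pose a k : R := if act k then g (c k) else 0.
pose b k i : R := if act k then partial i g (c k) else 0.
pose T k x : R := a k + \sum_i b k i * (x - c k) ord0 i.
(* The constant [e / 2] compensates for the negative linear parts, so that [q >= 0] everywhere when
   [g >= 0] on [O]. *)
pose q x : R := \sum_k (T k x + e / 2) * th k x.
have sT k : smooth (fun x => T k x + e / 2).
  have sb i := smoothM (@smooth_cst R n (b k i))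
    (smoothB (@smooth_coord R n i) (@smooth_cst R n (c k ord0 i))).
  have := smoothD (smoothD (@smooth_cst R n (a k)) (smooth_sum (index_enum 'I_n) sb))
    (@smooth_cst R n (e / 2)).
  congr smooth; apply/funext => x; rewrite /T; congr (_ + _ + _).
  by apply: eq_bigr => i _; rewrite !mxE.
have sth k : smooth (th k) by have [] := Hth k.
have dT k l x : partial l (fun x => T k x + e / 2) x = b k l.
  have d1 i : is_derive x (delta_mx ord0 l) (fun y : 'rV[R]_n => b k i * (y - c k) ord0 i)
      (b k i * (l == i)%:R).
    have Z := is_deriveZ (b k i) (is_deriveB (is_derive_coord l i x)
      (is_derive_cst (c k ord0 i) x (delta_mx ord0 l))).
    rewrite subr0 in Z; move: Z; congr is_derive; apply/funext => y.
    by rewrite !mxE.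
  have d2 := is_deriveD (is_deriveD (is_derive_cst (a k) x (delta_mx ord0 l))
    (is_derive_bigsum (index_enum 'I_n) d1)) (is_derive_cst (e / 2) x (delta_mx ord0 l)).
  apply: (etrans (@derive_val _ _ _ _ _ _ _ d2)).
  rewrite add0r addr0 (bigD1 l)//= eqxx mulr1 big1 ?addr0// => i il.
  by rewrite eq_sym (negbTE il) mulr0.
have dq l x : partial l q x =
    \sum_k ((T k x + e / 2) * partial l (th k) x + b k l * th k x).
  have d1 k := is_deriveM (smooth_is_derive l x (sT k)) (smooth_is_derive l x (sth k)).
  have d2 := is_derive_bigsum (index_enum I) d1.
  apply: (etrans (@derive_val _ _ _ _ _ _ _ d2)).
  by apply: eq_bigr => k _; rewrite dT -![_ *: _]/(_ * _) [th k x * _]mulrC.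
have wE : w * (1 + n%:R + n%:R * C) = e / 2 by rewrite /w; field; exact: lt0r_neq0.
have nw : n%:R * w <= e / 2.
  rewrite -wE mulrC; apply: ler_wpM2l; first exact: ltW.
  by rewrite addrAC lerDr addr_ge0// mulr_ge0// ltW.
have near_act k x : K x -> `|x - c k| < h ->
   [/\ a k = g (c k), forall l, b k l = partial l g (c k), `|T k x - g x| <= n%:R * (w * h) &
       forall l, `|b k l - partial l g x| <= w].
  move=> Kx xc; have ak : act k by apply/asboolP; exists x.
  have cx : `|c k - x| < r.
    by rewrite distrC (lt_le_trans xc).
  rewrite /a /b ak; split=> //; last first.
    move=> l; have [_ /(_ l)] := Hr x Kx _ cx.
    by move=> /le_trans; apply.
  rewrite /T /a /b ak distrC opprD addrA.
  apply: (@le_trans _ _ (n%:R * (w * `|x - c k|))); last first.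
    by rewrite !ler_wpM2l ?(ltW w0) ?(ltW xc).
  apply: taylor1 => z zc i.
  have zx : `|z - x| < r.
    rewrite -(subrKA (c k)) (splitr r); apply: le_lt_trans (ler_normD _ _) _.
    rewrite ltr_leD//; last by rewrite distrC (le_trans (ltW xc)).
    by rewrite (le_lt_trans zc)// (lt_le_trans xc).
  have [Oz Hz] := Hr x Kx z zx; have [Oc Hc] := Hr x Kx _ cx.
  split; first by have [] := Cg _ Oz i.
  rewrite -(subrKA (partial i g x)) (splitr w).
  by apply: le_trans (ler_normD _ _) _; rewrite lerD// distrC.
exists q; split.
- exact: (smooth_sum (index_enum I) (fun k => smoothM (sT k) (sth k))).
- move=> x Kx; have [S1 _] := Sth x (HA x Kx).
  have Eg d : d = \sum_k d * th k x by rewrite -mulr_sumr S1 mulr1.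
  rewrite [g x]Eg -sumrB; apply: le_trans (ler_norm_sum _ _ _) _.
  rewrite [leRHS]Eg; apply: ler_sum => k _.
  have [_ th0 thf _] := Hth k.
  rewrite -mulrBl normrM [`|th k x|]ger0_norm//.
  have [->|/thf xc] := eqVneq (th k x) 0; first by rewrite !mulr0.
  rewrite ler_wpM2r//; have [_ _ HT _] := near_act k x Kx xc.
  rewrite opprD addrA [leRHS]splitr; apply: le_trans (ler_normD _ _) _.
  rewrite normrN [X in _ + X]gtr0_norm ?divr_gt0// lerD2r distrC.
  apply: le_trans HT (le_trans _ nw); rewrite mulrA ler_piMr// mulr_ge0//.
  exact: ltW.
- move=> x l Kx; have [S1 /(_ l)[S2 S3]] := Sth x (HA x Kx).
  have -> : partial l g x - partial l q x =
      \sum_k ((partial l g x - b k l) * th k x - (T k x - g x) * partial l (th k) x).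
    rewrite dq sumrB; under [X in _ = X - _]eq_bigr do rewrite mulrBl.
    rewrite sumrB -mulr_sumr S1 mulr1.
    under [X in _ = _ - X]eq_bigr do rewrite mulrBl.
    rewrite [X in _ = _ - X]sumrB -[X in _ = _ - (_ - X)]mulr_sumr S2 mulr0 subr0.
    under eq_bigr do rewrite mulrDl.
    rewrite !big_split /= -[X in _ - (_ + X + _)]mulr_sumr S2 mulr0 addr0.
    by rewrite opprD [- _ - _]addrC addrA.
  apply: (@le_trans _ _ (\sum_k (w * th k x + n%:R * (w * h) * `|partial l (th k) x|))).
    apply: le_trans (ler_norm_sum _ _ _) _; apply: ler_sum => k _.
    have [_ th0 thf dthf] := Hth k.
    have [/andP[/eqP-> /eqP->]|Hn] := boolP ((th k x == 0) && (partial l (th k) x == 0)).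
      by rewrite normr0 !mulr0 addr0 subr0 normr0.
    have xc : `|x - c k| < h.
      by move: Hn; rewrite negb_and => /orP[/thf|/dthf].
    have [_ _ HT /(_ l)Hb] := near_act k x Kx xc.
    apply: le_trans (ler_normB _ _) _; rewrite !normrM [`|th k x|]ger0_norm//.
    by rewrite lerD// ler_wpM2r// distrC.
  rewrite big_split /= -!mulr_sumr S1 mulr1.
  apply: (@le_trans _ _ (w + n%:R * (w * h) * (C / h))).
    by rewrite lerD2l ler_wpM2l ?S3// (mulr_ge0 (ler0n _ _) (mulr_ge0 (ltW w0) (ltW h0))).
  have -> : w + n%:R * (w * h) * (C / h) = w * (1 + n%:R * C).
    by field; exact: lt0r_neq0.
  apply: (@le_trans _ _ (e / 2)); last by lra.
  by rewrite -wE ler_wpM2l ?(ltW w0)// lerD2r lerDl.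
- move=> g0 x; apply: sumr_ge0 => k _.
  have [_ th0 thf _] := Hth k.
  have [->|/thf xc] := eqVneq (th k x) 0; first by rewrite mulr0.
  rewrite mulr_ge0// /T /a /b; case: ifP => [/asboolP[y Ky yc]|_]; last first.
    by rewrite big1 ?addr0 ?add0r ?divr_ge0 ?(ltW e0)// => i _; rewrite mul0r.
  have yr : `|c k - y| < r.
    by rewrite distrC (lt_le_trans yc).
  have [Oc Hc] := Hr y Ky _ yr.
  have bM i : `|partial i g (c k)| <= M + w.
    rewrite -[partial i g (c k)](subrK (partial i g y)) addrC.
    exact: le_trans (ler_normD _ _) (lerD (HM _ Ky i) (le_trans (Hc i) w2)).
  have lb : - (e / 2) <= \sum_i partial i g (c k) * (x - c k) ord0 i.
    rewrite lerNl -sumrN; apply: (@le_trans _ _ (\sum_(i < n) (M + w) * h)).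
      apply: ler_sum => i _; apply: le_trans (ler_norm _) _; rewrite normrN normrM.
      apply: ler_pM => //; apply: le_trans (coord_le_norm _ _) (ltW xc).
    rewrite sumr_const card_ord -[leLHS]mulr_natl mulrA.
    apply: (@le_trans _ _ ((n%:R * (M + w) + 1) * h)).
      by rewrite ler_wpM2r ?(ltW h0)// lerDl.
    rewrite mulrC -ler_pdivlMr; last by rewrite ltr_wpDl// mulr_ge0// addr_ge0// ltW.
    apply: le_trans hM _; rewrite invfM mulrA.
    by rewrite lexx.
  by have := g0 _ Oc; lra.
Qed.

End approximation.

(** * Lebesgue measure on row vectors *)

Section rV_measure.
Variables (R : realType) (n : nat).
Local Notation mu := (lebesgue_rV R n).
Implicit Types (O U : set 'rV[R]_n) (x : 'rV[R]_n) (u : 'rV[R]_n -> R).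

Let cube (c : 'rV[R]_n) (r : R) := [set x : 'rV[R]_n | forall i, `|x ord0 i - c ord0 i| < r].

Lemma measurable_box (A : 'I_n -> set (measurableTypeR R)) :
  (forall i, measurable (A i)) ->
  measurable [set x : 'rV[R]_n | forall i, A i (x ord0 i)].
Proof.
move=> mA; rewrite [X in measurable X](_ : _ = \bigcap_(i in setT)
    ((fun x : 'rV[R]_n => x ord0 i : measurableTypeR R) @^-1` A i)).
  apply: fin_bigcap_measurable; first exact: finite_finset.
  by move=> i _; rewrite -[X in measurable X]setTI; exact: measurable_coor.
by apply/seteqP; split => x /= Ax i; [move=> _; exact: Ax|exact: (Ax i I)].
Qed.

(** The sigma-algebra is generated by the coordinates, so an open set is written as the countable
    union of the rational boxes that it contains. *)
Lemma open_measurable_rV U : open U -> measurable U.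
Proof.
move=> oU.
pose box (p : {ffun 'I_n -> rat} * rat) : set 'rV[R]_n :=
  cube (\row_i ratr (p.1 i)) (ratr p.2).
pose F p := if `[< box p `<=` U >] then box p else set0.
have -> : U = \bigcup_p F p.
  apply/seteqP; split=> x; last first.
    by move=> [p _]; rewrite /F; case: ifPn => // /asboolP; exact.
  move=> Ux; have /nbhs_ballP[e /= e0 He] : nbhs x U by exact: open_nbhs_nbhs.
  (* The rational centre lies within [r] of [x] and the box has half-width [r], so a radius below
     [e / 2] keeps the box in the ball. *)
  have [r] : exists r, ratr r \in `]0, e / 2[%R by apply: rat_in_itvoo; rewrite divr_gt0.
  rewrite in_itv/= => /andP[r0 re].
  have /choice[q Hq] : forall i, exists q : rat, `|x ord0 i - ratr q| < ratr r.
    move=> i; have [q] : exists q, ratr q \in `](x ord0 i - ratr r), (x ord0 i)[%R.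
      by apply: rat_in_itvoo; rewrite ltrBlDr ltrDl.
    by rewrite in_itv/= => /andP[q1 q2]; exists q; rewrite gtr0_norm; lra.
  pose c := (finfun q, r); exists c => //.
  have xc : box c x by move=> i; rewrite mxE ffunE; exact: Hq.
  rewrite /F; case: ifPn => // /asboolP nsub; exfalso; apply: nsub => y yc; apply: He.
  rewrite -ball_normE /ball_ /=; apply: rV_norm_lt => // i.
  rewrite !mxE -(subrKA (ratr (q i))) (splitr e).
  apply: le_lt_trans (ler_normD _ _) _; rewrite ltrD ?(lt_trans _ re)//.
  by have := yc i; rewrite mxE ffunE distrC; exact.
apply: countable_bigcupT_measurable => [|p]; first exact: countableP.
rewrite /F; case: ifP => // _.
apply: (@measurable_box (fun i => [set t : R | `|t - (\row_j ratr (p.1 j) : 'rV[R]_n) ord0 i| < ratr p.2])) => i.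
rewrite (_ : mkset _ = ball ((\row_j ratr (p.1 j) : 'rV[R]_n) ord0 i) (ratr p.2)).
  exact: measurable_ball.
by apply/seteqP; split=> t; rewrite -ball_normE /ball_ /= distrC.
Qed.

Lemma bounded_set_lebesgue_rV U : measurable U -> bounded_set U -> (mu U < +oo)%E.
Proof.
move=> mU [A [_ /(_ (`|A| + 1))HA]].
have {}HA x : U x -> `|x| <= `|A| + 1.
  by apply: HA; rewrite (le_lt_trans (ler_norm _))// ltrDl.
pose I : set (measurableTypeR R) := `[- (`|A| + 1), `|A| + 1]%classic.
have mI : measurable I by exact: measurable_itv.
apply: (@le_lt_trans _ _ (mu [set x | forall i, I (x ord0 i)])).
  apply: le_measure; rewrite ?inE//.
    exact: (@measurable_box (fun=> I)).
  move=> x Ux i; rewrite /I /= in_itv/= -ler_norml.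
  exact: le_trans (coord_le_norm x i) (HA x Ux).
rewrite (@lebesgue_rV_box R n (fun=> I))//.
rewrite ltey_eq; apply/orP; left.
elim/big_ind: _ => // [a b|i _]; first exact: fin_numM.
by rewrite lebesgue_measure_itv /=; case: ifP.
Qed.

Lemma open_continuous_measurable O u : open O ->
  (forall x, O x -> {for x, continuous u}) -> measurable_fun O u.
Proof.
move=> oO cu mO; apply: (measurability _ (RGenOInfty.measurableE R)) => //.
move=> _ [_ [a ->] <-].
apply: open_measurable_rV; rewrite openE => x [Ox ux].
have cx := cu x Ox.
apply: filterI; first by exact: open_nbhs_nbhs.
by apply: cx; apply: open_nbhs_nbhs; split=> //; exact: interval_open.
Qed.

End rV_measure.

(** * Integrals of derivatives of functions vanishing far away *)

Section bounded_support.
Variables (R : realType) (n : nat).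
Implicit Types (f : 'rV[R]_n -> R).

(** This form passes with the same [M] to slices, as the induction on the dimension requires. *)
Definition bounded_support f := exists M : R, forall x, M < `|x| -> f x = 0.

Lemma compact_ball0 (M : R) : compact [set x : 'rV[R]_n | `|x| <= M].
Proof.
apply: bounded_closed_compact.
  by exists M; split; [exact: num_real|move=> B MB x /le_trans; apply; exact: ltW].
rewrite (_ : mkset _ = [set x | (fun y : 'rV[R]_n => `|y|) x <= M])//.
apply: (@closed_comp _ _ _ [set t : R | t <= M]); last exact: closed_le.
by move=> x _; exact: norm_continuous.
Qed.

Lemma bounded_support_bounded f : continuous f -> bounded_support f ->
  exists2 C : R, 0 <= C & forall x, `|f x| <= C.
Proof.
move=> cf [M HM].
have cK : compact (f @` [set x | `|x| <= M]).
  apply: continuous_compact; last exact: compact_ball0.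
  exact: continuous_subspaceT.
have [A [_ /(_ (`|A| + 1))HA]] := compact_bounded cK.
exists (`|A| + 1); first by rewrite addr_ge0.
move=> x; have [xM|/HM ->] := leP `|x| M; last by rewrite normr0 addr_ge0.
apply: HA; last by exists x.
by rewrite (le_lt_trans (ler_norm _))// ltrDl.
Qed.

Lemma continuous_measurable f : continuous f -> measurable_fun setT f.
Proof.
by move=> cf; apply: open_continuous_measurable; [exact: openT|move=> x _; exact: cf].
Qed.

Lemma bounded_support_integrable f : continuous f -> bounded_support f ->
  (lebesgue_rV R n).-integrable setT (EFin \o f).
Proof.
move=> cf sf; have [C C0 HC] := bounded_support_bounded cf sf.
have [M HM] := sf.
have oB : open (ball (0 : 'rV[R]_n) (`|M| + 1)) by exact: ball_open.
have mB := open_measurable_rV oB.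
have -> : EFin \o f = (EFin \o f) \_ (ball (0 : 'rV[R]_n) (`|M| + 1)).
  apply/funext => x; rewrite patchE; case: ifPn => // /negP xB /=.
  rewrite HM// ltNge; apply/negP => xM; apply: xB; rewrite inE.
  rewrite -ball_normE /ball_ /= sub0r normrN.
  by rewrite (le_lt_trans xM)// (le_lt_trans (ler_norm M))// ltrDl.
apply: (integrable_mkcond _ mB).1; apply: measurable_bounded_integrable => //.
- apply: bounded_set_lebesgue_rV => //.
  exists (`|M| + 1); split; first exact: num_real.
  move=> B MB x; rewrite -ball_normE /ball_ /= sub0r normrN => xB.
  exact/ltW/(lt_trans xB).
- exact: measurable_funTS (continuous_measurable cf).
- by exists C; split; [exact: num_real|move=> B CB x _; exact: le_trans (HC x) (ltW CB)].
Qed.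

Lemma partial_far f i (M : R) x : (forall x, M < `|x| -> f x = 0) -> M < `|x| ->
  partial i f x = 0.
Proof.
move=> HM Mx; rewrite /partial.
rewrite -(@near_eq_derive _ _ _ (cst 0) f); first by rewrite derive_cst.
near=> y; rewrite HM//; near: y.
have := @norm_continuous _ _ x => /cvgrPdist_lt/(_ (`|x| - M)).
rewrite subr_gt0 => /(_ Mx); apply: filterS => y.
rewrite ltr_norml => /andP[_]; lra.
Unshelve. all: by end_near. Qed.

End bounded_support.

Section cons_measure_integral.
Variables (R : realType) (n : nat).
Local Notation lam := (@lebesgue_measure R).
Local Notation mu := (lebesgue_rV R n).

Lemma rV_cons_continuous (a : R) : continuous (fun y : 'rV[R]_n => rV_cons (a, y)).
Proof.
move=> y A /nbhs_ballP[e /= e0 eA]; apply/nbhs_ballP; exists e => // z.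
rewrite -ball_normE /ball_ /= => yz; apply: eA; rewrite -ball_normE /ball_ /=.
apply: rV_norm_lt => // i; rewrite !mxE.
case: unliftP => [j _|_] /=; last by rewrite subrr normr0.
by apply: le_lt_trans yz; have := coord_le_norm (y - z) j; rewrite !mxE.
Qed.

Lemma rV_cons_line0 (y : 'rV[R]_n) (t a : R) :
  rV_cons (t + a, y) = t *: delta_mx ord0 ord0 + rV_cons (a, y) :> 'rV[R]_n.+1.
Proof.
apply/rowP => i; rewrite !mxE eqxx /=.
case: unliftP => [j ->|->] /=; last by rewrite mulr1.
by rewrite mulr0 add0r.
Qed.

Lemma rV_cons_lineS (y : 'rV[R]_n) (a t : R) (j : 'I_n) :
  rV_cons (a, t *: delta_mx ord0 j + y) =
  t *: delta_mx ord0 (lift ord0 j) + rV_cons (a, y) :> 'rV[R]_n.+1.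
Proof.
apply/rowP => i; rewrite !mxE eqxx /=.
case: unliftP => [k ->|->] /=; last by rewrite mulr0 add0r.
by rewrite !mxE eqxx /= (inj_eq lift_inj).
Qed.

Lemma integrable_cons (f : 'rV[R]_n.+1 -> R) :
  (lebesgue_rV R n.+1).-integrable setT (EFin \o f) ->
  (lam \x mu)%E.-integrable setT (fun p => (f (rV_cons p))%:E).
Proof.
move=> /integrableP[mf foo]; apply/integrableP; split.
  exact: (measurableT_comp mf (@measurable_rV_cons R n)).
apply: le_lt_trans foo.
rewrite /= /cons_measure ge0_integral_pushforward//.
- exact: measurable_rV_cons.
- by apply/measurable_EFinP; apply: measurableT_comp => //; exact/measurable_EFinP.
Qed.

Lemma integral_cons (f : 'rV[R]_n.+1 -> R) :
  (lebesgue_rV R n.+1).-integrable setT (EFin \o f) ->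
  (\int[lebesgue_rV R n.+1]_x (f x)%:E = \int[lam \x mu]_p (f (rV_cons p))%:E)%E.
Proof.
move=> fi; rewrite /= /cons_measure integral_pushforward//.
- exact: measurable_rV_cons.
- by have /integrableP[] := fi.
- by rewrite preimage_setT; exact: integrable_cons.
Qed.

End cons_measure_integral.

Lemma integral_deriv_bounded_support (R : realType) (F f : R -> R) (M : R) :
  (forall t : R, is_derive t 1 F (f t)) -> continuous f ->
  (forall t : R, M < `|t| -> F t = 0 /\ f t = 0) ->
  (\int[@lebesgue_measure R]_t (f t)%:E = 0)%E.
Proof.
move=> dF cf HM; pose a := `|M| + 1.
have Ma : M < a by rewrite (le_lt_trans (ler_norm M))// ltrDl.
have a0 : 0 < a by rewrite ltr_wpDl.
have cF : continuous F.
  move=> t; apply/differentiable_continuous/derivable1_diffP.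
  by have [] := dF t.
have -> : (\int[@lebesgue_measure R]_t (f t)%:E =
    \int[@lebesgue_measure R]_(t in `[(- a)%R, a]) (f t)%:E)%E.
  rewrite [RHS]integral_mkcond; apply: eq_integral => t _.
  rewrite patchE; case: ifPn => // /negP ta.
  have Mt : M < `|t|.
    rewrite ltNge; apply/negP => tM; apply: ta.
    by rewrite inE /= in_itv /= -ler_norml (le_trans tM)// ltW.
  by have [_ ->] := HM t Mt.
rewrite (@continuous_FTC2 _ f F).
- have [|-> _] := HM a; first by rewrite gtr0_norm.
  have [|-> _] := HM (- a); first by rewrite normrN gtr0_norm.
  by rewrite sube0.
- lra.
- exact: continuous_subspaceT.
- split=> [t _||].
  + by have [] := dF t.
  + exact/cvg_at_right_filter/cF.
  + exact/cvg_at_left_filter/cF.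
- by move=> t _; rewrite derive1E; exact: derive_val.
Qed.

(** Fubini and induction on the dimension. For the first coordinate the inner integral is
    one-dimensional and vanishes by the fundamental theorem of calculus; for any other, the slices
    at a fixed first coordinate satisfy the induction hypothesis. *)
Lemma integral_partial (R : realType) (n : nat) (i : 'I_n) (f : 'rV[R]_n -> R) :
  continuous f -> (forall x, derivable f x (delta_mx ord0 i)) ->
  continuous (partial i f) -> bounded_support f ->
  (\int[lebesgue_rV R n]_x (partial i f x)%:E = 0)%E.
Proof.
elim: n i f => [|n IH] i f cf df cpf [M HM]; first by case: i df cpf.
have ipf : (lebesgue_rV R n.+1).-integrable setT (EFin \o partial i f).
  apply: bounded_support_integrable => //.
  by exists M => x; exact: partial_far.
rewrite integral_cons//.
have ic := integrable_cons ipf.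
have far (p : measurableTypeR R * 'rV[R]_n) : M < `|p.1| \/ M < `|p.2| ->
    M < `|rV_cons p : 'rV[R]_n.+1|.
  have p1 : `|p.1| <= `|rV_cons p : 'rV[R]_n.+1|.
    by have := coord_le_norm (rV_cons p : 'rV[R]_n.+1) ord0; rewrite mxE unlift_none.
  have p2 : `|p.2| <= `|rV_cons p : 'rV[R]_n.+1|.
    apply: rV_norm_le => // j.
    by have := coord_le_norm (rV_cons p : 'rV[R]_n.+1) (lift ord0 j); rewrite mxE liftK.
  by case=> /lt_le_trans; apply.
have [j ij|ij] := unliftP ord0 i; subst i.
- rewrite -integral12_prod_meas1//=; apply: integral0_eq => a _.
  pose g (y : 'rV[R]_n) := f (rV_cons (a, y)).
  have dg y : is_derive y (delta_mx ord0 j) g (partial (lift ord0 j) f (rV_cons (a, y))).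
    apply/is_derive_line.
    rewrite (_ : (fun t : R => _) = fun t : R => f (t *: delta_mx ord0 (lift ord0 j) + rV_cons (a, y))).
      by have /is_derive_line := derivableP (df (rV_cons (a, y))).
    by apply/funext => t; rewrite /g rV_cons_lineS.
  have E : partial j g = fun y => partial (lift ord0 j) f (rV_cons (a, y)).
    by apply/funext => y; exact: (@derive_val _ _ _ _ _ _ _ (dg y)).
  have : (\int[lebesgue_rV R n]_y (partial j g y)%:E = 0)%E.
    apply: IH.
    - move=> y; apply: continuous_comp; [exact: rV_cons_continuous|exact: cf].
    - by move=> y; have [] := dg y.
    - rewrite E => y; apply: continuous_comp; [exact: rV_cons_continuous|exact: cpf].
    - by exists M => y My; rewrite /g HM//; apply: far; right.
  by rewrite E.
- rewrite -integral21_prod_meas1//=; apply: integral0_eq => y _.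
  pose F (t : R) := f (rV_cons (t, y)).
  have cline : continuous (fun t : R => rV_cons (t, y) : 'rV[R]_n.+1).
    move=> t A /nbhs_ballP[e /= e0 eA]; apply/nbhs_ballP; exists e => // s.
    rewrite -ball_normE /ball_ /= => ts; apply: eA; rewrite -ball_normE /ball_ /=.
    apply: rV_norm_lt => // i; rewrite !mxE.
    by case: unliftP => [j _|_] //=; rewrite subrr normr0.
  apply: (@integral_deriv_bounded_support _ F (fun t => partial ord0 f (rV_cons (t, y))) M).
  + move=> t.
    rewrite (_ : F = fun s : R => f (s *: delta_mx ord0 ord0 + rV_cons (0, y))).
      have -> : rV_cons (t, y) = t *: delta_mx ord0 ord0 + rV_cons (0, y) :> 'rV[R]_n.+1.
        by rewrite -rV_cons_line0 addr0.
      apply: is_derive_along.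
      exact: (derivableP (df _)).
    by apply/funext => s; rewrite -rV_cons_line0 addr0.
  + move=> t; apply: continuous_comp; [exact: cline|exact: cpf].
  + move=> t Mt; split; first by rewrite /F HM//; apply: far; left.
    by apply: partial_far HM _; apply: far; left.
Qed.

(** * Square integrable functions, test functions and weak gradients *)

Section square_integrable.
Variables (R : realType) (n : nat) (O : set 'rV[R]_n).
Hypotheses (O_open : open O) (O_bounded : bounded_set O).
Local Notation mu := (lebesgue_rV R n).
Implicit Types (u v a : 'rV[R]_n -> R).

Definition bounded_measurable a :=
  measurable_fun O a /\ exists M : R, forall x, O x -> `|a x| <= M.

Let mO : measurable O. Proof. exact: open_measurable_rV. Qed.

Let muO : (mu O < +oo)%E. Proof. exact: bounded_set_lebesgue_rV. Qed.

Lemma bounded_measurable_cst (c : R) : bounded_measurable (fun=> c).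
Proof. by split; [exact: measurable_cst|exists `|c|]. Qed.

Lemma bounded_measurableM a b : bounded_measurable a -> bounded_measurable b ->
  bounded_measurable (fun x => a x * b x).
Proof.
move=> [ma [A HA]] [mb [B HB]]; split; first exact: measurable_funM.
by exists (A * B) => x Ox; rewrite normrM ler_pM// ?HA ?HB.
Qed.

Lemma bounded_measurable_integrable a : bounded_measurable a ->
  mu.-integrable O (EFin \o a).
Proof.
move=> [ma [A HA]]; apply: measurable_bounded_integrable => //.
by exists A; split; [exact: num_real|move=> B AB x /HA /le_trans; apply; exact: ltW].
Qed.

Lemma bounded_measurable_L2 a : bounded_measurable a -> L2 O a.
Proof.
move=> ba; split; first by have [] := ba.
by apply: bounded_measurable_integrable; exact: bounded_measurableM.
Qed.

Lemma integrable_dominated u v : measurable_fun O u ->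
  (forall x, O x -> `|u x| <= v x) -> mu.-integrable O (EFin \o v) ->
  mu.-integrable O (EFin \o u).
Proof.
move=> mu' uv; apply: le_integrable => //; first exact/measurable_EFinP.
by move=> x Ox /=; rewrite lee_fin (le_trans (uv x Ox))// ler_norm.
Qed.

Lemma integrableD_fun u v : mu.-integrable O (EFin \o u) ->
  mu.-integrable O (EFin \o v) -> mu.-integrable O (EFin \o (fun x => u x + v x)).
Proof. by move=> iu iv; have := integrableD mO iu iv. Qed.

Lemma integrableZ_fun (c : R) u : mu.-integrable O (EFin \o u) ->
  mu.-integrable O (EFin \o (fun x => c * u x)).
Proof. by move=> iu; have := integrableZl mO c iu. Qed.

Lemma integrableB_fun u v : mu.-integrable O (EFin \o u) ->
  mu.-integrable O (EFin \o v) -> mu.-integrable O (EFin \o (fun x => u x - v x)).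
Proof. by move=> iu iv; have := integrableB mO iu iv. Qed.

Lemma integrable_sum_fun (I : Type) (r : seq I) (F : I -> 'rV[R]_n -> R) :
  (forall i, mu.-integrable O (EFin \o F i)) ->
  mu.-integrable O (EFin \o (fun x => \sum_(i <- r) F i x)).
Proof.
move=> iF; elim: r => [|i r IH].
  rewrite (_ : (fun _ => _) = fun=> 0).
    exact/bounded_measurable_integrable/bounded_measurable_cst.
  by apply/funext => x; rewrite big_nil.
rewrite (_ : (fun _ => _) = fun x => F i x + \sum_(j <- r) F j x).
  exact: integrableD_fun.
by apply/funext => x; rewrite big_cons.
Qed.

Lemma Rintegral_sum (I : Type) (r : seq I) (F : I -> 'rV[R]_n -> R) :
  (forall i, mu.-integrable O (EFin \o F i)) ->
  \int[mu]_(x in O) (\sum_(i <- r) F i x) = \sum_(i <- r) \int[mu]_(x in O) F i x.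
Proof.
move=> iF; elim: r => [|i r IH].
  rewrite big_nil (_ : (fun _ => _) = fun=> 0) ?Rintegral_cst ?mul0r//.
  by apply/funext => x; rewrite big_nil.
rewrite big_cons -IH -RintegralD//; last exact: integrable_sum_fun.
by congr Rintegral; apply/funext => x; rewrite big_cons.
Qed.

Lemma L2_integrableM u v : L2 O u -> L2 O v ->
  mu.-integrable O (EFin \o (fun x => u x * v x)).
Proof.
move=> [mu' iu] [mv iv]; apply: (@integrable_dominated _ (fun x => u x ^+ 2 + v x ^+ 2)).
- exact: measurable_funM.
- move=> x _; rewrite normrM -[u x ^+ 2]real_normK ?num_real//.
  rewrite -[v x ^+ 2]real_normK ?num_real//.
  have := sqr_ge0 (`|u x| - `|v x|).
  have := mulr_ge0 (normr_ge0 (u x)) (normr_ge0 (v x)); nra.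
- exact: integrableD_fun.
Qed.

Lemma L2D u v : L2 O u -> L2 O v -> L2 O (fun x => u x + v x).
Proof.
move=> Lu Lv; have [mu' iu] := Lu; have [mv iv] := Lv; split; first exact: measurable_funD.
have := integrableD_fun (integrableD_fun iu iv) (integrableZ_fun 2 (L2_integrableM Lu Lv)).
by congr integrable; apply/funext => x /=; congr EFin; ring.
Qed.

Lemma L2M a u : bounded_measurable a -> L2 O u -> L2 O (fun x => a x * u x).
Proof.
move=> [ma [A HA]] [mu' iu]; split; first exact: measurable_funM.
apply: (@integrable_dominated _ (fun x => A ^+ 2 * u x ^+ 2)).
- by apply: measurable_funX; exact: measurable_funM.
- move=> x Ox; rewrite ger0_norm ?sqr_ge0// exprMn ler_wpM2r ?sqr_ge0//.
  have A0 : 0 <= A by exact: le_trans (HA x Ox).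
  by rewrite -[a x ^+ 2]real_normK ?num_real// lerXn2r ?nnegrE ?HA.
- exact: integrableZ_fun.
Qed.

Lemma L2Z (c : R) u : L2 O u -> L2 O (fun x => c * u x).
Proof. by move=> Lu; apply: L2M => //; exact: bounded_measurable_cst. Qed.

Lemma L2N u : L2 O u -> L2 O (fun x => - u x).
Proof.
move=> /(@L2Z (-1)); congr L2; by apply/funext => x; rewrite mulN1r.
Qed.

Lemma L2B u v : L2 O u -> L2 O v -> L2 O (fun x => u x - v x).
Proof. by move=> Lu /L2N; exact: L2D. Qed.

Lemma L2_sum (I : Type) (r : seq I) (F : I -> 'rV[R]_n -> R) :
  (forall i, L2 O (F i)) -> L2 O (fun x => \sum_(i <- r) F i x).
Proof.
move=> LF; elim: r => [|i r IH].
  rewrite (_ : (fun _ => _) = fun=> 0).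
    exact/bounded_measurable_L2/bounded_measurable_cst.
  by apply/funext => x; rewrite big_nil.
rewrite (_ : (fun _ => _) = fun x => F i x + \sum_(j <- r) F j x); first exact: L2D.
by apply/funext => x; rewrite big_cons.
Qed.

Lemma L2_norm u : L2 O u -> L2 O (fun x => `|u x|).
Proof.
move=> [mu' iu]; split; first exact: measurableT_comp.
move: iu; congr integrable; apply/funext => x /=.
by rewrite real_normK ?num_real.
Qed.

Lemma le_Rintegral_dominated u v : measurable_fun O u ->
  mu.-integrable O (EFin \o v) -> (forall x, O x -> `|u x| <= v x) ->
  `|\int[mu]_(x in O) u x| <= \int[mu]_(x in O) v x.
Proof.
move=> mu' iv uv; have iu := integrable_dominated mu' uv iv.
apply: le_trans (le_normr_Rintegral mO iu) _; apply: le_Rintegral => //.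
exact: integrable_norm.
Qed.

End square_integrable.

(** * Calculus of test functions and of functions on the closure *)

Section test_functions.
Variables (R : realType) (n : nat) (O : set 'rV[R]_n).
Hypotheses (O_open : open O) (O_bounded : bounded_set O).
Local Notation mu := (lebesgue_rV R n).
Implicit Types (u v a phi psi : 'rV[R]_n -> R) (Du Dv : 'rV[R]_n -> 'rV[R]_n).

Lemma test_smooth phi : test_function O phi -> smooth phi.
Proof. by case. Qed.

Lemma eq0_outside_support phi x : ~ closure [set y | phi y != 0] x -> phi x = 0.
Proof.
by move=> nx; apply/eqP/negP => /negP x0; apply: nx; exact: subset_closure.
Qed.

Lemma test_outside phi x : test_function O phi -> ~ O x -> phi x = 0.
Proof.
by move=> tphi nO; apply: eq0_outside_support => Sx; case: tphi => _ _ /(_ _ Sx).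
Qed.

(** The condition involves the closed support of [psi], because a derivative of [psi] may be nonzero
    at a zero of [psi]. *)
Lemma test_of_subsupport psi v : test_function O psi -> smooth v ->
  (forall x, v x != 0 -> closure [set y | psi y != 0] x) -> test_function O v.
Proof.
move=> [_ cpsi psiO] sv vpsi.
have S : closure [set x | v x != 0] `<=` closure [set x | psi x != 0].
  rewrite [X in _ `<=` X](closure_id _).1; last exact: closed_closure.
  exact: closureS.
split=> //; first exact: subclosed_compact (@closed_closure _ _) cpsi S.
exact: subset_trans S psiO.
Qed.

Lemma test_of_support psi v : test_function O psi -> smooth v ->
  (forall x, v x != 0 -> psi x != 0) -> test_function O v.
Proof.
move=> tpsi sv H; apply: (test_of_subsupport tpsi sv) => x /H x0.
exact: subset_closure.
Qed.

Lemma partial_eq0 i phi x : ~ closure [set y | phi y != 0] x -> partial i phi x = 0.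
Proof.
move=> nx; rewrite /partial.
rewrite -(@near_eq_derive _ _ _ (cst 0) phi); first by rewrite derive_cst.
have oC : open (~` closure [set y | phi y != 0]) by exact/closed_openC/closed_closure.
have := open_nbhs_nbhs (conj oC nx).
by apply: filterS => y ny; rewrite (eq0_outside_support ny).
Qed.

Lemma test_partial i phi : test_function O phi -> test_function O (partial i phi).
Proof.
move=> tphi; apply: (test_of_subsupport tphi).
  exact/smooth_partial/test_smooth.
by move=> x; apply: contraPP => nx; apply/negP; rewrite negbK (partial_eq0 i nx).
Qed.

Lemma testM phi q : test_function O phi -> smooth q ->
  test_function O (fun x => q x * phi x).
Proof.
move=> tphi sq; apply: (test_of_support tphi (smoothM sq (test_smooth tphi))).
by move=> x; apply: contraNN => /eqP ->; rewrite mulr0.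
Qed.

Lemma testD phi psi : test_function O phi -> test_function O psi ->
  test_function O (fun x => phi x + psi x).
Proof.
move=> tphi tpsi; have [sphi cphi phiO] := tphi; have [spsi cpsi psiO] := tpsi.
have S : closure [set x | phi x + psi x != 0] `<=`
    closure [set x | phi x != 0] `|` closure [set x | psi x != 0].
  rewrite -closureU; apply: closureS => x /= s0.
  have [p0|] := eqVneq (phi x) 0; last by left.
  by right; move: s0; rewrite p0 add0r.
split; first exact: smoothD.
- exact: subclosed_compact (@closed_closure _ _) (compactU cphi cpsi) S.
- by move=> x /S[/phiO|/psiO].
Qed.

Lemma test_bounded_support phi : test_function O phi -> bounded_support phi.
Proof.
move=> tphi; have [A [_ /(_ (`|A| + 1))HA]] := O_bounded.
have {}HA x : O x -> `|x| <= `|A| + 1.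
  by apply: HA; rewrite (le_lt_trans (ler_norm _))// ltrDl.
by exists (`|A| + 1) => x xA; apply: (test_outside tphi) => /HA; rewrite leNgt xA.
Qed.

Lemma test_bounded_measurable phi : test_function O phi -> bounded_measurable O phi.
Proof.
move=> tphi; have cphi := smooth_continuous (test_smooth tphi).
split; first exact: measurable_funTS (continuous_measurable cphi).
have [C _ HC] := bounded_support_bounded cphi (test_bounded_support tphi).
by exists C.
Qed.

Lemma test_L2 phi : test_function O phi -> L2 O phi.
Proof. by move=> tphi; apply: bounded_measurable_L2 => //; exact: test_bounded_measurable. Qed.

Lemma Rintegral_partial_test i phi : test_function O phi ->
  \int[mu]_(x in O) partial i phi x = 0.
Proof.
move=> tphi; have := integral_partial (smooth_continuous (test_smooth tphi)) _
  (smooth_continuous (smooth_partial i (test_smooth tphi))) (test_bounded_support tphi).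
move=> I0; rewrite Rintegral_mkcond /Rintegral.
rewrite (_ : (fun x => _) = fun x => (partial i phi x)%:E).
  by rewrite I0// => x; have [] := smooth_is_derive i x (test_smooth tphi).
apply/funext => x; rewrite patchE; case: ifPn => //; rewrite notin_setE => nO.
by rewrite (test_outside (test_partial i tphi) nO).
Qed.

Lemma compact_closure_bounded : compact (closure O).
Proof.
apply: bounded_closed_compact; last exact: closed_closure.
have [A [_ HA]] := O_bounded.
exists (`|A|); split; first exact: num_real.
move=> B AB x; rewrite closureE => /(_ [set x | `|x| <= B]); apply; split.
- apply: compact_closed; first exact: norm_hausdorff.
  exact: compact_ball0.
- by apply: HA; rewrite (le_lt_trans (ler_norm A)).
Qed.

Lemma Cbar_bounded (V : normedModType R) (u : 'rV[R]_n -> V) :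
  {within closure O, continuous u} -> exists M : R, forall x, closure O x -> `|u x| <= M.
Proof.
move=> cu; have := compact_bounded (continuous_compact cu compact_closure_bounded).
move=> [A [_ /(_ (`|A| + 1))HA]]; exists (`|A| + 1) => x Ox; apply: HA; last by exists x.
by rewrite (le_lt_trans (ler_norm _))// ltrDl.
Qed.

Lemma Cbar_continuous u x : Cbar O u -> O x -> {for x, continuous u}.
Proof.
move=> cu Ox.
have : {within O, continuous u} by apply: continuous_subspaceW cu; exact: subset_closure.
by rewrite continuous_open_subspace// => /(_ x); apply; rewrite inE.
Qed.

Lemma Cbar_bounded_measurable u : Cbar O u -> bounded_measurable O u.
Proof.
move=> cu; split.
  by apply: open_continuous_measurable => // x; exact: Cbar_continuous.
have [M HM] := Cbar_bounded cu.
by exists M => x Ox; apply: HM; exact: subset_closure.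
Qed.

Lemma C1bar_bounded_measurable u : C1bar O u -> bounded_measurable O u.
Proof. by move=> [cu _ _]; exact: Cbar_bounded_measurable. Qed.

Lemma C1bar_continuous u x : C1bar O u -> O x -> {for x, continuous u}.
Proof. by move=> [cu _ _]; exact: Cbar_continuous. Qed.

Lemma C1bar_grad_continuous u x : C1bar O u -> O x -> {for x, continuous (grad u)}.
Proof.
move=> [_ _ [g cg Hg]] Ox.
have cgO : {within O, continuous g} by apply: continuous_subspaceW cg; exact: subset_closure.
have {}cgO : {for x, continuous g}.
  by move: cgO; rewrite continuous_open_subspace// => /(_ x); apply; rewrite inE.
have OE : \forall y \near x, g y = grad u y.
  have : \forall y \near x, O y by exact: open_nbhs_nbhs.
  by apply: filterS => y; exact: Hg.
rewrite /prop_for /continuous_at -(Hg x Ox).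
apply: cvg_trans cgO; exact: (@near_eq_cvg _ _ (nbhs x) (nbhs_filter x) _ _ OE).
Qed.

Lemma C1bar_C1_on u : C1bar O u -> C1_on O u.
Proof.
move=> Cu x Ox i; split; first by have [_ du _] := Cu; exact: du.
have cg := C1bar_grad_continuous Cu Ox.
have := @continuous_comp _ _ _ (grad u) (fun y : 'rV[R]_n => y ord0 i) x cg.
rewrite (_ : _ \o _ = partial i u); first by apply; exact: coord_continuous.
by apply/funext => y /=; rewrite mxE.
Qed.

Lemma C1bar_partial_bounded_measurable u i : C1bar O u ->
  bounded_measurable O (partial i u).
Proof.
move=> Cu; split.
  by apply: open_continuous_measurable => // x Ox; have [] := C1bar_C1_on Cu Ox i.
have [_ _ [g cg Hg]] := Cu; have [M HM] := Cbar_bounded cg.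
exists M => x Ox; apply: le_trans (HM x _); last exact: subset_closure.
by rewrite Hg//; have := coord_le_norm (grad u x) i; rewrite mxE.
Qed.

End test_functions.

(** * Integration by parts and comparison of weak gradients *)

Section weak_gradients.
Variables (R : realType) (n : nat) (O : set 'rV[R]_n).
Hypotheses (O_open : open O) (O_bounded : bounded_set O).
Local Notation mu := (lebesgue_rV R n).
Implicit Types (u v a phi psi : 'rV[R]_n -> R) (Du Dv : 'rV[R]_n -> 'rV[R]_n).

Let mO : measurable O. Proof. exact: open_measurable_rV. Qed.

(** Near the support of [phi], [u] is replaced by a smooth [q] that is C^1-close to it. The integral
    of a partial derivative of [q * phi] is zero, and the error is at most [e] times a constant
    depending on [phi]. *)
Lemma weak_gradient_C1bar u : C1bar O u -> weak_gradient O u (grad u).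
Proof.
move=> Cu; have bu := C1bar_bounded_measurable O_open O_bounded Cu.
have bpu i := C1bar_partial_bounded_measurable O_open O_bounded i Cu.
split; first by apply: bounded_measurable_L2.
  move=> i; rewrite (_ : (fun x => _) = partial i u).
    by apply: bounded_measurable_L2.
  by apply/funext => x; rewrite mxE.
move=> phi i tphi; apply/eqP; rewrite -subr_eq0 opprK.
have bphi := test_bounded_measurable O_bounded tphi.
have bpphi := test_bounded_measurable O_bounded (test_partial i tphi).
have iF := bounded_measurable_integrable O_open O_bounded (bounded_measurableM bu bpphi).
have iG := bounded_measurable_integrable O_open O_bounded (bounded_measurableM (bpu i) bphi).
have -> : \int[mu]_(x in O) (grad u x ord0 i * phi x) =
    \int[mu]_(x in O) (partial i u x * phi x).
  by congr Rintegral; apply/funext => x; rewrite mxE.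
rewrite -RintegralD//.
pose B x := `|phi x| + `|partial i phi x|.
have iB : mu.-integrable O (EFin \o B).
  by apply: integrableD_fun => //; apply: integrable_norm;
    exact: bounded_measurable_integrable.
have B0 : 0 <= \int[mu]_(x in O) B x by apply: Rintegral_ge0 => x _; exact: addr_ge0.
have le_e (e : R) : 0 < e ->
    `|\int[mu]_(x in O) (u x * partial i phi x + partial i u x * phi x)| <=
    e * \int[mu]_(x in O) B x.
  move=> e0; have [sphi cK KO] := tphi.
  have [q [sq q0 q1 _]] := smooth_approx O_open cK KO (C1bar_C1_on O_open Cu) e0.
  have tqphi := testM tphi sq.
  have pq x : partial i (fun x => q x * phi x) x =
      q x * partial i phi x + phi x * partial i q x.
    exact: (@derive_val _ _ _ _ _ _ _
      (is_deriveM (smooth_is_derive i x sq) (smooth_is_derive i x sphi))).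
  have iZ : mu.-integrable O (EFin \o (fun x => q x * partial i phi x + phi x * partial i q x)).
    have := bounded_measurable_integrable O_open O_bounded
      (test_bounded_measurable O_bounded (test_partial i tqphi)).
    by congr integrable; apply/funext => x /=; rewrite pq.
  have E : \int[mu]_(x in O) (q x * partial i phi x + phi x * partial i q x) = 0.
    rewrite -(Rintegral_partial_test O_bounded i tqphi).
    by congr Rintegral; apply/funext => x; rewrite pq.
  rewrite -[X in `|X|]subr0 -E -RintegralB//; last exact: integrableD_fun.
  have /integrableP[/measurable_EFinP mD _] := integrableB_fun O_open
    (integrableD_fun O_open iF iG) iZ.
  rewrite -RintegralZl//; apply: le_Rintegral_dominated => //.
    exact: integrableZ_fun.
  move=> x Ox; rewrite /B.
  have [Kx|nK] := pselect (closure [set y | phi y != 0] x); last first.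
    rewrite (eq0_outside_support nK) (partial_eq0 i nK).
    by rewrite !(mulr0, mul0r, addr0, subr0, normr0).
  have -> : u x * partial i phi x + partial i u x * phi x -
     (q x * partial i phi x + phi x * partial i q x) =
     (partial i u x - partial i q x) * phi x + (u x - q x) * partial i phi x by ring.
  apply: le_trans (ler_normD _ _) _; rewrite mulrDr !normrM.
  by rewrite lerD// ler_wpM2r// ?q0 ?q1.
rewrite -normr_le0; apply/ler_addgt0Pr => e e0; rewrite add0r.
(* Adding 1 keeps the divisor positive even when the integral of [B] is zero. *)
have B1 : 0 < \int[mu]_(x in O) B x + 1 by rewrite ltr_wpDl.
apply: le_trans (le_e _ (divr_gt0 e0 B1)) _.
by rewrite mulrAC ler_pdivrMr// ler_wpM2l ?(ltW e0)// lerDl.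
Qed.

Lemma weak_gradient_linear (c : R) u v Du Dv : weak_gradient O u Du -> weak_gradient O v Dv ->
  weak_gradient O (fun x => c * u x + v x) (fun x => c *: Du x + Dv x).
Proof.
move=> [Lu LDu Wu] [Lv LDv Wv]; split.
- by apply: L2D => //; exact: L2Z.
- move=> i; rewrite (_ : (fun x => _) = fun x => c * Du x ord0 i + Dv x ord0 i).
    by apply: L2D => //; exact: L2Z.
  by apply/funext => x; rewrite !mxE.
move=> phi i tphi.
have Lphi := test_L2 O_open O_bounded tphi.
have Lpphi := test_L2 O_open O_bounded (test_partial i tphi).
have -> : \int[mu]_(x in O) ((c * u x + v x) * partial i phi x) =
   c * \int[mu]_(x in O) (u x * partial i phi x) + \int[mu]_(x in O) (v x * partial i phi x).
  rewrite -RintegralZl//; last exact: L2_integrableM.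
  rewrite -RintegralD//; last exact: L2_integrableM.
    by congr Rintegral; apply/funext => x; rewrite mulrDl mulrA.
  by apply: integrableZ_fun => //; exact: L2_integrableM.
have -> : \int[mu]_(x in O) ((c *: Du x + Dv x) ord0 i * phi x) =
   c * \int[mu]_(x in O) (Du x ord0 i * phi x) + \int[mu]_(x in O) (Dv x ord0 i * phi x).
  rewrite -RintegralZl//; last by apply: L2_integrableM => //; exact: LDu.
  rewrite -RintegralD//; last by apply: L2_integrableM => //; exact: LDv.
    by congr Rintegral; apply/funext => x; rewrite !mxE mulrDl mulrA.
  by apply: integrableZ_fun => //; apply: L2_integrableM => //; exact: LDu.
by rewrite Wu// Wv// opprD mulrN.
Qed.

(* Two weak gradients of [u] agree almost everywhere, but pairing them with a
   coefficient times a test function is all that is needed: the coefficient is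
   replaced by a smooth function, so that the product is a test function. *)
Lemma weak_gradient_pairing u a D1 D2 phi i : weak_gradient O u D1 ->
  weak_gradient O u D2 -> C1bar O a -> test_function O phi ->
  \int[mu]_(x in O) (D1 x ord0 i * (a x * phi x)) =
  \int[mu]_(x in O) (D2 x ord0 i * (a x * phi x)).
Proof.
move=> [_ L1 W1] [_ L2' W2] Ca tphi.
have ba := C1bar_bounded_measurable O_open O_bounded Ca.
have Lphi := test_L2 O_open O_bounded tphi.
have Laphi := L2M O_open ba Lphi.
pose F x := D1 x ord0 i - D2 x ord0 i.
have LF : L2 O F by exact: (L2B O_open (L1 i) (L2' i)).
have F0 psi : test_function O psi -> \int[mu]_(x in O) (F x * psi x) = 0.
  move=> tpsi; have Lpsi := test_L2 O_open O_bounded tpsi.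
  have := W1 psi i tpsi; rewrite (W2 psi i tpsi) => /oppr_inj E.
  rewrite (_ : (fun x => _) = fun x => D1 x ord0 i * psi x - D2 x ord0 i * psi x).
    rewrite RintegralB//; first by rewrite E subrr.
      by apply: L2_integrableM => //; exact: L1.
    by apply: L2_integrableM => //; exact: L2'.
  by apply/funext => x; rewrite mulrBl.
have i1 : mu.-integrable O (EFin \o (fun x => D1 x ord0 i * (a x * phi x))).
  by apply: L2_integrableM => //; exact: L1.
have i2 : mu.-integrable O (EFin \o (fun x => D2 x ord0 i * (a x * phi x))).
  by apply: L2_integrableM => //; exact: L2'.
apply/eqP; rewrite -subr_eq0 -RintegralB//.
pose B x := `|F x * phi x|.
have iB : mu.-integrable O (EFin \o B) by apply/integrable_norm/L2_integrableM.
have B0 : 0 <= \int[mu]_(x in O) B x by apply: Rintegral_ge0 => x _; exact: normr_ge0.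
have le_e (e : R) : 0 < e ->
    `|\int[mu]_(x in O) (D1 x ord0 i * (a x * phi x) - D2 x ord0 i * (a x * phi x))| <=
    e * \int[mu]_(x in O) B x.
  move=> e0; have [_ cK KO] := tphi.
  have [q [sq q0 _ _]] := smooth_approx O_open cK KO (C1bar_C1_on O_open Ca) e0.
  have tqphi := testM tphi sq.
  have iq : mu.-integrable O (EFin \o (fun x => F x * (q x * phi x))).
    by apply: L2_integrableM => //; exact: test_L2.
  rewrite -[X in `|X|]subr0 -(F0 _ tqphi) -RintegralB//; last exact: integrableB_fun.
  have /integrableP[/measurable_EFinP mD _] := integrableB_fun O_open
    (integrableB_fun O_open i1 i2) iq.
  rewrite -RintegralZl//; apply: le_Rintegral_dominated => //.
    exact: integrableZ_fun.
  move=> x Ox; rewrite /B /F.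
  have [Kx|nK] := pselect (closure [set y | phi y != 0] x); last first.
    rewrite (eq0_outside_support nK).
    by rewrite !(mulr0, mul0r, addr0, subr0, normr0).
  have -> : D1 x ord0 i * (a x * phi x) - D2 x ord0 i * (a x * phi x) -
     (D1 x ord0 i - D2 x ord0 i) * (q x * phi x) =
     (a x - q x) * ((D1 x ord0 i - D2 x ord0 i) * phi x) by ring.
  by rewrite normrM ler_wpM2r// q0.
rewrite -normr_le0; apply/ler_addgt0Pr => e e0; rewrite add0r.
have B1 : 0 < \int[mu]_(x in O) B x + 1 by rewrite ltr_wpDl.
apply: le_trans (le_e _ (divr_gt0 e0 B1)) _.
by rewrite mulrAC ler_pdivrMr// ler_wpM2l ?(ltW e0)// lerDl.
Qed.

End weak_gradients.

(** * The weak maximum principle *)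

Section cutoff_profiles.
Variable R : realType.
Implicit Types t : R.

(* Jbeta' = beta, Kbeta' = t beta' and Jbeta + Kbeta = t beta, all in closed form. *)
Definition beta t : R := (1 + 2 * t) * flat t.
Definition dbeta t : R := 2 * flat t + (1 + 2 * t) * dflat t.
Definition Jbeta t : R := t ^+ 2 * flat t.
Definition Kbeta t : R := (t + t ^+ 2) * flat t.

(** This identity dictates the formula for [beta]: the derivative of [t ^ 2 * flat t] becomes
    [(2 * t + 1) * flat t], and [t * beta' t] integrates in the same way. *)
Lemma sqr_dflat t : t ^+ 2 * dflat t = flat t.
Proof.
have [t0|t0] := leP t 0; first by rewrite flat_le0// dflat_le0// mulr0.
by rewrite flatE// dflatE// mulrA -exprMn divff ?expr1n ?mul1r// gt_eqF.
Qed.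

Lemma flat_le t : 0 < t -> (1 + t) * flat t <= t.
Proof.
move=> t0; rewrite flatE// expRN ler_pdivrMr ?expR_gt0//.
have -> : 1 + t = t * (1 + t^-1) by rewrite mulrDr mulr1 divff ?gt_eqF// addrC.
by rewrite ler_pM2l// expR_ge1Dx.
Qed.

Lemma flat_le_id t : 0 < t -> flat t <= t.
Proof. by move=> t0; have := flat_le t0; have := flat_ge0 t; nra. Qed.

Lemma mul_dflat_le1 t : 0 < t -> t * dflat t <= 1.
Proof.
move=> t0; have -> : t * dflat t = t^-1 * flat t.
  by rewrite -sqr_dflat; field; exact: lt0r_neq0.
by rewrite mulrC ler_pdivrMr// mul1r flat_le_id.
Qed.

Lemma beta_le0 t : t <= 0 -> beta t = 0.
Proof. by move=> t0; rewrite /beta flat_le0// mulr0. Qed.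

Lemma dbeta_le0 t : t <= 0 -> dbeta t = 0.
Proof. by move=> t0; rewrite /dbeta flat_le0// dflat_le0// !mulr0 addr0. Qed.

Lemma beta_ge0 t : 0 <= beta t.
Proof.
have [t0|t0] := leP t 0; first by rewrite beta_le0.
by rewrite mulr_ge0 ?flat_ge0//; lra.
Qed.

Lemma beta_le t : 0 < t -> beta t <= 2 * t.
Proof. by move=> t0; have := flat_le t0; have := flat_ge0 t; rewrite /beta; nra. Qed.

Lemma dbeta_ge0 t : 0 <= dbeta t.
Proof.
have [t0|t0] := leP t 0; first by rewrite dbeta_le0.
by rewrite addr_ge0// mulr_ge0 ?flat_ge0 ?dflat_ge0//; lra.
Qed.

(** The terms [2 * flat t], [dflat t] and [2 * (t * dflat t)] contribute at most 2, 1 and 2. *)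
Lemma dbeta_le5 t : dbeta t <= 5.
Proof.
have [t0|t0] := leP t 0; first by rewrite dbeta_le0.
have := mul_dflat_le1 t0; have := flat_le1 t; have := dflat_le1 t.
by rewrite /dbeta; nra.
Qed.

(** It lets the energy, weighted by [dbeta p], dominate the squared gradient of [flat p]. *)
Lemma sqr_dflat_le_dbeta t : dflat t ^+ 2 <= dbeta t.
Proof.
have [t0|t0] := leP t 0; first by rewrite dbeta_le0// dflat_le0// expr0n.
have := flat_ge0 t; have := dflat_le1 t; have := dflat_ge0 t.
by rewrite /dbeta; nra.
Qed.

Lemma Jbeta_ge0 t : 0 <= Jbeta t.
Proof. by rewrite mulr_ge0 ?sqr_ge0 ?flat_ge0. Qed.

Lemma Kbeta_ge0 t : 0 <= Kbeta t.
Proof.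
have [t0|t0] := leP t 0; first by rewrite /Kbeta flat_le0// mulr0.
by rewrite mulr_ge0 ?flat_ge0// addr_ge0 ?sqr_ge0// ltW.
Qed.

Let is_derive_affine (a b : R) t : is_derive t 1 (fun s : R => a + b * s) b.
Proof.
have := is_deriveD (is_derive_cst a t 1) (is_deriveZ b (is_derive_id t 1)).
by move=> D; apply: is_derive_eq D _; rewrite add0r [LHS]mulr1.
Qed.

Let is_derive_sqr t : is_derive t 1 (fun s : R => s ^+ 2) (2 * t).
Proof.
have := is_deriveX 2 (is_derive_id t 1).
move=> D; apply: is_derive_eq D _.
by rewrite expr1 [LHS]mulr1.
Qed.

Lemma is_derive_beta t : is_derive t 1 beta (dbeta t).
Proof.
apply: is_derive_eq (is_deriveM (is_derive_affine 1 2 t) (is_derive_flat t)) _.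
by rewrite /dbeta -![_ *: _]/(_ * _); ring.
Qed.

Lemma is_derive_Jbeta t : is_derive t 1 Jbeta (beta t).
Proof.
apply: is_derive_eq (is_deriveM (is_derive_sqr t) (is_derive_flat t)) _.
by rewrite /beta -![_ *: _]/(_ * _) sqr_dflat; ring.
Qed.

Lemma is_derive_Kbeta t : is_derive t 1 Kbeta (t * dbeta t).
Proof.
apply: is_derive_eq (is_deriveM (is_deriveD (is_derive_id t 1) (is_derive_sqr t))
  (is_derive_flat t)) _.
rewrite /dbeta -![_ *: _]/(_ * _) !fctE /= -[flat t in RHS]sqr_dflat.
by rewrite -[X in _ + X = _]/(flat t * _) -sqr_dflat; ring.
Qed.

End cutoff_profiles.

(** * The integrand of the weak formulation *)

Section operator_form.
Variables (R : realType) (n : nat).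
Local Notation mu := (lebesgue_rV R n).
Implicit Types (u v a phi psi p : 'rV[R]_n -> R) (Du Dv : 'rV[R]_n -> 'rV[R]_n)
  (L : operator R n).

Definition op_form L u Du phi x : R :=
  \sum_i (\sum_j opA L x i j * Du x ord0 j + opb L x ord0 i * u x) * partial i phi x
  + (\sum_i opc L x ord0 i * Du x ord0 i) * phi x + opd L x * u x * phi x.

(** Every term is brought to the shape: [u] or a component of [Du], times a coefficient, times a
    test function. Linearity, integrability and the change of weak gradient are all read off this
    shape. *)
Lemma op_formE L u Du phi x : op_form L u Du phi x =
  \sum_i \sum_j Du x ord0 j * (opA L x i j * partial i phi x)
  + \sum_i u x * (opb L x ord0 i * partial i phi x)
  + \sum_i Du x ord0 i * (opc L x ord0 i * phi x) + u x * (opd L x * phi x).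
Proof.
rewrite /op_form -big_split /= mulr_suml; congr (_ + _ + _); last by ring.
  apply: eq_bigr => i _; rewrite mulrDl mulr_suml; congr (_ + _); last by ring.
  by apply: eq_bigr => j _; ring.
by apply: eq_bigr => i _; ring.
Qed.

Lemma op_form_linear L (c : R) u v Du Dv phi x :
  op_form L (fun x => c * u x + v x) (fun x => c *: Du x + Dv x) phi x =
  c * op_form L u Du phi x + op_form L v Dv phi x.
Proof.
pose w x := c * u x + v x; pose Dw x := c *: Du x + Dv x.
rewrite -[LHS]/(op_form L w Dw phi x) !op_formE.
have sumL (F G H : 'I_n -> R) : (forall i, F i = c * G i + H i) ->
    \sum_i F i = c * \sum_i G i + \sum_i H i.
  by move=> E; rewrite mulr_sumr -big_split /=; exact: eq_bigr.
have E1 : \sum_i \sum_j Dw x ord0 j * (opA L x i j * partial i phi x) =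
    c * (\sum_i \sum_j Du x ord0 j * (opA L x i j * partial i phi x)) +
    \sum_i \sum_j Dv x ord0 j * (opA L x i j * partial i phi x).
  by apply: (sumL) => i; apply: (sumL) => j; rewrite /Dw !mxE; ring.
have E2 : \sum_i w x * (opb L x ord0 i * partial i phi x) =
    c * (\sum_i u x * (opb L x ord0 i * partial i phi x)) +
    \sum_i v x * (opb L x ord0 i * partial i phi x).
  by apply: (sumL) => i; rewrite /w; ring.
have E3 : \sum_i Dw x ord0 i * (opc L x ord0 i * phi x) =
    c * (\sum_i Du x ord0 i * (opc L x ord0 i * phi x)) +
    \sum_i Dv x ord0 i * (opc L x ord0 i * phi x).
  by apply: (sumL) => i; rewrite /Dw !mxE; ring.
have E4 : w x * (opd L x * phi x) = c * (u x * (opd L x * phi x)) + v x * (opd L x * phi x).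
  by rewrite /w; ring.
have add4 (a1 b1 a2 b2 a3 b3 a4 b4 : R) :
    (c * a1 + b1) + (c * a2 + b2) + (c * a3 + b3) + (c * a4 + b4) =
    c * (a1 + a2 + a3 + a4) + (b1 + b2 + b3 + b4) by ring.
by rewrite [X in X + _ + _ + _ = _]E1 [X in _ + X + _ + _ = _]E2
  [X in _ + X + _ = _]E3 [X in _ + X = _]E4; exact: add4.
Qed.

Lemma partial_comp (F dF : R -> R) p i x : (forall t : R, is_derive t 1 F (dF t)) ->
  smooth p -> partial i (fun y => F (p y)) x = dF (p x) * partial i p x.
Proof.
move=> dF' sp.
exact: (@derive_val _ _ _ _ _ _ _ (is_derive_comp (dF' (p x)) (smooth_is_derive i x sp))).
Qed.

(** The [b] terms assemble into the gradient of [Kbeta p] and the [c] terms into that of [Jbeta p].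
    The zero-order term [d * p * beta p] is shared between them because
    [Jbeta t + Kbeta t = t * beta t]. *)
Lemma op_form_beta L p x : smooth p ->
  op_form L p (grad p) (fun y => beta (p y)) x =
  dbeta (p x) * (\sum_i \sum_j opA L x i j * partial i p x * partial j p x)
  + (opd L x * Kbeta (p x) + \sum_i opb L x ord0 i * partial i (fun y => Kbeta (p y)) x)
  + (opd L x * Jbeta (p x) + \sum_i opc L x ord0 i * partial i (fun y => Jbeta (p y)) x).
Proof.
move=> sp; rewrite op_formE.
have E1 : \sum_i \sum_j grad p x ord0 j * (opA L x i j * partial i (fun y => beta (p y)) x) =
    dbeta (p x) * (\sum_i \sum_j opA L x i j * partial i p x * partial j p x).
  rewrite mulr_sumr; apply: eq_bigr => i _; rewrite mulr_sumr; apply: eq_bigr => j _.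
  by rewrite mxE (partial_comp _ _ (@is_derive_beta R))//; ring.
have E2 : \sum_i p x * (opb L x ord0 i * partial i (fun y => beta (p y)) x) =
    \sum_i opb L x ord0 i * partial i (fun y => Kbeta (p y)) x.
  apply: eq_bigr => i _.
  by rewrite (partial_comp _ _ (@is_derive_beta R))// (partial_comp _ _ (@is_derive_Kbeta R))//; ring.
have E3 : \sum_i grad p x ord0 i * (opc L x ord0 i * beta (p x)) =
    \sum_i opc L x ord0 i * partial i (fun y => Jbeta (p y)) x.
  apply: eq_bigr => i _; rewrite mxE.
  by rewrite (partial_comp _ _ (@is_derive_Jbeta R))//; ring.
rewrite E1 E2 E3 /Jbeta /Kbeta /beta; ring.
Qed.

End operator_form.

(** * Integrals of the form and the lower energy bound *)

Section energy.
Variables (R : realType) (n : nat) (O : set 'rV[R]_n).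
Hypotheses (O_open : open O) (O_bounded : bounded_set O).
Local Notation mu := (lebesgue_rV R n).
Implicit Types (u v a phi psi p w : 'rV[R]_n -> R) (Du Dv Dw : 'rV[R]_n -> 'rV[R]_n)
  (L : operator R n).

Let mO : measurable O. Proof. exact: open_measurable_rV. Qed.

Definition C1bar_coefficients L := [/\ forall i j, C1bar O (fun x => opA L x i j),
  forall i, C1bar O (fun x => opb L x ord0 i), forall i, C1bar O (fun x => opc L x ord0 i) &
  C1bar O (opd L)].

Lemma admissible_C1bar (alpha : R) L : admissible alpha O L -> C1bar_coefficients L.
Proof.
move=> [[cA cb cc cd] _ _ _ _]; split=> [i j|i|i|].
- by have [] := cA i j.
- by have [] := cb i.
- by have [] := cc i.
- by have [] := cd.
Qed.

Lemma op_form_terms_integrable L u Du phi : C1bar_coefficients L ->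
  L2 O u -> (forall i, L2 O (fun x => Du x ord0 i)) -> test_function O phi ->
  [/\ forall i j, mu.-integrable O (EFin \o (fun x => Du x ord0 j * (opA L x i j * partial i phi x))),
      forall i, mu.-integrable O (EFin \o (fun x => u x * (opb L x ord0 i * partial i phi x))),
      forall i, mu.-integrable O (EFin \o (fun x => Du x ord0 i * (opc L x ord0 i * phi x))) &
      mu.-integrable O (EFin \o (fun x => u x * (opd L x * phi x)))].
Proof.
move=> [cA cb cc cd] Lu LDu tphi.
have Lphi := test_L2 O_open O_bounded tphi.
have Lpphi i := test_L2 O_open O_bounded (test_partial i tphi).
have B a : C1bar O a -> bounded_measurable O a by exact: C1bar_bounded_measurable.
split=> [i j|i|i|]; apply: L2_integrableM => //; apply: L2M => //; exact: B.
Qed.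

Lemma op_form_integrable L u Du phi : C1bar_coefficients L ->
  L2 O u -> (forall i, L2 O (fun x => Du x ord0 i)) -> test_function O phi ->
  mu.-integrable O (EFin \o op_form L u Du phi).
Proof.
move=> cL Lu LDu tphi; have [iA ib ic id'] := op_form_terms_integrable cL Lu LDu tphi.
rewrite (_ : op_form L u Du phi = (fun x => (((\sum_i \sum_j Du x ord0 j * (opA L x i j * partial i phi x))
  + \sum_i u x * (opb L x ord0 i * partial i phi x))
  + \sum_i Du x ord0 i * (opc L x ord0 i * phi x)) + u x * (opd L x * phi x))); last first.
  by apply/funext => x; exact: op_formE.
apply: integrableD_fun => //; apply: integrableD_fun => //; last exact: integrable_sum_fun.
apply: integrableD_fun => //; last exact: integrable_sum_fun.
exact: (integrable_sum_fun O_open O_bounded _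
    (fun i => integrable_sum_fun O_open O_bounded _ (iA i))).
Qed.

Lemma Rintegral_op_form L u Du phi : C1bar_coefficients L ->
  L2 O u -> (forall i, L2 O (fun x => Du x ord0 i)) -> test_function O phi ->
  \int[mu]_(x in O) op_form L u Du phi x =
  \sum_i \sum_j \int[mu]_(x in O) (Du x ord0 j * (opA L x i j * partial i phi x))
  + \sum_i \int[mu]_(x in O) (u x * (opb L x ord0 i * partial i phi x))
  + \sum_i \int[mu]_(x in O) (Du x ord0 i * (opc L x ord0 i * phi x))
  + \int[mu]_(x in O) (u x * (opd L x * phi x)).
Proof.
move=> cL Lu LDu tphi; have [iA ib ic id'] := op_form_terms_integrable cL Lu LDu tphi.
rewrite (_ : op_form L u Du phi = (fun x => (((\sum_i \sum_j Du x ord0 j * (opA L x i j * partial i phi x))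
  + \sum_i u x * (opb L x ord0 i * partial i phi x))
  + \sum_i Du x ord0 i * (opc L x ord0 i * phi x)) + u x * (opd L x * phi x))); last first.
  by apply/funext => x; exact: op_formE.
have i1 : mu.-integrable O (EFin \o (fun x => \sum_i \sum_j Du x ord0 j * (opA L x i j * partial i phi x))).
  exact: (integrable_sum_fun O_open O_bounded _
    (fun i => integrable_sum_fun O_open O_bounded _ (iA i))).
have i2 : mu.-integrable O (EFin \o (fun x => \sum_i u x * (opb L x ord0 i * partial i phi x))).
  exact: integrable_sum_fun.
have i3 : mu.-integrable O (EFin \o (fun x => \sum_i Du x ord0 i * (opc L x ord0 i * phi x))).
  exact: integrable_sum_fun.
have i12 := integrableD_fun O_open i1 i2; have i123 := integrableD_fun O_open i12 i3.
rewrite (RintegralD mO i123 id') (RintegralD mO i12 i3) (RintegralD mO i1 i2).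
rewrite (Rintegral_sum O_open O_bounded _ ib) (Rintegral_sum O_open O_bounded _ ic).
rewrite (Rintegral_sum O_open O_bounded _
  (fun i => integrable_sum_fun O_open O_bounded _ (iA i))).
congr (_ + _ + _ + _); apply: eq_bigr => i _.
exact: (Rintegral_sum O_open O_bounded _ (iA i)).
Qed.

(** A solution comes with some weak gradient for its equation, while the Sobolev approximation
    provides another one; this allows passing between them. In the principal part [partial i phi] is
    itself a test function, so the pairing lemma applies. *)
Lemma Rintegral_op_form_gradient L u D1 D2 phi : C1bar_coefficients L ->
  weak_gradient O u D1 -> weak_gradient O u D2 -> test_function O phi ->
  \int[mu]_(x in O) op_form L u D1 phi x = \int[mu]_(x in O) op_form L u D2 phi x.
Proof.
move=> cL W1 W2 tphi; have [cA cb cc cd] := cL.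
have [Lu L1 _] := W1; have [_ L2' _] := W2.
rewrite !Rintegral_op_form//; congr (_ + _ + _ + _).
  apply: eq_bigr => i _; apply: eq_bigr => j _.
  by apply: (weak_gradient_pairing O_open O_bounded j W1 W2 (cA i j)); exact: test_partial.
by apply: eq_bigr => i _; apply: (weak_gradient_pairing O_open O_bounded i W1 W2 (cc i)).
Qed.

Lemma smooth_bounded_measurable p : smooth p -> bounded_measurable O p.
Proof.
move=> sp; have cp := smooth_continuous sp.
split; first exact: measurable_funTS (continuous_measurable cp).
have cw : {within closure O, continuous p} by exact: continuous_subspaceT.
have [M HM] := Cbar_bounded O_bounded cw.
by exists M => x Ox; apply: HM; exact: subset_closure.
Qed.

Lemma smooth_flat p : smooth p -> smooth (fun x => flat (p x)).
Proof. exact: smooth_flatp. Qed.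

Lemma smooth_dflat p : smooth p -> smooth (fun x => dflat (p x)).
Proof. exact: smooth_flatp. Qed.

Lemma smooth_beta p : smooth p -> smooth (fun x => beta (p x)).
Proof.
move=> sp; apply: smoothM (smooth_flat sp).
exact: smoothD (@smooth_cst R n 1) (smoothM (@smooth_cst R n 2) sp).
Qed.

Lemma smooth_dbeta p : smooth p -> smooth (fun x => dbeta (p x)).
Proof.
move=> sp; apply: smoothD; first exact: smoothM (@smooth_cst R n 2) (smooth_flat sp).
apply: smoothM (smooth_dflat sp).
exact: smoothD (@smooth_cst R n 1) (smoothM (@smooth_cst R n 2) sp).
Qed.

Lemma smooth_Jbeta p : smooth p -> smooth (fun x => Jbeta (p x)).
Proof. by move=> sp; exact: smoothM (smoothM sp sp) (smooth_flat sp). Qed.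

Lemma smooth_Kbeta p : smooth p -> smooth (fun x => Kbeta (p x)).
Proof. by move=> sp; exact: smoothM (smoothD sp (smoothM sp sp)) (smooth_flat sp). Qed.

Lemma test_positive_part psi p (F : R -> R) : test_function O psi ->
  (forall x, 0 < p x -> psi x != 0) -> smooth (fun x => F (p x)) ->
  (forall t, t <= 0 -> F t = 0) -> test_function O (fun x => F (p x)).
Proof.
move=> tpsi ppsi sF F0; apply: (test_of_support tpsi sF) => x Fx; apply: ppsi.
by rewrite ltNge; apply: contraNN Fx => /F0 ->.
Qed.

(** The support of [psi] contains the set where [p > 0]; hence [Jbeta p] and [Kbeta p] are
    nonnegative test functions, to which the two sign conditions apply. Ellipticity bounds what
    remains. *)
Lemma energy_lower (alpha Lam : R) L psi p : admissible alpha O L ->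
  0 < Lam ->
  (forall x (xi : 'rV[R]_n), O x -> xi != 0 ->
     Lam^-1 * \sum_i xi ord0 i ^+ 2 <= \sum_i \sum_j opA L x i j * xi ord0 i * xi ord0 j) ->
  test_function O psi -> smooth p -> (forall x, 0 < p x -> psi x != 0) ->
  Lam^-1 * \int[mu]_(x in O) (dbeta (p x) * \sum_i partial i p x ^+ 2) <=
  \int[mu]_(x in O) op_form L p (grad p) (fun y => beta (p y)) x.
Proof.
move=> adm Lam0 ell tpsi sp ppsi; have cL := admissible_C1bar adm.
have [cA cb cc cd] := cL; have [_ _ _ admb admc] := adm.
have B a : C1bar O a -> bounded_measurable O a by exact: C1bar_bounded_measurable.
have S := smooth_bounded_measurable.
have Sp i := S _ (smooth_partial i sp).
have tK : test_function O (fun y => Kbeta (p y)).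
  apply: (test_positive_part tpsi ppsi (smooth_Kbeta sp)) => t t0.
  by rewrite /Kbeta flat_le0// mulr0.
have tJ : test_function O (fun y => Jbeta (p y)).
  apply: (test_positive_part tpsi ppsi (smooth_Jbeta sp)) => t t0.
  by rewrite /Jbeta flat_le0// mulr0.
have I := bounded_measurable_integrable O_open O_bounded.
have Isum := integrable_sum_fun O_open O_bounded.
have IK : mu.-integrable O (EFin \o (fun x => opd L x * Kbeta (p x) +
    \sum_i opb L x ord0 i * partial i (fun y => Kbeta (p y)) x)).
  apply: integrableD_fun => //; last apply: Isum => i; apply: I; apply: bounded_measurableM;
    do ?[exact: B | exact: test_bounded_measurable tK | exact: test_bounded_measurable (test_partial _ tK)].
have IJ : mu.-integrable O (EFin \o (fun x => opd L x * Jbeta (p x) +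
    \sum_i opc L x ord0 i * partial i (fun y => Jbeta (p y)) x)).
  apply: integrableD_fun => //; last apply: Isum => i; apply: I; apply: bounded_measurableM;
    do ?[exact: B | exact: test_bounded_measurable tJ | exact: test_bounded_measurable (test_partial _ tJ)].
have IA : mu.-integrable O (EFin \o (fun x =>
    dbeta (p x) * (\sum_i \sum_j opA L x i j * partial i p x * partial j p x))).
  rewrite (_ : (fun x => _) = fun x =>
      \sum_i \sum_j dbeta (p x) * (opA L x i j * partial i p x * partial j p x)).
    apply: (Isum) => i; apply: (Isum) => j; apply: I.
    apply: bounded_measurableM; first exact/S/smooth_dbeta.
    apply: bounded_measurableM => //; apply: bounded_measurableM => //; exact: B.
  by apply/funext => x; rewrite mulr_sumr; under [RHS]eq_bigr do rewrite -mulr_sumr.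
have ID : mu.-integrable O (EFin \o (fun x => dbeta (p x) * \sum_i partial i p x ^+ 2)).
  rewrite (_ : (fun x => _) = fun x => \sum_i dbeta (p x) * (partial i p x * partial i p x)).
    apply: (Isum) => i; apply: I; apply: bounded_measurableM; first exact/S/smooth_dbeta.
    exact: bounded_measurableM.
  by apply/funext => x; rewrite mulr_sumr.
rewrite (_ : op_form L p (grad p) _ = (fun x =>
  dbeta (p x) * (\sum_i \sum_j opA L x i j * partial i p x * partial j p x)
  + (opd L x * Kbeta (p x) + \sum_i opb L x ord0 i * partial i (fun y => Kbeta (p y)) x)
  + (opd L x * Jbeta (p x) + \sum_i opc L x ord0 i * partial i (fun y => Jbeta (p y)) x))); last first.
  by apply/funext => x; exact: op_form_beta.
rewrite (RintegralD mO (integrableD_fun O_open IA IK) IJ) (RintegralD mO IA IK) -addrA.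
apply: le_trans (_ : _ <= \int[mu]_(x in O) (dbeta (p x) *
   (\sum_i \sum_j opA L x i j * partial i p x * partial j p x))) _.
  rewrite -(RintegralZl _ mO ID); apply: (le_Rintegral mO (integrableZ_fun O_open _ ID) IA).
  move=> x Ox; rewrite mulrCA ler_wpM2l ?dbeta_ge0//.
  (* Ellipticity is stated for nonzero vectors only. *)
  have [g0|g0] := eqVneq (grad p x) 0.
    have pz i : partial i p x = 0 by have := congr1 (fun M : 'rV[R]_n => M ord0 i) g0; rewrite !mxE.
    rewrite !big1 ?mulr0// => [i _|i _]; last by rewrite pz expr0n.
    by rewrite big1// => j _; rewrite !pz mulr0.
  have := ell x _ Ox g0.
  under eq_bigr do rewrite mxE.
  by under [X in _ <= X -> _]eq_bigr do under eq_bigr do rewrite !mxE.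
rewrite lerDl addr_ge0//.
- by apply: admb => // x; exact: Kbeta_ge0.
- by apply: admc => // x; exact: Jbeta_ge0.
Qed.

End energy.

(** * The Poincare inequality and the upper energy bound *)

Section maximum_principle.
Variables (R : realType) (n : nat) (O : set 'rV[R]_n).
Hypotheses (O_open : open O) (O_bounded : bounded_set O).
Local Notation mu := (lebesgue_rV R n).
Implicit Types (u v a phi psi p w : 'rV[R]_n -> R) (Du Dv Dw : 'rV[R]_n -> 'rV[R]_n)
  (L : operator R n).

Let mO : measurable O. Proof. exact: open_measurable_rV. Qed.

(** The [i]-th derivative of [x_i * V ^ 2] integrates to zero, so the integral of [V ^ 2] is that of
    [- 2 * x_i * V * partial i V]. With [|x_i| <= B], Young's inequality absorbs half of the left
    side and gives the constant [4 * B ^ 2]. *)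
Lemma poincare (i : 'I_n) : exists2 C : R, 0 <= C & forall V, test_function O V ->
  \int[mu]_(x in O) (V x ^+ 2) <= C * \int[mu]_(x in O) (partial i V x ^+ 2).
Proof.
have [A [_ /(_ (`|A| + 1))HA]] := O_bounded.
have {}HA x : O x -> `|x| <= `|A| + 1.
  by apply: HA; rewrite (le_lt_trans (ler_norm _))// ltrDl.
pose B := `|A| + 1.
exists (4 * B ^+ 2); first by rewrite mulr_ge0// sqr_ge0.
move=> V tV; have sV := test_smooth tV.
have tT : test_function O (fun x => (x ord0 i * V x) * V x).
  exact: testM tV (smoothM (@smooth_coord R n i) sV).
have bV := test_bounded_measurable O_bounded tV.
have bpV := test_bounded_measurable O_bounded (test_partial i tV).
have bx : bounded_measurable O (fun x : 'rV[R]_n => x ord0 i).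
  exact: (smooth_bounded_measurable O_bounded (@smooth_coord R n i)).
have I := bounded_measurable_integrable O_open O_bounded.
have iV2 : mu.-integrable O (EFin \o (fun x => V x ^+ 2)).
  exact: I (bounded_measurableM bV bV).
have ipV2 : mu.-integrable O (EFin \o (fun x => partial i V x ^+ 2)).
  exact: I (bounded_measurableM bpV bpV).
have icross := I _ (bounded_measurableM (bounded_measurableM bx bV) bpV).
have pT x : partial i (fun x : 'rV[R]_n => (x ord0 i * V x) * V x) x =
    V x ^+ 2 + 2 * (x ord0 i * V x * partial i V x).
  have D := is_deriveM (is_deriveM (is_derive_coord i i x) (smooth_is_derive i x sV))
    (smooth_is_derive i x sV).
  apply: (etrans (@derive_val _ _ _ _ _ _ _ D)).
  by rewrite eqxx -![_ *: _]/(_ * _) !fctE /=; ring.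
have E : \int[mu]_(x in O) (V x ^+ 2) =
    - 2 * \int[mu]_(x in O) (x ord0 i * V x * partial i V x).
  have := Rintegral_partial_test O_bounded i tT.
  rewrite (_ : partial i _ = fun x => V x ^+ 2 + 2 * (x ord0 i * V x * partial i V x)).
    rewrite (RintegralD mO iV2 (integrableZ_fun O_open 2 icross)) (RintegralZl 2 mO icross).
    by move/eqP; rewrite addr_eq0 => /eqP ->; rewrite mulNr.
  by apply/funext => x; exact: pT.
have := le_Rintegral mO (integrableZ_fun O_open (- 2) icross)
  (integrableD_fun O_open (integrableZ_fun O_open 2^-1 iV2) (integrableZ_fun O_open (2 * B ^+ 2) ipV2)).
rewrite (RintegralZl _ mO icross) -E.
rewrite (RintegralD mO (integrableZ_fun O_open 2^-1 iV2) (integrableZ_fun O_open (2 * B ^+ 2) ipV2)).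
rewrite (RintegralZl _ mO iV2) (RintegralZl _ mO ipV2).
have H : forall x, O x -> - 2 * (x ord0 i * V x * partial i V x) <=
    2^-1 * V x ^+ 2 + 2 * B ^+ 2 * partial i V x ^+ 2.
  move=> x Ox.
  have xB : x ord0 i ^+ 2 <= B ^+ 2.
    rewrite -[x ord0 i ^+ 2]real_normK ?num_real// lerXn2r ?nnegrE ?addr_ge0//.
    exact: le_trans (coord_le_norm x i) (HA x Ox).
  have := sqr_ge0 (V x + 2 * (x ord0 i * partial i V x)).
  have := sqr_ge0 (partial i V x).
  nra.
by move=> /(_ H); lra.
Qed.

Lemma op_form_bound L u Du phi x (M : R) :
  (forall i j, `|opA L x i j| <= M) -> (forall i, `|opb L x ord0 i| <= M) ->
  (forall i, `|opc L x ord0 i| <= M) -> `|opd L x| <= M ->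
  `|op_form L u Du phi x| <= M * (`|u x| + \sum_i `|Du x ord0 i|) *
     (`|phi x| + \sum_i `|partial i phi x|).
Proof.
move=> HA Hb Hc Hd; set S := `|u x| + _.
have lin (F : 'I_n -> R) (e : R) : (forall i, `|F i| <= M) -> `|e| <= M ->
    `|\sum_j F j * Du x ord0 j + e * u x| <= M * S.
  move=> HF He; rewrite /S mulrDr addrC; apply: le_trans (ler_normD _ _) _.
  rewrite normrM mulr_sumr lerD ?ler_wpM2r//; apply: le_trans (ler_norm_sum _ _ _) _.
  by apply: ler_sum => j _; rewrite normrM ler_wpM2r.
have -> : op_form L u Du phi x =
  \sum_i (\sum_j opA L x i j * Du x ord0 j + opb L x ord0 i * u x) * partial i phi x
  + (\sum_i opc L x ord0 i * Du x ord0 i + opd L x * u x) * phi x.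
  by rewrite /op_form [in RHS]mulrDl addrA.
rewrite mulrDr addrC; apply: le_trans (ler_normD _ _) _; apply: lerD.
  by rewrite normrM ler_wpM2r// lin.
rewrite mulr_sumr; apply: le_trans (ler_norm_sum _ _ _) _.
by apply: ler_sum => i _; rewrite normrM ler_wpM2r// lin.
Qed.

Lemma coefficients_bound L : C1bar_coefficients O L -> exists2 M : R, 0 <= M &
  forall x, O x -> [/\ forall i j, `|opA L x i j| <= M, forall i, `|opb L x ord0 i| <= M,
  forall i, `|opc L x ord0 i| <= M & `|opd L x| <= M].
Proof.
move=> [cA cb cc cd].
have B a : C1bar O a -> exists M : R, 0 <= M /\ forall x, O x -> `|a x| <= M.
  move=> Ca; have [_ [M HM]] := C1bar_bounded_measurable O_open O_bounded Ca.
  by exists `|M|; split=> // x Ox; apply: le_trans (HM x Ox) (ler_norm _).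
have /choice[MA HMA] : forall ij : 'I_n * 'I_n, exists M : R, 0 <= M /\
    forall x, O x -> `|opA L x ij.1 ij.2| <= M by move=> ij; exact: B (cA ij.1 ij.2).
have /choice[Mb HMb] := fun i => B _ (cb i).
have /choice[Mc HMc] := fun i => B _ (cc i).
have [Md [Md0 HMd]] := B _ cd.
have SA : 0 <= \sum_ij MA ij by apply: sumr_ge0 => ij _; have [] := HMA ij.
have Sb : 0 <= \sum_i Mb i by apply: sumr_ge0 => i _; have [] := HMb i.
have Sc : 0 <= \sum_i Mc i by apply: sumr_ge0 => i _; have [] := HMc i.
have le_sum (I : finType) (F : I -> R) k : (forall i, 0 <= F i) -> F k <= \sum_i F i.
  by move=> F0; rewrite (bigD1 k)//= lerDl sumr_ge0.
exists (\sum_ij MA ij + \sum_i Mb i + \sum_i Mc i + Md); first by rewrite !addr_ge0.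
move=> x Ox; split=> [i j|i|i|].
- have [_ /(_ x Ox) H] := HMA (i, j).
  have := le_sum _ MA (i, j) (fun ij => (HMA ij).1); move: H => /=; lra.
- have [_ /(_ x Ox) H] := HMb i; have := le_sum _ Mb i (fun i => (HMb i).1); lra.
- have [_ /(_ x Ox) H] := HMc i; have := le_sum _ Mc i (fun i => (HMc i).1); lra.
- by have := HMd x Ox; lra.
Qed.

(** By linearity the form at [p] exceeds that at [w] by the form at [p - w], tested with [beta p].
    The first factor is bounded by [T], and the second by [5 * (T + Q)], as [beta p] and its
    gradient are controlled by [p] and its gradient. The constant depends on [L] alone, which leaves
    [t] and the approximation free. *)
Lemma energy_upper L : C1bar_coefficients O L -> exists2 C : R, 0 <= C &
  forall w Dw psi p (T : 'rV[R]_n -> R) (t : R),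
  L2 O w -> (forall i, L2 O (fun x => Dw x ord0 i)) -> L2 O T -> 0 < t ->
  test_function O psi -> smooth p -> (forall x, 0 < p x -> psi x != 0) ->
  (forall x, O x -> 0 < p x -> `|p x - w x| + \sum_i `|partial i p x - Dw x ord0 i| <= T x) ->
  \int[mu]_(x in O) op_form L w Dw (fun y => beta (p y)) x <= 0 ->
  \int[mu]_(x in O) op_form L p (grad p) (fun y => beta (p y)) x <=
  C * ((1 + t^-1) * \int[mu]_(x in O) (T x ^+ 2) +
       t * \int[mu]_(x in O) ((`|w x| + \sum_i `|Dw x ord0 i|) ^+ 2)).
Proof.
move=> cL; have [M M0 HM] := coefficients_bound cL.
exists (5 * M); first by rewrite mulr_ge0.
move=> w Dw psi p T t Lw LDw LT t0 tpsi sp ppsi HT form_le0.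
pose Q x := `|w x| + \sum_i `|Dw x ord0 i|.
have tv : test_function O (fun y => beta (p y)).
  exact: (test_positive_part tpsi ppsi (smooth_beta sp) (@beta_le0 R)).
have Lp := bounded_measurable_L2 O_open O_bounded (smooth_bounded_measurable O_bounded sp).
have LDp i : L2 O (fun x => grad p x ord0 i).
  rewrite (_ : (fun x => _) = partial i p); last by apply/funext => x; rewrite mxE.
  exact: (bounded_measurable_L2 O_open O_bounded
    (smooth_bounded_measurable O_bounded (smooth_partial i sp))).
have LQ : L2 O Q.
  apply: L2D => //; first exact: L2_norm.
  by apply: L2_sum => // i; exact: L2_norm.
have iw := op_form_integrable O_open O_bounded cL Lw LDw tv.
have ip := op_form_integrable O_open O_bounded cL Lp LDp tv.
have [_ iT2] := LT; have [_ iQ2] := LQ.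
have iR := integrableD_fun O_open (integrableZ_fun O_open (1 + t^-1) iT2)
  (integrableZ_fun O_open t iQ2).
have iD := integrableB_fun O_open ip iw.
rewrite -[leLHS](subrK (\int[mu]_(x in O) op_form L w Dw (fun y => beta (p y)) x)).
rewrite -[leRHS]addr0; apply: lerD => //.
rewrite -(RintegralB mO ip iw) -(RintegralZl _ mO iT2) -(RintegralZl _ mO iQ2).
rewrite -(RintegralD mO (integrableZ_fun O_open (1 + t^-1) iT2) (integrableZ_fun O_open t iQ2)).
rewrite -(RintegralZl _ mO iR).
apply: (le_Rintegral mO iD (integrableZ_fun O_open (5 * M) iR)) => x Ox.
have -> : op_form L p (grad p) (fun y => beta (p y)) x - op_form L w Dw (fun y => beta (p y)) x =
   op_form L (fun x => -1 * w x + p x) (fun x => -1 *: Dw x + grad p x) (fun y => beta (p y)) x.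
  by rewrite op_form_linear mulN1r addrC.
have [HA Hb Hc Hd] := HM x Ox.
apply: le_trans (ler_norm _) _; apply: le_trans (op_form_bound _ _ _ HA Hb Hc Hd) _.
have pbeta i : partial i (fun y => beta (p y)) x = dbeta (p x) * partial i p x.
  exact: partial_comp (@is_derive_beta R) sp.
have -> : \sum_i `|partial i (fun y => beta (p y)) x| = \sum_i `|dbeta (p x) * partial i p x|.
  by apply: eq_bigr => i _; rewrite pbeta.
(* Where [p <= 0] the test function and its gradient vanish, so closeness of [p] to [w] is required
   only where [p > 0]. *)
have [px|px] := leP (p x) 0.
  have -> : \sum_i `|dbeta (p x) * partial i p x| = 0.
    by apply: big1 => i _; rewrite dbeta_le0// mul0r normr0.
  rewrite beta_le0// normr0 addr0 mulr0 mulr_ge0 ?mulr_ge0// addr_ge0// mulr_ge0 ?sqr_ge0 ?(ltW t0)//.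
  by rewrite addr_ge0// invr_ge0 ltW.
set S := _ + \sum_i `|(-1 *: Dw x + grad p x) ord0 i|.
have ST : S <= T x.
  apply: le_trans (HT x Ox px); rewrite /S mulN1r [- w x + _]addrC.
  by rewrite lerD2l; apply: ler_sum => i _; rewrite !mxE mulN1r addrC.
have S0 : 0 <= S by rewrite addr_ge0// sumr_ge0.
have PQ : `|beta (p x)| + \sum_i `|dbeta (p x) * partial i p x| <= 5 * (S + Q x).
  rewrite ger0_norm ?beta_ge0//.
  have -> : S + Q x = (`|-1 * w x + p x| + `|w x|) +
      \sum_i (`|(-1 *: Dw x + grad p x) ord0 i| + `|Dw x ord0 i|).
    by rewrite big_split /= /S /Q; ring.
  rewrite mulrDr; apply: lerD.
    have := beta_le px; have := ler_norm (-1 * w x + p x); have := ler_norm (w x).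
    by have := normr_ge0 (w x); have := normr_ge0 (-1 * w x + p x); lra.
  rewrite mulr_sumr; apply: ler_sum => i _.
  rewrite normrM ger0_norm ?dbeta_ge0//; apply: ler_pM => //; first exact: dbeta_ge0.
    exact: dbeta_le5.
  rewrite -[leLHS](_ : `|(-1 *: Dw x + grad p x) ord0 i + Dw x ord0 i| = _); last first.
    by rewrite !mxE; congr `|_|; ring.
  exact: ler_normD.
have Q0 : 0 <= Q x by rewrite addr_ge0// sumr_ge0.
have T0 : 0 <= T x by exact: le_trans S0 ST.
apply: (@le_trans _ _ (M * T x * (5 * (T x + Q x)))).
  apply: ler_pM => //.
  - exact: mulr_ge0.
  - by rewrite addr_ge0// sumr_ge0.
  - by rewrite ler_wpM2l.
  - by apply: le_trans PQ _; lra.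
have -> : M * T x * (5 * (T x + Q x)) = 5 * M * (T x ^+ 2 + T x * Q x) by ring.
rewrite ler_wpM2l ?mulr_ge0// mulrDl mul1r -addrA lerD2l.
(* Expanded, this is Young's inequality [T * Q <= T ^ 2 / t + t * Q ^ 2]. *)
have : 0 <= t^-1 * ((T x - t * Q x) ^+ 2 + t * (T x * Q x)).
  by rewrite mulr_ge0 ?invr_ge0 ?(ltW t0)// addr_ge0 ?sqr_ge0// !mulr_ge0// ltW.
have -> : t^-1 * ((T x - t * Q x) ^+ 2 + t * (T x * Q x)) =
   t^-1 * T x ^+ 2 + t * Q x ^+ 2 - T x * Q x by field; exact: lt0r_neq0.
by rewrite subr_ge0.
Qed.

End maximum_principle.

(** * Nonnegativity of solutions with nonnegative data *)

Section comparison.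
Variables (R : realType) (n : nat) (O : set 'rV[R]_n).
Hypotheses (O_open : open O) (O_bounded : bounded_set O).
Local Notation mu := (lebesgue_rV R n).
Implicit Types (u v a phi psi p w g : 'rV[R]_n -> R) (Du Dv Dw : 'rV[R]_n -> 'rV[R]_n)
  (L : operator R n).

Let mO : measurable O. Proof. exact: open_measurable_rV. Qed.

Lemma lebesgue_rV_ball_gt0 (x : 'rV[R]_n) (r : R) : 0 < r -> (0 < mu (ball x r))%E.
Proof.
move=> r0.
have -> : ball x r = [set y | forall i, (ball (x ord0 i) r : set (measurableTypeR R)) (y ord0 i)].
  apply/seteqP; split=> y /=.
    rewrite -ball_normE /ball_ /= => xy i; rewrite -ball_normE /ball_ /=.
    by apply: le_lt_trans xy; have := coord_le_norm (x - y) i; rewrite !mxE.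
  move=> H; rewrite -ball_normE /ball_ /=; apply: rV_norm_lt => // i.
  by have := H i; rewrite -ball_normE /ball_ /= !mxE.
rewrite (@lebesgue_rV_box R n (fun i => ball (x ord0 i) r)); last first.
  by move=> i; exact: measurable_ball.
elim/big_ind: _ => // [a b a0 b0|i _]; first exact: mule_gt0.
rewrite ball_itv lebesgue_measure_itv /= lte_fin ifT; last lra.
by rewrite -EFinD lte_fin; lra.
Qed.

(** Were [F x > 0], continuity would give [F >= F x / 2] on a ball, which has positive measure. This
    turns the final integral estimate into a pointwise one. *)
Lemma continuous_Rintegral_eq0 (F : 'rV[R]_n -> R) :
  (forall x, O x -> {for x, continuous F}) -> (forall x, O x -> 0 <= F x) ->
  mu.-integrable O (EFin \o F) -> \int[mu]_(x in O) F x <= 0 ->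
  forall x, O x -> F x = 0.
Proof.
move=> cF F0 iF I0 x Ox; apply/eqP; rewrite eq_le F0// andbT leNgt; apply/negP => Fx.
have [r /= r0 Hr] : exists2 r : R, 0 < r & ball x r `<=` [set y | O y /\ F x / 2 <= F y].
  have N1 : \forall y \near x, O y by exact: open_nbhs_nbhs.
  have N2 : \forall y \near x, F x / 2 <= F y.
    have /cvgrPdist_lt/(_ (F x / 2)) := cF x Ox; rewrite divr_gt0// => /(_ isT).
    by apply: filterS => y; rewrite ltr_norml => /andP[_]; lra.
  have N : nbhs x [set y | O y /\ F x / 2 <= F y] by exact: filterI N1 N2.
  by have [r r0 Hr] := (nbhs_ballP x _).1 N; exists r.
have mB : measurable (ball x r) by apply: open_measurable_rV; exact: ball_open.
have BO : ball x r `<=` O by move=> y /Hr[].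
have iI : mu.-integrable O (EFin \o (\1_(ball x r) : 'rV[R]_n -> R)).
  apply: (bounded_measurable_integrable O_open O_bounded); split.
    exact: measurable_indic.
  by exists 1 => y _; rewrite indicE; case: (_ \in _); rewrite ?normr1 ?normr0.
have : \int[mu]_(y in O) (F x / 2 * \1_(ball x r) y) <= \int[mu]_(y in O) F y.
  apply: (le_Rintegral mO (integrableZ_fun O_open _ iI) iF) => y Oy.
  rewrite indicE; have [|_] := boolP (y \in (ball x r : set 'rV[R]_n)); last by rewrite mulr0 F0.
  by rewrite inE mulr1 => /Hr[].
rewrite (RintegralZl _ mO iI) => /le_trans/(_ I0).
apply/negP; rewrite -ltNge mulr_gt0 ?divr_gt0//.
rewrite /Rintegral integral_indic//.
have -> : ball x r `&` O = ball x r by exact/setIidl.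
apply: fine_gt0; rewrite lebesgue_rV_ball_gt0//=.
by apply: le_lt_trans (bounded_set_lebesgue_rV mO O_bounded); apply: le_measure; rewrite ?inE.
Qed.

Lemma sqr_sum_le (I : finType) (F : I -> R) :
  (\sum_i F i) ^+ 2 <= #|I|%:R * \sum_i F i ^+ 2.
Proof.
rewrite expr2 mulr_suml.
under eq_bigr do rewrite mulr_sumr.
apply: (@le_trans _ _ (\sum_i \sum_j (F i ^+ 2 + F j ^+ 2) / 2)).
  apply: ler_sum => i _; apply: ler_sum => j _.
  by have := sqr_ge0 (F i - F j); nra.
have -> : \sum_i \sum_j (F i ^+ 2 + F j ^+ 2) / 2 =
    \sum_i (#|I|%:R * F i ^+ 2 + \sum_j F j ^+ 2) / 2.
  by apply: eq_bigr => i _; rewrite -mulr_suml big_split /= sumr_const mulr_natl.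
rewrite -mulr_suml big_split /= -mulr_sumr sumr_const -[X in _ + X]mulr_natl.
lra.
Qed.

Lemma flat_lipschitz (s t : R) : `|flat s - flat t| <= `|s - t|.
Proof.
have D (b : R) : is_derive b 1 (fun r : R => r + t) 1.
  by apply: is_derive_eq (is_deriveD (is_derive_id b 1) (is_derive_cst t b 1)) _; rewrite addr0.
have := @derive_deviation R (fun r => flat (r + t)) (fun r => dflat (r + t)) (s - t) 0 1.
rewrite mul0r subr0 subrK add0r mul1r; apply=> b _; split.
  by have := @is_derive1_comp _ (@flat R) _ b _ _ (is_derive_flat (b + t)) (D b); rewrite mulr1.
by rewrite subr0 ger0_norm ?dflat_ge0 ?dflat_le1.
Qed.

Lemma op_formN L u Du phi x :
  op_form L (fun y => - u y) (fun y => - Du y) phi x = - op_form L u Du phi x.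
Proof.
(* [- u] is written as [-2 * u + u], an instance of the available linear combination. *)
have := op_form_linear L (-2) u u Du Du phi x.
have -> : (fun y => -2 * u y + u y) = (fun y => - u y) by apply/funext => y; ring.
have -> : (fun y => -2 *: Du y + Du y) = (fun y => - Du y).
  by apply/funext => y; apply/rowP => i; rewrite !mxE; ring.
by move=> ->; ring.
Qed.

(** The quantity shown to vanish is the integral [I] of [flat (- u) ^ 2]. It is compared with that
    of [flat p ^ 2], which the Poincare inequality bounds by the energy of [p], itself squeezed
    between the lower and the upper energy bounds. *)
Lemma weak_maximum_principle (alpha : R) L f g u : (0 < n)%N -> admissible alpha O L ->
  C1bar O g -> (forall x, O x -> 0 <= g x) -> (forall x, O x -> 0 <= f x) ->
  (forall x, O x -> {for x, continuous u}) ->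
  dirichlet_solution O L f g u -> forall x, O x -> 0 <= u x.
Proof.
move=> n_gt0 adm Cg g0 f0 cu [Du [Wu [Dz Wz [phi tphi cphi]] weak]].
have cL := admissible_C1bar adm.
pose i0 : 'I_n := Ordinal n_gt0.
have Wg := weak_gradient_C1bar O_open O_bounded Cg.
(* This weak gradient of [u], unlike [Du], is tied to the gradients of the approximating test
   functions. *)
have Wu2 : weak_gradient O u (fun x => 1 *: Dz x + grad g x).
  have := weak_gradient_linear O_open O_bounded 1 Wz Wg.
  by congr weak_gradient; apply/funext => x; rewrite mul1r subrK.
pose w x := - u x.
pose Dw x := - (1 *: Dz x + grad g x).
have [Lu LD2 _] := Wu2.
have Lw : L2 O w by exact: L2N.
have LDw i : L2 O (fun x => Dw x ord0 i).
  have := L2N O_open (LD2 i); congr L2; apply/funext => x; by rewrite !mxE.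
have [Lz LDz _] := Wz.
have [Lam Lam0 ell] : exists2 Lam : R, 0 < Lam &
  forall x (xi : 'rV[R]_n), O x -> xi != 0 ->
     Lam^-1 * \sum_i xi ord0 i ^+ 2 <= \sum_i \sum_j opA L x i j * xi ord0 i * xi ord0 j.
  have [_ _ [Lam Lam0 H] _ _] := adm; exists Lam => // x xi Ox xi0.
  by have /andP[] := H x xi Ox xi0.
have [CU CU0 HU] := energy_upper O_open O_bounded cL.
have [CP CP0 HP] := poincare O_open O_bounded i0.
pose m := fine (mu O).
have m0 : 0 <= m by exact: fine_ge0.
pose Q x := `|w x| + \sum_i `|Dw x ord0 i|.
have LQ : L2 O Q.
  apply: L2D => //; first exact: L2_norm.
  by apply: L2_sum => // i; exact: L2_norm.
pose B := \int[mu]_(x in O) (Q x ^+ 2).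
have B0 : 0 <= B by apply: Rintegral_ge0 => x _; exact: sqr_ge0.
pose I := \int[mu]_(x in O) (flat (w x) ^+ 2).
have iF : mu.-integrable O (EFin \o (fun x => flat (w x) ^+ 2)).
  have [mw _] := Lw.
  have mf : measurable_fun O (fun x => flat (w x)).
    apply: (measurableT_comp _ mw); apply: continuous_measurable_fun => y.
    apply/differentiable_continuous/derivable1_diffP.
    by have [] := is_derive_flat y.
  have bf : bounded_measurable O (fun x => flat (w x)).
    by split=> //; exists 1 => x _; rewrite ger0_norm ?flat_ge0 ?flat_le1.
  exact: (bounded_measurable_integrable O_open O_bounded (bounded_measurableM bf bf)).
(* Here [k] bounds the squared Sobolev distance from [u - g] to a test function, and [t] is the
   parameter of Young's inequality. *)
have main (k t : R) : 0 < k -> k <= 1 -> 0 < t ->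
    I <= 2 * (CP * (Lam * (CU * ((1 + t^-1) * (3 * (n%:R + 2) * k) + t * B)))) +
         2 * (3 * (n%:R + 2) * k).
  move=> k0 k1 t0.
  have [j Nj] : exists j, \int[mu]_(x in O) ((u x - g x - phi j x) ^+ 2) +
     \sum_i \int[mu]_(x in O) ((Dz x ord0 i - partial i (phi j) x) ^+ 2) <= k.
    have /cvgrPdist_lt/(_ k k0)[j _ /(_ j (leqnn j))] := cphi.
    rewrite sub0r normrN => Hj; exists j; apply: le_trans (ltW Hj); exact: ler_norm.
  pose a x := u x - g x - phi j x.
  pose b i x := Dz x ord0 i - partial i (phi j) x.
  have La : L2 O a := L2B O_open Lz (test_L2 O_open O_bounded (tphi j)).
  have Lb i : L2 O (b i) := L2B O_open (LDz i) (test_L2 O_open O_bounded (test_partial i (tphi j))).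
  (* With this choice [e ^ 2 * m <= k]; each of the [n + 1] errors made on [g] and its partial
     derivatives is at most [d], and together they amount to [e]. *)
  pose e := k / (1 + m).
  have m1 : 0 < 1 + m by rewrite ltr_wpDr.
  have e0 : 0 < e by rewrite divr_gt0.
  pose d := e / n.+1%:R.
  have d0 : 0 < d by rewrite divr_gt0.
  have [sphi cK KO] := tphi j.
  have [q [sq q0 q1 qpos]] := smooth_approx O_open cK KO (C1bar_C1_on O_open Cg) d0.
  have {}qpos := qpos g0.
  (* [phi j] approximates [u - g] and [q] approximates [g], so [p] approximates [w = - u]. *)
  pose p x := - phi j x - q x.
  have sp : smooth p := smoothB (smoothN sphi) sq.
  have pK x : 0 < p x -> phi j x != 0.
    by move=> px; apply/eqP => pz; move: px; rewrite /p pz; have := qpos x; clear -O_open O_bounded mO; lra.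
  pose T x := (`|a x| + \sum_i `|b i x|) + e.
  have Le : L2 O (fun=> e) := bounded_measurable_L2 O_open O_bounded (bounded_measurable_cst O e).
  have LT : L2 O T.
    apply: L2D => //; apply: L2D => //; first exact: L2_norm.
    by apply: L2_sum => // i; exact: L2_norm.
  have dne : (1 + n%:R) * d = e.
    by rewrite addrC natr1 /d mulrC divfK// pnatr_eq0.
  have pp i x : partial i p x = - partial i (phi j) x - partial i q x.
    exact: (@derive_val _ _ _ _ _ _ _
      (is_deriveB (is_deriveN (smooth_is_derive i x sphi)) (smooth_is_derive i x sq))).
  have wpa x : p x - w x = a x + (g x - q x) by rewrite /p /w /a; ring.
  have HT x : O x -> 0 < p x ->
      `|p x - w x| + \sum_i `|partial i p x - Dw x ord0 i| <= T x.
    move=> Ox /pK px; have Kx : closure [set y | phi j y != 0] x by exact: subset_closure.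
    apply: (@le_trans _ _ ((`|a x| + d) + \sum_i (`|b i x| + d))).
      apply: lerD.
        by rewrite wpa; apply: le_trans (ler_normD _ _) _; rewrite lerD2l q0.
      apply: ler_sum => i _.
      have -> : partial i p x - Dw x ord0 i = b i x + (partial i g x - partial i q x).
        by rewrite pp /Dw /b !mxE; ring.
      by apply: le_trans (ler_normD _ _) _; rewrite lerD2l q1.
    by rewrite big_split /= sumr_const card_ord -mulr_natl /T -dne; clear -O_open O_bounded mO; lra.
  have tv : test_function O (fun y => beta (p y)).
    exact: (test_positive_part (tphi j) pK (smooth_beta sp) (@beta_le0 R)).
  have form0 : \int[mu]_(x in O) op_form L w Dw (fun y => beta (p y)) x <= 0.
    have E : \int[mu]_(x in O) op_form L u Du (fun y => beta (p y)) x =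
        \int[mu]_(x in O) (f x * beta (p x)) := weak _ tv.
    have iu := op_form_integrable O_open O_bounded cL Lu LD2 tv.
    rewrite (_ : op_form L w Dw _ = fun x => -1 * op_form L u (fun x => 1 *: Dz x + grad g x)
      (fun y => beta (p y)) x); last by apply/funext => x; rewrite op_formN mulN1r.
    rewrite (RintegralZl _ mO iu) mulN1r oppr_le0.
    rewrite (Rintegral_op_form_gradient O_open O_bounded cL Wu2 Wu tv) E.
    by apply: Rintegral_ge0 => x Ox; rewrite mulr_ge0 ?f0 ?beta_ge0.
  have upper := HU w Dw (phi j) p T t Lw LDw LT t0 (tphi j) sp pK HT form0.
  have lower := energy_lower O_open O_bounded adm Lam0 ell (tphi j) sp pK.
  have tV : test_function O (fun y => flat (p y)).
    exact: (test_positive_part (tphi j) pK (smooth_flat sp) (@flat_le0 R)).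
  have bmI := bounded_measurable_integrable O_open O_bounded.
  have bms u' (su : smooth u') := smooth_bounded_measurable O_bounded su.
  have iG : mu.-integrable O (EFin \o (fun x => dbeta (p x) * \sum_i partial i p x ^+ 2)).
    apply: bmI; apply: bms; apply: smoothM (smooth_dbeta sp) _.
    exact: (smooth_sum (index_enum 'I_n) (fun i => smoothM (smooth_partial i sp) (smooth_partial i sp))).
  have idV : mu.-integrable O (EFin \o (fun x => partial i0 (fun y => flat (p y)) x ^+ 2)).
    by apply: bmI; apply: bms; apply: smoothM; exact: smooth_partial (smooth_flat sp).
  have dV : \int[mu]_(x in O) (partial i0 (fun y => flat (p y)) x ^+ 2) <=
     \int[mu]_(x in O) (dbeta (p x) * \sum_i partial i p x ^+ 2).
    apply: (le_Rintegral mO idV iG) => x Ox.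
    rewrite (partial_comp _ _ (@is_derive_flat R) sp) exprMn.
    apply: ler_pM; rewrite ?sqr_ge0 ?sqr_dflat_le_dbeta//.
    by rewrite (bigD1 i0)//= lerDl sumr_ge0// => i _; exact: sqr_ge0.
  have [_ iT2] := LT; have [_ ia2] := La.
  have ib2 i : mu.-integrable O (EFin \o (fun x => b i x ^+ 2)) by have [] := Lb i.
  have isb2 := integrable_sum_fun O_open O_bounded (index_enum 'I_n) ib2.
  have [_ ie2] := Le.
  (* The 3 comes from squaring a sum of three terms; their squares contribute [k], [n * k] (by
     Cauchy-Schwarz over the [n] derivatives) and [k]. *)
  have T2 : \int[mu]_(x in O) (T x ^+ 2) <= 3 * (n%:R + 2) * k.
    have i1 := integrableD_fun O_open (integrableD_fun O_open ia2
      (integrableZ_fun O_open n%:R isb2)) ie2.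
    apply: (@le_trans _ _ (\int[mu]_(x in O)
        (3 * ((a x ^+ 2 + n%:R * \sum_i b i x ^+ 2) + e ^+ 2)))).
      apply: (le_Rintegral mO iT2 (integrableZ_fun O_open 3 i1)) => x Ox.
      have : (\sum_i `|b i x|) ^+ 2 <= n%:R * \sum_i b i x ^+ 2.
        have := sqr_sum_le (fun i => `|b i x|); rewrite card_ord.
        by under [X in _ <= _ * X -> _]eq_bigr do rewrite real_normK ?num_real//.
      rewrite -[a x ^+ 2]real_normK ?num_real// /T.
      set A' := `|a x|; set B' := \sum_i `|b i x|; move=> HB'.
      have := sqr_ge0 (A' - B'); have := sqr_ge0 (A' - e); have := sqr_ge0 (B' - e).
      move: HB'; move: A' B' => A' B'; clear -O_open O_bounded mO; nra.
    rewrite (RintegralZl _ mO i1) (RintegralD mO (integrableD_fun O_open ia2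
      (integrableZ_fun O_open n%:R isb2)) ie2) (RintegralD mO ia2 (integrableZ_fun O_open n%:R isb2)).
    rewrite (RintegralZl _ mO isb2) (Rintegral_sum O_open O_bounded _ ib2).
    rewrite (Rintegral_cst mu mO) -/m -mulrA ler_pM2l//.
    have a20 : 0 <= \int[mu]_(x in O) (a x ^+ 2) by apply: Rintegral_ge0 => x _; exact: sqr_ge0.
    have b20 : 0 <= \sum_i \int[mu]_(x in O) (b i x ^+ 2).
      by apply: sumr_ge0 => i _; apply: Rintegral_ge0 => x _; exact: sqr_ge0.
    have em : e ^+ 2 * m <= k.
      have -> : e ^+ 2 * m = e * (e * m) by ring.
      apply: (@le_trans _ _ (e * k)).
        by rewrite ler_pM2l// /e mulrAC ler_pdivrMr// ler_pM2l// lerDr.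
      apply: (@le_trans _ _ (1 * k)); last by rewrite mul1r.
      by rewrite ler_pM2r// /e ler_pdivrMr// mul1r (le_trans k1)// lerDl.
    have nb : n%:R * \sum_i \int[mu]_(x in O) (b i x ^+ 2) <= n%:R * k.
      by rewrite ler_wpM2l//; move: Nj a20; rewrite /a /b; clear -O_open O_bounded mO; lra.
    by move: Nj nb b20 em; rewrite /a /b; clear -O_open O_bounded mO; lra.
  (* On the support of [phi j] this is the Lipschitz bound. Off it [q] need not approximate [g], but
     [phi j x = 0] and [g x >= 0] give [w x <= |a x|]. *)
  have flatT x : O x -> flat (w x) <= flat (p x) + T x.
    move=> Ox; have T0 : `|a x| + e <= T x.
      by rewrite /T lerD2r lerDl sumr_ge0.
    have [Kx|nK] := pselect (closure [set y | phi j y != 0] x).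
      have := ler_normD (a x) (g x - q x); have := q0 x Kx.
      have := ler_norm (flat (w x) - flat (p x)).
      have : d <= e by rewrite -dne ler_peMl ?(ltW d0)// lerDl.
      have := flat_lipschitz (p x) (w x); rewrite wpa distrC.
      move: T0; clear -O_open O_bounded mO; lra.
    have [w0|w0] := leP (w x) 0.
      rewrite (flat_le0 w0) addr_ge0 ?flat_ge0//.
      by apply: le_trans T0; rewrite addr_ge0// ltW.
    have := flat_le_id w0; have := flat_ge0 (p x).
    have : w x <= `|a x|.
      have -> : w x = - a x - g x by rewrite /w /a (eq0_outside_support nK); ring.
      by have := ler_norm (- a x); rewrite normrN; have := g0 x Ox; clear -O_open O_bounded mO; lra.
    move: T0 (ltW e0); clear -O_open O_bounded mO; lra.
  have iV2 : mu.-integrable O (EFin \o (fun x => flat (p x) ^+ 2)).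
    by apply: bmI; apply: bms; exact: smoothM (smooth_flat sp) (smooth_flat sp).
  have I1 : I <= 2 * \int[mu]_(x in O) (flat (p x) ^+ 2) + 2 * \int[mu]_(x in O) (T x ^+ 2).
    rewrite -(RintegralZl _ mO iV2) -(RintegralZl _ mO iT2).
    rewrite -(RintegralD mO (integrableZ_fun O_open 2 iV2) (integrableZ_fun O_open 2 iT2)).
    apply: (le_Rintegral mO iF (integrableD_fun O_open (integrableZ_fun O_open 2 iV2)
      (integrableZ_fun O_open 2 iT2))) => x Ox.
    have := flatT x Ox; have := flat_ge0 (w x); have := sqr_ge0 (flat (p x) - T x).
    have := flat_ge0 (p x); clear -O_open O_bounded mO; nra.
  apply: le_trans I1 _; apply: lerD; last by rewrite ler_pM2l.
  rewrite ler_pM2l//; apply: le_trans (HP _ tV) _; rewrite ler_wpM2l//.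
  apply: le_trans dV _; rewrite -ler_pdivrMl//.
  apply: le_trans lower _; apply: le_trans upper _; rewrite ler_wpM2l// lerD2r.
  by rewrite ler_wpM2l// addr_ge0// invr_ge0 ltW.
have I0 : I <= 0.
  rewrite leNgt; apply/negP => I_gt0.
  pose c : R := 3 * (n%:R + 2).
  have c0 : 0 <= c by rewrite mulr_ge0// addr_ge0.
  pose A := 2 * (CP * (Lam * (CU * (2 * c + B)))) + 2 * c.
  have A0 : 0 <= A by rewrite addr_ge0 ?mulr_ge0 ?addr_ge0 ?mulr_ge0 ?(ltW Lam0).
  have D0 : 0 < A + 1 + I by rewrite addr_gt0// ltr_wpDl.
  (* With [k = s ^ 2] and [t = s] the estimate reads [I <= s * A], which this value of [s]
     contradicts, since [s * A < I]. *)
  pose s := I / (A + 1 + I).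
  have s0 : 0 < s by rewrite divr_gt0.
  have s1 : s <= 1 by rewrite ler_pdivrMr// mul1r lerDr addr_ge0.
  have IsA : I <= s * A.
    apply: le_trans (main (s ^+ 2) s _ _ s0) _; rewrite ?exprn_gt0 ?exprn_ile1 ?(ltW s0)//.
    rewrite -/c.
    have -> : (1 + s^-1) * (c * s ^+ 2) + s * B = s * ((s + 1) * c + B).
      by field; exact: lt0r_neq0.
    have -> : s * A = 2 * (CP * (Lam * (CU * (s * (2 * c + B))))) + 2 * (c * s).
      by rewrite /A; ring.
    apply: lerD; last by rewrite ler_pM2l// ler_wpM2l// expr2 ler_piMl// ltW.
    rewrite ler_pM2l// ler_wpM2l// ler_wpM2l ?(ltW Lam0)// ler_wpM2l// ler_pM2l//.
    by rewrite lerD2r ler_wpM2r//; lra.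
  move: IsA; apply/negP; rewrite -ltNge /s mulrAC ltr_pdivrMr// ltr_pM2l//.
  by lra.
move=> x Ox.
have cF y : O y -> {for y, continuous (fun x => flat (w x) ^+ 2)}.
  move=> Oy; have cw : {for y, continuous w} by apply: continuousN; exact: cu.
  have cf : {for y, continuous (fun x => flat (w x))}.
    apply: (@continuous_comp _ _ _ w (@flat R) y cw).
    apply/differentiable_continuous/derivable1_diffP.
    by have [] := is_derive_flat (w y).
  exact: (continuousM cf cf).
have := @continuous_Rintegral_eq0 (fun x => flat (w x) ^+ 2) cF (fun y _ => sqr_ge0 _) iF I0 x Ox.
move/eqP; rewrite sqrf_eq0 => /eqP fw0.
have := leP (w x) 0; case; first by rewrite /w oppr_le0.
by move=> /flat_gt0; rewrite fw0 ltxx.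
Qed.

End comparison.

(** * Superposition and continuous functions on the closure *)

Section linearity.
Variables (R : realType) (n : nat) (O : set 'rV[R]_n).
Hypotheses (O_open : open O) (O_bounded : bounded_set O).
Local Notation mu := (lebesgue_rV R n).
Implicit Types (u v a phi psi f g : 'rV[R]_n -> R) (Du Dv : 'rV[R]_n -> 'rV[R]_n)
  (L : operator R n).

Let mO : measurable O. Proof. exact: open_measurable_rV. Qed.

Lemma Rintegral_sqr_linear (c : R) u v : L2 O u -> L2 O v ->
  \int[mu]_(x in O) ((c * u x + v x) ^+ 2) <=
  2 * c ^+ 2 * \int[mu]_(x in O) (u x ^+ 2) + 2 * \int[mu]_(x in O) (v x ^+ 2).
Proof.
move=> Lu Lv; have [_ iu] := Lu; have [_ iv] := Lv.
have [_ iuv] := L2D O_open (L2Z O_open c Lu) Lv.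
have iu' := integrableZ_fun O_open (2 * c ^+ 2) iu.
have iv' := integrableZ_fun O_open 2 iv.
rewrite -(RintegralZl _ mO iu) -(RintegralZl _ mO iv) -(RintegralD mO iu' iv').
apply: (le_Rintegral mO iuv (integrableD_fun O_open iu' iv')) => x _.
rewrite -subr_ge0 (_ : _ - _ = (c * u x - v x) ^+ 2) ?sqr_ge0//; ring.
Qed.

Lemma W12_0_linear (c : R) u v : W12_0 O u -> W12_0 O v ->
  W12_0 O (fun x => c * u x + v x).
Proof.
move=> [Du Wu [phi tphi cphi]] [Dv Wv [psi tpsi cpsi]].
exists (fun x => c *: Du x + Dv x); first exact: weak_gradient_linear.
exists (fun j x => c * phi j x + psi j x).
  by move=> j; apply: testD => //; exact: (testM (tphi j) (@smooth_cst R n c)).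
have [Lu LDu _] := Wu; have [Lv LDv _] := Wv.
pose Nu j := \int[mu]_(x in O) ((u x - phi j x) ^+ 2) +
  \sum_i \int[mu]_(x in O) ((Du x ord0 i - partial i (phi j) x) ^+ 2).
pose Nv j := \int[mu]_(x in O) ((v x - psi j x) ^+ 2) +
  \sum_i \int[mu]_(x in O) ((Dv x ord0 i - partial i (psi j) x) ^+ 2).
have cu : Nu @ \oo --> (0 : R) := cphi.
have cv : Nv @ \oo --> (0 : R) := cpsi.
have cN : (fun j => 2 * c ^+ 2 * Nu j + 2 * Nv j) @ \oo --> (2 * c ^+ 2 * 0 + 2 * 0 : R).
  move: (Nu) (Nv) cu cv => F1 F2 c1 c2.
  exact: (cvgD (cvgM (cvg_cst _) c1) (cvgM (cvg_cst _) c2)).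
rewrite !mulr0 addr0 in cN.
apply: (squeeze_cvgr _ (cvg_cst 0) cN); apply: nearW => j.
apply/andP; split.
  by rewrite addr_ge0 ?sumr_ge0// => *; apply: Rintegral_ge0 => x _; exact: sqr_ge0.
have pE i x : partial i (fun x => c * phi j x + psi j x) x =
    c * partial i (phi j) x + partial i (psi j) x.
  exact: (@derive_val _ _ _ _ _ _ _ (is_deriveD
    (is_deriveZ c (smooth_is_derive i x (test_smooth (tphi j))))
    (smooth_is_derive i x (test_smooth (tpsi j))))).
have Lphi := test_L2 O_open O_bounded (tphi j).
have Lpsi := test_L2 O_open O_bounded (tpsi j).
have Lpphi i := test_L2 O_open O_bounded (test_partial i (tphi j)).
have Lppsi i := test_L2 O_open O_bounded (test_partial i (tpsi j)).
rewrite /Nu /Nv !mulrDr !mulr_sumr addrACA -big_split /=; apply: lerD.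
  have := Rintegral_sqr_linear c (L2B O_open Lu Lphi) (L2B O_open Lv Lpsi).
  by congr (_ <= _); congr Rintegral; apply/funext => x; congr (_ ^+ 2); ring.
apply: ler_sum => i _.
have := Rintegral_sqr_linear c (L2B O_open (LDu i) (Lpphi i)) (L2B O_open (LDv i) (Lppsi i)).
congr (_ <= _); congr Rintegral; apply/funext => x; rewrite pE !mxE.
by congr (_ ^+ 2); ring.
Qed.

Lemma dirichlet_solution_linear (c : R) L f1 f2 g1 g2 u1 u2 : C1bar_coefficients O L ->
  bounded_measurable O f1 -> bounded_measurable O f2 ->
  dirichlet_solution O L f1 g1 u1 -> dirichlet_solution O L f2 g2 u2 ->
  dirichlet_solution O L (fun x => c * f1 x + f2 x) (fun x => c * g1 x + g2 x)
    (fun x => c * u1 x + u2 x).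
Proof.
move=> cL bf1 bf2 [D1 [W1 Z1 E1]] [D2 [W2 Z2 E2]].
exists (fun x => c *: D1 x + D2 x); split; first exact: weak_gradient_linear.
  have := W12_0_linear c Z1 Z2; congr W12_0; apply/funext => x; ring.
move=> phi tphi; have [L1 LD1 _] := W1; have [L2' LD2 _] := W2.
have i1 := op_form_integrable O_open O_bounded cL L1 LD1 tphi.
have i2 := op_form_integrable O_open O_bounded cL L2' LD2 tphi.
have bphi := test_bounded_measurable O_bounded tphi.
have j1 := bounded_measurable_integrable O_open O_bounded (bounded_measurableM bf1 bphi).
have j2 := bounded_measurable_integrable O_open O_bounded (bounded_measurableM bf2 bphi).
rewrite [RHS](_ : _ = c * \int[mu]_(x in O) (f1 x * phi x) + \int[mu]_(x in O) (f2 x * phi x)).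
  rewrite -E1// -E2//.
  rewrite -(RintegralZl c mO i1) -(RintegralD mO (integrableZ_fun O_open c i1) i2).
  congr Rintegral; apply/funext => x; exact: op_form_linear.
rewrite -(RintegralZl c mO j1) -(RintegralD mO (integrableZ_fun O_open c j1) j2).
by congr Rintegral; apply/funext => x; ring.
Qed.

End linearity.

(** * Continuity up to the boundary *)

Section closure_extension.
Variables (R : realType) (n : nat) (O : set 'rV[R]_n).
Implicit Types (w : 'rV[R]_n -> R).

Lemma Cbar_ge0 w : Cbar O w -> (forall x, O x -> 0 <= w x) ->
  forall x, closure O x -> 0 <= w x.
Proof.
move=> /subspace_continuousP cw w0 x Ox; rewrite leNgt; apply/negP => wx.
have /cvgrPdist_lt/(_ (- w x)) := cw x Ox; rewrite oppr_gt0 => /(_ wx) N.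
have [y [Oy]] := Ox _ N.
move=> /(_ (subset_closure Oy)); rewrite ltr_norml => /andP[H _].
by move: H; rewrite opprK ltrDl oppr_gt0 ltNge w0.
Qed.

Lemma mx_norm_lt m k (M : 'M[R]_(m, k)) (e : R) : 0 < e -> (forall i j, `|M i j| < e) ->
  `|M| < e.
Proof.
by move=> e0 Me; rewrite /Num.norm /= mx_normrE; apply: bigmax_lt => // -[i j] _; exact: Me.
Qed.

Lemma within_continuous_mx m k (A : set 'rV[R]_n) (M : 'rV[R]_n -> 'M[R]_(m, k)) :
  (forall i j, {within A, continuous (fun x => M x i j)}) -> {within A, continuous M}.
Proof.
move=> cM; apply/subspace_continuousP => x Ax; apply/cvgrPdist_lt => e e0.
have N i j : \forall y \near within A (nbhs x), `|M x i j - M y i j| < e.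
  have /subspace_continuousP/(_ x Ax)/cvgrPdist_lt := cM i j.
  exact.
have FF : Filter (within A (nbhs x)) by exact: within_filter.
have := filter_forall FF (fun i => filter_forall FF (N i)).
apply: filterS => y H; apply: mx_norm_lt => // i j.
by rewrite !mxE; exact: H.
Qed.

(** Every point of [closure O] is a limit of points of [O], so the limit defining [gradbar] is the
    value of the continuous extension. *)
Lemma gradbar_continuous w : C1bar O w -> {within closure O, continuous (gradbar O w)}.
Proof.
move=> [_ _ [g cg Hg]].
have E x : closure O x -> gradbar O w x = g x.
  move=> Ox; have /subspace_continuousP/(_ x Ox) cgx := cg.
  have PF : ProperFilter (within O (nbhs x)) by exact: within_nbhs_proper.
  apply: cvg_lim; first exact: norm_hausdorff.
  have : g @ within O (nbhs x) --> g x.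
    apply: cvg_trans cgx; apply: cvg_app; apply: within_subset; exact: subset_closure.
  apply: cvg_trans; apply: near_eq_cvg.
  have := withinT O (nbhs_filter x).
  by apply: filterS => y /Hg.
have := cg; apply: subspace_eq_continuous.
by move=> x; rewrite inE => /E.
Qed.

End closure_extension.

Section supremum_norm.
Variables (R : realType) (m n : nat) (O : set 'rV[R]_n).
Hypothesis O_bounded : bounded_set O.
Implicit Types (w : 'rV[R]_n -> R) (u : 'rV[R]_n -> 'rV[R]_m).

Lemma le_supnorm w x : Cbar O w -> closure O x -> `|w x| <= supnorm O w.
Proof.
move=> cw Ox; apply: ub_le_sup; last by exists x.
have [M HM] := Cbar_bounded O_bounded cw.
by exists M => _ [y Oy <-]; exact: HM.
Qed.

Lemma supnorm_le w (c : R) x : closure O x -> (forall y, closure O y -> `|w y| <= c) ->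
  supnorm O w <= c.
Proof.
move=> Ox wc; apply: ge_sup; first by exists `|w x|; exists x.
by move=> _ [y Oy <-]; exact: wc.
Qed.

(** The first alternative is the default value of the maximum. *)
Lemma supnormv_attained u : supnormv O u = 0 \/
  exists k, supnormv O u = supnorm O (component u k).
Proof.
rewrite /supnormv; elim/big_ind: _ => [|a b Ha Hb|k _]; first by left.
  by case: (leP a b).
by right; exists k.
Qed.

Lemma le_supnormv u k : supnorm O (component u k) <= supnormv O u.
Proof. exact: (le_bigmax _ (fun j => supnorm O (component u j)) k). Qed.

End supremum_norm.

Lemma C1bar_cst (R : realType) (n : nat) (O : set 'rV[R]_n) (c : R) : C1bar O (fun=> c).
Proof.
split.
- by apply: continuous_subspaceT; exact: cst_continuous.
- by move=> x i _; exact: derivable_cst.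
- exists (fun=> 0); first by apply: continuous_subspaceT; exact: cst_continuous.
  by move=> x _; apply/rowP => i; rewrite !mxE /partial derive_cst.
Qed.

(** [F] is continuous only on the constrained set; membership of [u] in [Pset] keeps the triple
    formed by [y], [u y] and the Jacobian inside it. *)
Lemma nemytskii_continuous (R : realType) (m n : nat) (O : set 'rV[R]_n) (rho : 'I_m -> R)
  (F : 'rV[R]_n -> 'rV[R]_m -> 'M[R]_(m, n) -> R) (u : 'rV[R]_n -> 'rV[R]_m) :
  {within [set p : 'rV[R]_n * 'rV[R]_m * 'M[R]_(m, n) |
     [/\ closure O p.1.1, Ibox rho p.1.2 & Rbox rho p.2]],
     continuous (fun p => F p.1.1 p.1.2 p.2)} ->
  Pset O rho u -> Cbar O (fun y => F y (u y) (jac O u y)).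
Proof.
move=> /subspace_continuousP cF [Cu uP].
have cu : {within closure O, continuous u}.
  by apply: within_continuous_mx => i j; rewrite ord1; have [] := Cu j.
have cj : {within closure O, continuous (jac O u)}.
  apply: within_continuous_mx => k i.
  rewrite (_ : (fun x => _) = fun x => gradbar O (component u k) x ord0 i); last first.
    by apply/funext => x; rewrite mxE.
  have cg := gradbar_continuous (Cu k).
  move=> x; apply: (@continuous_comp _ _ _ (gradbar O (component u k) : subspace (closure O) -> _)
    (fun y : 'rV[R]_n => y ord0 i)); first exact: cg.
  exact: coord_continuous.
apply/subspace_continuousP => x Ox.
have [Ix Rx] := uP x Ox.
have FF : Filter (within (closure O) (nbhs x)) by exact: within_filter.
have c1 : id @ within (closure O) (nbhs x) --> x by exact: cvg_within.
have /subspace_continuousP/(_ x Ox) c2 := cu.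
have /subspace_continuousP/(_ x Ox) c3 := cj.
have c12 : (fun y => (y, u y)) @ within (closure O) (nbhs x) --> (x, u x).
  exact: cvg_pair c1 c2.
have c123 : (fun y => (y, u y, jac O u y)) @ within (closure O) (nbhs x) -->
    (x, u x, jac O u x).
  exact: cvg_pair c12 c3.
move=> B FB.
have N := c123 _ (cF (x, u x, jac O u x) (And3 Ox Ix Rx) B FB).
have W : within (closure O) (nbhs x) (closure O) := withinT _ (nbhs_filter x).
have := @filterI _ _ FF _ _ N W.
apply: (@filterS _ _ FF) => y [Hy Oy]; have [Iy Ry] := uP y Oy.
by apply: Hy; split.
Qed.

(** * Vanishing of nonnegative solutions by a strict supremum-norm estimate *)

Theorem theorem3p5 (R : realType) (m n : nat) (m_gt0 : (0 < m)%N)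
  (n_gt0 : (0 < n)%N) (alpha : R) (alpha01 : 0 < alpha < 1)
  (O : set 'rV[R]_n) (O_open : open O) (O_bounded : bounded_set O)
  (O_connected : connected O) (O_C1a : C1a_domain alpha O)
  (L : 'I_m -> operator R n)
  (L_admissible : forall k, admissible alpha O (L k))
  (f : 'I_m -> 'rV[R]_n -> 'rV[R]_m -> 'M[R]_(m, n) -> R)
  (h : 'I_m -> ('rV[R]_n -> 'rV[R]_m) -> R)
  (zeta : 'I_m -> 'rV[R]_n -> R)
  (zeta_C1a : forall k, C1abar alpha O (zeta k))
  (zeta_ge0 : forall k x, O x -> 0 <= zeta k x)
  (lambda eta : 'I_m -> R)
  (lambda_ge0 : forall k, 0 <= lambda k) (eta_ge0 : forall k, 0 <= eta k)
  (G : 'I_m -> ('rV[R]_n -> R) -> 'rV[R]_n -> R)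
  (G_green : forall k, green_operator alpha O (L k) (G k))
  (gamma : 'I_m -> 'rV[R]_n -> R)
  (gamma_C1a : forall k, C1abar alpha O (gamma k))
  (gamma_sol : forall k,
     dirichlet_solution O (L k) (fun=> 0) (zeta k) (gamma k))
  (rho : 'I_m -> R) (rho_gt0 : forall k, 0 < rho k)
  (tau : 'I_m -> R) (tau_gt0 : forall k, 0 < tau k)
  (xi : 'I_m -> R) (xi_gt0 : forall k, 0 < xi k)
  (f_cont : forall k,
     {within [set p : 'rV[R]_n * 'rV[R]_m * 'M[R]_(m, n) |
                [/\ closure O p.1.1, Ibox rho p.1.2 & Rbox rho p.2]],
       continuous (fun p => f k p.1.1 p.1.2 p.2)})
  (f_bound : forall k x z w, closure O x -> Ibox rho z -> Rbox rho w ->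
     0 <= f k x z w <= tau k * z ord0 k)
  (h_cont : forall k, continuous_on_C1 O (Pset O rho) (h k))
  (h_bound : forall k u, Pset O rho u -> h k u <= xi k * supnormv O u)
  (small : forall k,
     lambda k * tau k * supnorm O (G k (fun=> 1))
     + eta k * xi k * supnorm O (gamma k) < 1) :
  forall u : 'rV[R]_n -> 'rV[R]_m,
    Pset O rho u -> weak_solution O f h lambda eta G gamma u ->
    forall x, closure O x -> u x = 0.
Proof.
move=> u Pu [Cu uE] x0 Ox0.
have cL k := admissible_C1bar (L_admissible k).
have cu k : Cbar O (component u k) by have [] := Cu k.
have u_ge0 k x : closure O x -> 0 <= u x ord0 k.
  by move=> Ox; have [_ /(_ x Ox)[/(_ k)/andP[]]] := Pu.
pose s := supnormv O u.
have u_le k x : closure O x -> `|u x ord0 k| <= s.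
  by move=> Ox; apply: le_trans (le_supnorm O_bounded (cu k) Ox) (le_supnormv O u k).
have s_ge0 : 0 <= s by apply: le_trans (u_le (Ordinal m_gt0) x0 Ox0).
suff s_le0 : s <= 0.
  apply/rowP => k; rewrite mxE; apply/eqP; rewrite -normr_le0.
  exact: le_trans (u_le k x0 Ox0) s_le0.
rewrite leNgt; apply/negP => s_gt0.
have bound k : supnorm O (component u k) <=
    (lambda k * tau k * supnorm O (G k (fun=> 1)) + eta k * xi k * supnorm O (gamma k)) * s.
  pose Fk y := f k y (u y) (jac O u y).
  have cF : Cbar O Fk by exact: nemytskii_continuous (f_cont k) Pu.
  have Fk_bound y : closure O y -> 0 <= Fk y <= tau k * s.
    move=> Oy; have [_ /(_ y Oy)[Iy Ry]] := Pu.
    have /andP[F0 F1] := f_bound k y (u y) (jac O u y) Oy Iy Ry.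
    rewrite F0; apply: le_trans F1 _; rewrite ler_pM2l//.
    exact: le_trans (ler_norm _) (u_le k y Oy).
  have c1 : Cbar O (fun=> 1 : R) by have [] := C1bar_cst O (1 : R).
  have [[CGF _] SGF] := G_green k Fk cF.
  have [[CG1 _] SG1] := G_green k _ c1.
  have ts0 : 0 < tau k * s by rewrite mulr_gt0.
  (* The function [G 1 - G Fk / (tau k * s)] has right-hand side [1 - Fk / (tau k * s) >= 0] and
     zero boundary data, so the maximum principle gives the comparison; [s > 0] allows the
     division. *)
  pose c : R := - (tau k * s)^-1.
  have bF : bounded_measurable O Fk by exact: Cbar_bounded_measurable.
  have S := dirichlet_solution_linear O_open O_bounded c (cL k) bF
    (bounded_measurable_cst O 1) SGF SG1.
  have cv : Cbar O (fun x => c * G k Fk x + G k (fun=> 1) x).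
    have [c_GF _ _] := CGF; have [c_G1 _ _] := CG1.
    move=> z; apply: cvgD; last exact: c_G1.
    by apply: cvgM; [exact: cvg_cst|exact: c_GF].
  have G_le y : closure O y -> G k Fk y <= tau k * s * G k (fun=> 1) y.
    move=> Oy; have : 0 <= c * G k Fk y + G k (fun=> 1) y.
      apply: (Cbar_ge0 cv _ Oy) => z Oz.
      apply: (weak_maximum_principle O_open O_bounded n_gt0 (L_admissible k)
        (C1bar_cst O (c * 0 + 0)) _ _ _ S) => // [z' _|z' Oz'|z' Oz'].
      - by rewrite mulr0 addr0.
      - have /andP[_ F1] := Fk_bound z' (subset_closure Oz').
        by rewrite /c mulNr addrC subr_ge0 mulrC ler_pdivrMr// mul1r.
      - apply: continuousD; last exact: C1bar_continuous CG1 Oz'.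
        by apply: continuousM; [exact: cst_continuous|exact: C1bar_continuous CGF Oz'].
    by rewrite /c mulNr addrC subr_ge0 mulrC ler_pdivrMr// [_ * (tau k * s)]mulrC.
  have gamma_ge0 y : closure O y -> 0 <= gamma k y.
    have [[cg _ _] _] := gamma_C1a k; apply: (Cbar_ge0 cg).
    have [Cz _] := zeta_C1a k; have [Cg _] := gamma_C1a k.
    apply: (weak_maximum_principle O_open O_bounded n_gt0 (L_admissible k) Cz (zeta_ge0 k) _ _
      (gamma_sol k)) => //.
    by move=> z Oz; exact: C1bar_continuous Cg Oz.
  apply: (supnorm_le Ox0) => y Oy; rewrite ger0_norm ?u_ge0//.
  rewrite [leLHS](uE k y Oy).
  rewrite mulrDl; apply: lerD.
    rewrite -!mulrA ler_wpM2l//; apply: le_trans (G_le y Oy) _.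
    rewrite -mulrA ler_pM2l// mulrC ler_pM2r//.
    have [cG1 _ _] := CG1.
    exact: le_trans (ler_norm _) (le_supnorm O_bounded cG1 Oy).
  rewrite -!mulrA ler_wpM2l//.
  have [[cg _ _] _] := gamma_C1a k.
  have gle := le_trans (ler_norm _) (le_supnorm O_bounded cg Oy).
  (* As [gamma k y >= 0], the one-sided bound on [h k u] can be multiplied through, whatever the
     sign of [h k u]. *)
  apply: (@le_trans _ _ (gamma k y * (xi k * s))).
    by rewrite ler_wpM2l ?gamma_ge0// h_bound.
  by rewrite mulrCA ler_pM2l// ler_pM2r.
(* For the component realizing the norm, [bound k] reads [s <= c * s] with [c < 1], impossible for
   [s > 0]. *)
have [s0|[k sk]] := supnormv_attained O u; first by move: s_gt0; rewrite /s s0 ltxx.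
have := bound k; rewrite -sk -/s leNgt => /negP; apply.
by rewrite gtr_pMl.
Qed.
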